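(* Let $K\subseteq\mathbb{R}^{n\times n}_{\mathrm{sym}}$ be compact and nonempty, and let $1<p<q<\infty$. Then $K^{(p)}=K^{(q)}$.
   Context: $\mathbb{R}^{n\times n}_{\mathrm{sym}}$ is the space of real symmetric $n\times n$ matrices with the Euclidean (Frobenius) norm. $C^\infty_{\mathrm{per}}((0,1)^n;V)$ denotes the set of $\varphi\in C^\infty(\mathbb{R}^n;V)$ with $\varphi(x+e_i)=\varphi(x)$ for $i=1,\dots,n$. The divergence of a matrix field acts row-wise: $(\mathrm{div}\,\varphi)_i=\sum_j\partial_j\varphi_{ij}$. For $f:\mathbb{R}^{n\times n}_{\mathrm{sym}}\to\mathbb{R}$, the symmetric $\mathrm{div}$-quasiconvex envelope is $$\mathcal{Q}_{\mathrm{sdqc}}f(\xi):=\inf\Big\{\int_{(0,1)^n}f(\varphi)\,dx:\ \varphi\in C^\infty_{\mathrm{per}}((0,1)^n;\mathbb{R}^{n\times n}_{\mathrm{sym}}),\ \mathrm{div}\,\varphi=0,\ \int_{(0,1)^n}\varphi\,dx=\xi\Big\}.$$ For $r\in[1,\infty)$ let $f_r(\xi):=\mathrm{dist}^r(\xi,K)$ and $K^{(r)}:=\{\xi\in\mathbb{R}^{n\times n}_{\mathrm{sym}}:\mathcal{Q}_{\mathrm{sdqc}}f_r(\xi)=0\}$. *)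

(* Defs.v *)
From HB Require Import structures.
From mathcomp Require Import all_boot all_order all_algebra.
From mathcomp Require Import all_classical all_reals all_analysis.

Set Implicit Arguments.
Unset Strict Implicit.
Unset Printing Implicit Defensive.

Import Order.TTheory GRing.Theory Num.Theory.
Import numFieldNormedType.Exports.
Local Open Scope classical_set_scope.
Local Open Scope ring_scope.

(* The library has no Lebesgue measure on R^n.  It is built on n.-tuple R
   (with the library's product sigma-algebra) as the n-fold product of the
   one-dimensional one. *)
Definition tcons (T : Type) (n : nat) (u : T * n.-tuple T) : n.+1.-tuple T :=
  [tuple of u.1 :: u.2].

Lemma measurable_tcons d (T : measurableType d) (n : nat) :
  measurable_fun [set: T * n.-tuple T] (@tcons T n).
Proof. exact: measurable_cons. Qed.

Section cons_measure.
Context d (T : measurableType d) (R : realType) (n : nat).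
Variable m1 : {sigma_finite_measure set T -> \bar R}.
Variable m : {sigma_finite_measure set (n.-tuple T) -> \bar R}.

Definition cons_measure : set (n.+1.-tuple T) -> \bar R :=
  pushforward (m1 \x m)%E (@tcons T n).

Let cons_measure0 : cons_measure set0 = 0%E.
Proof. by rewrite /cons_measure /pushforward preimage_set0 measure0. Qed.

Let cons_measure_ge0 A : (0 <= cons_measure A)%E.
Proof. by rewrite /cons_measure /pushforward measure_ge0. Qed.

Let cons_measure_sigma_additive : semi_sigma_additive cons_measure.
Proof.
move=> F mF tF mUF; rewrite /cons_measure /pushforward preimage_bigcup.
apply: measure_semi_sigma_additive.
- by move=> i; rewrite -[X in measurable X]setTI; exact: measurable_tcons.
- apply/trivIsetP => /= i j _ _ ij; rewrite -preimage_setI.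
  by move/trivIsetP : tF => /(_ _ _ _ _ ij) ->//; rewrite preimage_set0.
- rewrite -preimage_bigcup -[X in measurable X]setTI.
  exact: measurable_tcons.
Qed.

HB.instance Definition _ := isMeasure.Build _ _ _ cons_measure
  cons_measure0 cons_measure_ge0 cons_measure_sigma_additive.

Let cons_measure_sigma_finite : sigma_finite setT cons_measure.
Proof.
have /sigma_finiteP[F [FT ndF Ffin]] := sigma_finiteT m1.
have /sigma_finiteP[G [GT ndG Gfin]] := sigma_finiteT m.
pose H k := [set t : n.+1.-tuple T |
  F k (thead t) /\ G k [tuple of behead t]].
exists H.
  apply/esym; rewrite -subTset => t _.
  have [k _ Fk] : (\bigcup_k F k) (thead t) by rewrite -FT.
  have [l _ Gl] : (\bigcup_k G k) [tuple of behead t] by rewrite -GT.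
  exists (maxn k l) => //; split.
    by move: Fk; exact/subsetPset/ndF/leq_maxl.
  by move: Gl; exact/subsetPset/ndG/leq_maxr.
move=> k; have [mF oF] := Ffin k; have [mG oG] := Gfin k; split.
  apply: measurableI; rewrite -[X in measurable X]setTI.
    exact: measurable_tnth.
  exact: measurable_behead.
rewrite /cons_measure /pushforward.
have -> : @tcons T n @^-1` H k = F k `*` G k.
  apply/seteqP; split => -[x t] /=; rewrite /H /tcons /= theadE.
    by have -> : [tuple of behead [tuple of x :: t]] = t by exact/val_inj.
  by have -> : [tuple of behead [tuple of x :: t]] = t by exact/val_inj.
by rewrite product_measure1E// lte_mul_pinfty// ge0_fin_numE.
Qed.

HB.instance Definition _ := Measure_isSigmaFinite.Build _ _ _ cons_measure
  cons_measure_sigma_finite.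

End cons_measure.

Fixpoint lebesgue_tuple (R : realType) (n : nat) :
    {sigma_finite_measure set (n.-tuple (measurableTypeR R)) -> \bar R} :=
  match n with
  | 0 => dirac [tuple]
  | n'.+1 => cons_measure (@lebesgue_measure R) (lebesgue_tuple R n')
  end.

Section sdqc.
Context {R : realType}.

Definition unit_cube {n : nat} : set (n.-tuple (measurableTypeR R)) :=
  [set t | forall i : 'I_n, 0 < (tnth t i : R) < 1].

(* R^n is n.-tuple R for the measure and 'rV[R]_n for the derivatives. *)
Definition cube_integral (n : nat) (g : 'rV[R]_n -> R) : \bar R :=
  (\int[lebesgue_tuple R n]_(t in unit_cube) (g (\row_i tnth t i))%:E)%E.

Definition evec (n : nat) (i : 'I_n) : 'rV[R]_n := delta_mx ord0 i.

(* C^k: all iterated partial derivatives of order at most k exist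
   everywhere and are continuous. *)
Fixpoint Ck (V : normedModType R) (n k : nat) (f : 'rV[R]_n -> V) : Prop :=
  continuous f /\
  match k with
  | 0 => True
  | k'.+1 => forall i : 'I_n, (forall x, derivable f x (evec i)) /\
                              Ck k' ('D_(evec i) f)
  end.

Definition smooth (V : normedModType R) (n : nat) (f : 'rV[R]_n -> V) : Prop :=
  forall k, Ck k f.

Definition Zn_periodic (V : Type) (n : nat) (f : 'rV[R]_n -> V) : Prop :=
  forall (i : 'I_n) (x : 'rV[R]_n), f (x + evec i) = f x.

Definition row_div (n : nat) (phi : 'rV[R]_n -> 'M[R]_n) (x : 'rV[R]_n)
    (i : 'I_n) : R :=
  \sum_j 'D_(evec j) (fun y => phi y i j) x.

Definition symmx {n : nat} : set 'M[R]_n := [set A | A^T = A].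

Definition sdqc_test (n : nat) (xi : 'M[R]_n) : set ('rV[R]_n -> 'M[R]_n) :=
  [set phi | [/\ smooth phi, Zn_periodic phi, forall x, symmx (phi x),
      forall x i, row_div phi x i = 0 &
      forall i j, cube_integral (fun x => phi x i j) = (xi i j)%:E]].

(* Test fields are symmetric-valued, so only the values of f on symmetric
   matrices matter. *)
Definition sdqc_envelope (n : nat) (f : 'M[R]_n -> R) (xi : 'M[R]_n) : \bar R :=
  ereal_inf [set cube_integral (f \o phi) | phi in sdqc_test xi].

(* The library norm on matrices is the max norm, hence an explicit
   Frobenius norm. *)
Definition frobenius (n : nat) (A : 'M[R]_n) : R :=
  Num.sqrt (\sum_i \sum_j (A i j) ^+ 2).

Definition frobenius_dist (n : nat) (xi : 'M[R]_n) (K : set 'M[R]_n) : R :=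
  inf [set frobenius (xi - eta) | eta in K].

Definition dist_pow (n : nat) (K : set 'M[R]_n) (r : R) (xi : 'M[R]_n) : R :=
  (frobenius_dist xi K) `^ r.

Definition sdqc_hull (n : nat) (K : set 'M[R]_n) (r : R) : set 'M[R]_n :=
  [set xi | symmx xi /\ sdqc_envelope (dist_pow K r) xi = 0%E].

End sdqc.

(* Main.v *)
Require Import Defs.
From mathcomp Require Import all_boot all_order all_algebra.
From mathcomp Require Import all_classical all_reals all_analysis.
From mathcomp Require Import measurable_realfun complex.
From mathcomp Require Import ring lra zify.

Set Implicit Arguments.
Unset Strict Implicit.
Unset Printing Implicit Defensive.

Import Order.TTheory GRing.Theory Num.Theory.
Import numFieldNormedType.Exports.
Local Open Scope classical_set_scope.
Local Open Scope ring_scope.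

(** Only two inclusions of approximation properties are at stake: [xi] belongs to
    the hull for the exponent [r] exactly when the [r]-th power of the distance to
    [K] has arbitrarily small mean along admissible fields of mean [xi] ([hullE]).
    Since the cube has measure one, smallness for a larger exponent implies
    smallness for a smaller one ([approximable_lower]), so the hull for [q] is
    contained in the hull for [p].

    For the other inclusion, let [phi] be admissible with [dist (phi, K)] small in
    [L^p].  Let [g] be [phi] with its entries clamped to [[-M, M]], where [M] bounds
    the entries of [K].  Then [g] is bounded, is at least as close to [K] as [phi],
    and [|phi - g| <= dist (phi, K)]; but [g] is not divergence-free.  It is
    corrected by a Fourier projection [P] onto divergence-free symmetric fields.
    As [P] is bounded on every [L^s] with [1 < s < oo], the correction
    [z = P g - g] is bounded in [L^s] for a large [s], and it is small in [L^2]: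
    [(1 - P)^*] maps into symmetrized gradients, which are orthogonal to [phi], so
    that [<z, z> = <(1 - P)^* z, phi - g>], and Hoelder's inequality pairs
    the [L^s] norm of one factor with the small [L^(s')] norm of the other.
    A sequence that is small in [L^2] and bounded in [L^s] is small in [L^q] for
    [q < s], whence [dist (P g, K)] is small in [L^q] ([truncated_field],
    [approximable_upper]).

    The analytic core is the boundedness of [P].  The orthogonal projection would
    lead to Riesz transforms and singular integrals.  An oblique projection
    [A |-> (1 - nu k^T) A (1 - k nu^T)] is used instead, where [nu (k)] is [e_i / k_i]
    for the first index [i] such that [|k_i|] is maximal.  The symbols
    [nu_i k_j] are built from signs of linear forms in [k]: the cones are cut out by
    the signs of [k_j + k_i] and [k_j - k_i], and on a cone [k_j / k_i] is the average
    of [sg (k_j - a k_i) * sg k_i] over [a] in [[-1, 1]] ([multiplier_cone_ratio]).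
    So everything reduces to Hilbert transforms along directions, for which
    M. Riesz's algebraic argument works for the exponents [s = 2 m] with [m] odd:
    the analytic signal [f + i H f] has only nonnegative frequencies, hence the mean
    of its [s]-th power is that of the part of [f] of zero frequency along the
    direction, which is nonnegative, whereas the real part of [(x + i y)^s] is at most
    [- y^s / 2 + C x^s] ([riesz_pointwise], [hilbert_bound]).

    All multipliers act on trigonometric polynomials, where they are finite sums.
    The clamped field is replaced by such polynomials with the help of a
    Korovkin-type approximation ([trig_dense]), and the integral only enters through
    its positivity, its linearity and the vanishing of the mean of derivatives of
    periodic functions ([cube_integral_derive0]). *)

(** * Integration of continuous functions over the unit cube *)
Section entrywise.
Context {R : realType}.

Lemma continuous_mx (m n : nat) (T : topologicalType) (f : T -> 'M[R]_(m, n)) :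
  (forall i j, continuous (fun y => f y i j)) -> continuous f.
Proof.
move=> cf x; apply/cvgrPdist_le => /= e e0; near=> y.
rewrite /Num.Def.normr/= mx_normrE (bigmax_le _ (ltW e0))//= => i _.
rewrite !mxE/=; move: i; near: y; apply: filter_forall => /= i.
by have /cvgrPdist_le/(_ _ e0) := cf i.1 i.2 x.
Unshelve. all: by end_near. Qed.

End entrywise.

Section tuple_integral.
Context {R : realType}.
Local Notation mR := (measurableTypeR R).

Definition row_of_tuple (n : nat) (t : n.-tuple mR) : 'rV[R]_n := \row_i (tnth t i : R).

Lemma measurable_coord (n : nat) (i : 'I_n) :
  measurable_fun [set: n.-tuple mR] (fun t => tnth t i : R).
Proof. exact: (measurable_tnth (T := mR)). Qed.

Lemma floor_grid_cvg (x : R) :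
  (Num.floor (k.+1%:R * x))%:~R / k.+1%:R @[k --> \oo] --> x.
Proof.
apply/cvgrPdist_le => e e0; near=> k.
have k0 : 0 < k.+1%:R :> R by rewrite ltr0n.
have /andP[f1 f2] := floor_itv (k.+1%:R * x).
have -> : x - (Num.floor (k.+1%:R * x))%:~R / k.+1%:R =
  (k.+1%:R * x - (Num.floor (k.+1%:R * x))%:~R) / k.+1%:R.
  by rewrite mulrBl mulrAC divff ?mul1r// gt_eqF.
rewrite ger0_norm; last by rewrite divr_ge0 ?subr_ge0// ltW.
apply: (@le_trans _ _ (k.+1%:R^-1)).
  by rewrite ler_piMl ?invr_ge0 ?ltW// ltrBlDl -intrD1.
apply/ltW; near: k; exact: (near_infty_natSinv_lt (PosNum e0)).
Unshelve. all: by end_near. Qed.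

(** The product sigma-algebra makes coordinates measurable, not a priori open sets.
    A continuous function is the limit of its values at the lower corners of the
    cells of finer and finer grids; each approximation takes countably many values,
    each of them on a union of boxes. *)
Lemma measurable_continuous (n : nat) (g : 'rV[R]_n -> R) : continuous g ->
  measurable_fun [set: n.-tuple mR] (g \o @row_of_tuple n).
Proof.
move=> cg; apply/measurable_EFinP.
pose fl (k : nat) (t : n.-tuple mR) : 'rV[int]_n :=
  \row_i Num.floor (k.+1%:R * (tnth t i : R)).
pose gr (k : nat) (z : 'rV[int]_n) : 'rV[R]_n :=
  \row_i ((z ord0 i)%:~R / k.+1%:R).
apply: (emeasurable_fun_cvg (fun k t => (g (gr k (fl k t)))%:E)).
- move=> k; apply/measurable_EFinP => _ Y mY; rewrite setTI.
  have -> : (fun t => g (gr k (fl k t))) @^-1` Y =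
      \bigcup_z [set t | fl k t = z /\ Y (g (gr k z))].
    apply/seteqP; split => [t /= Yt|t [z _ [<-]]//].
    by exists (fl k t).
  apply: countable_bigcupT_measurable; first exact: countableP.
  move=> z; have [Yz|nYz] := pselect (Y (g (gr k z))); last first.
    rewrite (_ : mkset _ = set0)//; apply/seteqP; split => // t [_ /=].
    by move=> Yz; apply: nYz.
  rewrite (_ : mkset _ = \bigcap_(i in [set: 'I_n])
     ((fun t : n.-tuple mR => tnth t i : R) @^-1`
       `[(z ord0 i)%:~R / k.+1%:R, (z ord0 i + 1)%:~R / k.+1%:R[)).
    apply: fin_bigcap_measurable => // i _.
    rewrite -[X in measurable X]setTI.
    by apply: measurable_coord => //; exact: measurable_itv.
  have k0 : 0 < k.+1%:R :> R by rewrite ltr0n.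
  have E (t : n.-tuple mR) i : (Num.floor (k.+1%:R * (tnth t i : R)) == z ord0 i) =
     ((tnth t i : R) \in `[(z ord0 i)%:~R / k.+1%:R, (z ord0 i + 1)%:~R / k.+1%:R[).
    by rewrite floor_eq in_itv /= ler_pdivrMr// ltr_pdivlMr// mulrC.
  apply/seteqP; split => [t [/= tz _] i _ /=|t /= tz].
    by rewrite -E -tz mxE.
  split=> //; apply/rowP => i; rewrite mxE; apply/eqP; rewrite E.
  exact: tz.
- move=> t _; apply/cvg_EFin; first exact: nearW.
  apply: continuous_cvg; first exact: cg.
  rewrite /row_of_tuple; apply/cvgrPdist_le => /= e e0; near=> k.
  rewrite /Num.Def.normr/= mx_normrE (bigmax_le _ (ltW e0))//= => i _.
  rewrite !mxE/=; move: i; near: k; apply: filter_forall => /= i.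
  by have /cvgrPdist_le/(_ _ e0) := @floor_grid_cvg (tnth t i.2).
Unshelve. all: by end_near. Qed.

Lemma unit_cubeE (n : nat) : @unit_cube R n =
  \bigcap_(i in [set: 'I_n]) ((fun t : n.-tuple mR => tnth t i : R) @^-1` `]0, 1[).
Proof.
by apply/seteqP; split => [t /= tc i _ /=|t /= tc i];
  [rewrite in_itv/=; exact: tc | have /= := tc i I; rewrite in_itv].
Qed.

Lemma measurable_unit_cube (n : nat) : measurable (@unit_cube R n).
Proof.
rewrite unit_cubeE; apply: fin_bigcap_measurable => // i _.
rewrite -[X in measurable X]setTI.
by apply: measurable_coord => //; exact: measurable_itv.
Qed.

Lemma tcons_unit_cube (n : nat) :
  @tcons mR n @^-1` unit_cube = (`]0, 1[%classic : set mR) `*` unit_cube.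
Proof.
apply/seteqP; split => -[x t] /=.
- move=> c; split => [|i].
    by have := c ord0; rewrite /tcons/= in_itv/= (tnth_nth 0).
  by have := c (lift ord0 i); rewrite !(tnth_nth 0).
- move=> [x01 tc] i; rewrite (tnth_nth 0) /tcons/=.
  have [j ->|->] := unliftP ord0 i; last by move: x01; rewrite in_itv.
  by have := tc j; rewrite (tnth_nth 0).
Qed.

Lemma unit_cube1 (n : nat) : lebesgue_tuple R n unit_cube = 1%E.
Proof.
elim: n => [|n IH].
  rewrite /= diracE mem_set//; by move=> [].
rewrite /= /cons_measure/= /pushforward tcons_unit_cube product_measure1E//.
- rewrite IH mule1; transitivity (@lebesgue_measure R `]0%R, 1%R[%classic) => //.
  by rewrite lebesgue_measure_itv/= lte_fin ltr01 oppr0 adde0.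
- exact: measurable_unit_cube.
Qed.

Lemma bounded_on_cube (n : nat) (g : 'rV[R]_n -> R) : continuous g ->
  exists2 M, 0 <= M & forall x : 'rV[R]_n, (forall i, 0 <= x ord0 i <= 1) -> `|g x| <= M.
Proof.
move=> cg; set A := [set x : 'rV[R]_n | forall i, x ord0 i \in `[0%R, 1%R]].
have cA : compact A.
  apply: (@rV_compact _ _ (fun=> `[(0 : R), 1]%classic)) => _; exact: segment_compact.
have [||c _ cmax] := @EVT_max_rV _ _ (fun x => `|g x|) _ _ cA.
- by exists 0 => i; rewrite mxE in_itv/= lexx ler01.
- apply: continuous_subspaceT => x.
  by apply: (@continuous_comp _ _ _ g Num.norm); [exact: cg|exact: norm_continuous].
- exists `|g c| => // x xA; apply: cmax; rewrite inE => i.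
  by rewrite in_itv/= xA.
Qed.

Lemma integrable_continuous (n : nat) (g : 'rV[R]_n -> R) : continuous g ->
  (lebesgue_tuple R n).-integrable unit_cube (EFin \o (g \o @row_of_tuple n)).
Proof.
move=> cg; apply: measurable_bounded_integrable.
- exact: measurable_unit_cube.
- by rewrite [X in (X < _)%E]unit_cube1 ltry.
- by apply: measurable_funTS; exact: measurable_continuous.
- have [M M0 gM] := bounded_on_cube cg.
  exists M; split; first exact: num_real.
  move=> y My t /= tc; apply: le_trans (ltW My); apply: gM => i.
  by rewrite mxE; have /andP[/ltW -> /ltW ->] := tc i.
Qed.

End tuple_integral.

Section pointwise_continuity.
Context {R : realType} {T : topologicalType}.
Implicit Types f g : T -> R.

Lemma continuous_pcst (c : R) : continuous (fun _ : T => c).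
Proof. by move=> x; exact: cst_continuous. Qed.

Lemma continuous_pD f g : continuous f -> continuous g ->
  continuous (fun x => f x + g x).
Proof. by move=> cf cg x; apply: continuousD; [exact: cf|exact: cg]. Qed.

Lemma continuous_pN f : continuous f -> continuous (fun x => - f x).
Proof. by move=> cf x; apply: continuousN; exact: cf. Qed.

Lemma continuous_pM f g : continuous f -> continuous g ->
  continuous (fun x => f x * g x).
Proof. by move=> cf cg x; apply: continuousM; [exact: cf|exact: cg]. Qed.

Lemma continuous_pZ (c : R) f : continuous f -> continuous (fun x => c * f x).
Proof. by move=> cf; apply: continuous_pM => //; exact: continuous_pcst. Qed.

Lemma continuous_pX f k : continuous f -> continuous (fun x => f x ^+ k).
Proof.
move=> cf; elim: k => [|k IH]; first exact: continuous_pcst.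
rewrite (_ : (fun x => _) = (fun x => f x * f x ^+ k)); first exact: continuous_pM.
by apply/funext => x; rewrite exprS.
Qed.

Lemma continuous_pcomp (h : R -> R) f : continuous h -> continuous f ->
  continuous (fun x => h (f x)).
Proof. by move=> ch cf x; apply: (@continuous_comp _ _ _ f h); [exact: cf|exact: ch]. Qed.

Lemma continuous_pnorm f : continuous f -> continuous (fun x => `|f x|).
Proof. by move=> cf; apply: continuous_pcomp => //; exact: norm_continuous. Qed.

Lemma continuous_psum I (s : seq I) (P : pred I) (h : I -> T -> R) :
  (forall i, P i -> continuous (h i)) -> continuous (fun x => \sum_(i <- s | P i) h i x).
Proof.
move=> ch; elim: s => [|i s IH].
  by rewrite (_ : (fun x => _) = cst 0); [move=> x; exact: cst_continuous|
    apply/funext => x; rewrite big_nil].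
case Pi : (P i); last first.
  by rewrite (_ : (fun x => _) = (fun x => \sum_(j <- s | P j) h j x))//;
    apply/funext => x; rewrite big_cons Pi.
rewrite (_ : (fun x => _) = (fun x => h i x + \sum_(j <- s | P j) h j x)).
  by move=> x; apply: continuousD; [exact: ch|exact: IH].
by apply/funext => x; rewrite big_cons Pi.
Qed.

Lemma continuous_pprod I (s : seq I) (P : pred I) (h : I -> T -> R) :
  (forall i, P i -> continuous (h i)) -> continuous (fun x => \prod_(i <- s | P i) h i x).
Proof.
move=> ch; elim: s => [|i s IH].
  by rewrite (_ : (fun x => _) = cst 1); [exact: continuous_pcst|
    apply/funext => x; rewrite big_nil].
case Pi : (P i); last first.
  by rewrite (_ : (fun x => _) = (fun x => \prod_(j <- s | P j) h j x))//;
    apply/funext => x; rewrite big_cons Pi.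
rewrite (_ : (fun x => _) = (fun x => h i x * \prod_(j <- s | P j) h j x)).
  by apply: continuous_pM; [exact: ch|exact: IH].
by apply/funext => x; rewrite big_cons Pi.
Qed.

End pointwise_continuity.

Section mean.
Context {R : realType} {n : nat}.
Implicit Types f g : 'rV[R]_n -> R.

Definition mean g : R := fine (cube_integral g).

Lemma cube_integralE g : continuous g -> cube_integral g = (mean g)%:E.
Proof.
move=> cg; rewrite /mean fineK//.
by apply: integrable_fin_num; [exact: measurable_unit_cube|exact: integrable_continuous].
Qed.

Lemma meanE g :
  mean g = \int[lebesgue_tuple R n]_(t in unit_cube) g (row_of_tuple t).
Proof. by []. Qed.

Let mcube := @measurable_unit_cube R n.

Lemma meanD f g : continuous f -> continuous g ->
  mean (fun x => f x + g x) = mean f + mean g.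
Proof.
by move=> cf cg; rewrite !meanE; apply: RintegralD;
  [exact: mcube|exact: integrable_continuous|exact: integrable_continuous].
Qed.

Lemma meanZ (c : R) f : continuous f -> mean (fun x => c * f x) = c * mean f.
Proof.
by move=> cf; rewrite !meanE; apply: RintegralZl;
  [exact: mcube|exact: integrable_continuous].
Qed.

Lemma mean_cst (c : R) : mean (fun=> c) = c.
Proof.
rewrite meanE Rintegral_cst; last exact: mcube.
by rewrite [X in fine X]unit_cube1 mulr1.
Qed.

Lemma le_mean f g : continuous f -> continuous g -> (forall x, f x <= g x) ->
  mean f <= mean g.
Proof.
by move=> cf cg fg; rewrite !meanE; apply: le_Rintegral;
  [exact: mcube|exact: integrable_continuous|exact: integrable_continuous|
   move=> t _; exact: fg].
Qed.

Lemma mean_ge0 f : (forall x, 0 <= f x) -> 0 <= mean f.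
Proof. by move=> f0; rewrite meanE; apply: Rintegral_ge0 => t _; exact: f0. Qed.

Lemma meanN f : continuous f -> mean (fun x => - f x) = - mean f.
Proof.
move=> cf; rewrite -mulN1r -meanZ//; congr mean.
by apply/funext => x; rewrite mulN1r.
Qed.

Lemma meanB f g : continuous f -> continuous g ->
  mean (fun x => f x - g x) = mean f - mean g.
Proof.
by move=> cf cg; rewrite -meanN// -meanD// => x; apply: continuousN; exact: cg.
Qed.

Lemma mean_sum I (s : seq I) (P : pred I) (h : I -> 'rV[R]_n -> R) :
  (forall i, P i -> continuous (h i)) ->
  mean (fun x => \sum_(i <- s | P i) h i x) = \sum_(i <- s | P i) mean (h i).
Proof.
move=> ch; elim: s => [|i s IH].
  rewrite big_nil -[RHS](mean_cst 0); congr mean.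
  by apply/funext => x; rewrite big_nil.
rewrite big_cons; case Pi : (P i); last first.
  by rewrite -IH; congr mean; apply/funext => x; rewrite big_cons Pi.
rewrite -IH -meanD; [|exact: ch|exact: continuous_psum].
by congr mean; apply/funext => x; rewrite big_cons Pi.
Qed.

Lemma mean_norm f : continuous f -> `|mean f| <= mean (fun x => `|f x|).
Proof.
move=> cf.
have cnf : continuous (fun x => `|f x|).
  move=> x; apply: (@continuous_comp _ _ _ f Num.norm); first exact: cf.
  exact: norm_continuous.
rewrite ler_norml -meanN//; apply/andP; split; apply: le_mean => //.
- exact: continuous_pN.
- by move=> x; rewrite lerNl -normrN ler_norm.
- by move=> x; exact: ler_norm.
Qed.

End mean.

(** * The mean of a derivative *)
Section derivative_mean.
Context {R : realType}.

(** The counterpart of [tcons] for row vectors. *)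
Definition rcons0 (n : nat) (x : R) (y : 'rV[R]_n) : 'rV[R]_n.+1 :=
  \row_i oapp (y ord0) x (unlift ord0 i).

Lemma row_of_tcons (n : nat) x (t : n.-tuple (measurableTypeR R)) :
  row_of_tuple (tcons (x, t)) = rcons0 x (row_of_tuple t).
Proof.
apply/rowP => i; rewrite !mxE (tnth_nth 0).
have [j ->|->] := unliftP ord0 i; last by [].
by rewrite /= mxE (tnth_nth 0).
Qed.

Lemma rcons0_shift (n : nat) x (y : 'rV[R]_n) h :
  rcons0 (h + x) y = h *: evec ord0 + rcons0 x y.
Proof.
apply/rowP => i; rewrite !mxE /=.
have [j ->|->] := unliftP ord0 i; last by rewrite eqxx mulr1.
by rewrite eq_sym (negbTE (neq_lift _ _)) mulr0 add0r.
Qed.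

Lemma rcons0_lift_shift (n : nat) x (y : 'rV[R]_n) h i :
  rcons0 x (h *: evec i + y) = h *: evec (lift ord0 i) + rcons0 x y.
Proof.
apply/rowP => j; rewrite !mxE /=.
have [k ->|->] := unliftP ord0 j.
  by rewrite /= !mxE/= (inj_eq (@lift_inj _ ord0)).
by rewrite /= mulr0 add0r.
Qed.

Lemma continuous_rcons0l (n : nat) (y : 'rV[R]_n) : continuous (fun x => rcons0 x y).
Proof.
apply: continuous_mx => i j; rewrite (_ : (fun x => _) =
  fun x => oapp (y ord0) x (unlift ord0 j)); last by apply/funext => x; rewrite mxE.
have [k _|_] := unliftP ord0 j; first by move=> x; exact: cst_continuous.
by move=> x; exact: cvg_id.
Qed.

Lemma continuous_rcons0r (n : nat) x : continuous (@rcons0 n x).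
Proof.
apply: continuous_mx => i j; rewrite (_ : (fun y => _) =
  fun y : 'rV_n => oapp (y ord0) x (unlift ord0 j)); last by apply/funext => y; rewrite mxE.
have [k _|_] := unliftP ord0 j; last by move=> y; exact: cst_continuous.
by move=> y; exact: coord_continuous.
Qed.

Section slices.
Context {n : nat} (g : 'rV[R]_n.+1 -> R) (cg : continuous g).
Local Notation mu := (@lebesgue_measure R).
Local Notation lam := (lebesgue_tuple R n).

Let D : set (measurableTypeR R * n.-tuple (measurableTypeR R)) :=
  `]0%R, 1%R[%classic `*` unit_cube.

Let G (z : measurableTypeR R * n.-tuple (measurableTypeR R)) : R :=
  g (rcons0 z.1 (row_of_tuple z.2)).

Let mD : measurable D.
Proof. by apply: measurableX => //; exact: measurable_unit_cube. Qed.

Let mG : measurable_fun setT G.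
Proof.
have -> : G = (g \o @row_of_tuple R n.+1) \o @tcons _ n.
  by apply/funext => -[x t]; rewrite /= row_of_tcons.
by apply: measurableT_comp; [exact: measurable_continuous|exact: measurable_tcons].
Qed.

Let D1 : (mu \x lam)%E D = 1%E.
Proof. by rewrite -[RHS](unit_cube1 n.+1) /= /cons_measure/= /pushforward tcons_unit_cube. Qed.

Let G_int : (mu \x lam)%E.-integrable D (EFin \o G).
Proof.
apply: measurable_bounded_integrable => //.
- by rewrite [X in (X < _)%E]D1 ltry.
- exact: measurable_funTS.
- have [M M0 gM] := bounded_on_cube cg.
  exists M; split; first exact: num_real.
  move=> y My [x t] /= [x01 tc]; apply: le_trans (ltW My); apply: gM => i.
  rewrite mxE; have [j _|_] := unliftP ord0 i => /=.
    by rewrite mxE; have /andP[t0 t1] := tc j; rewrite (ltW t0) (ltW t1).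
  by move: x01; rewrite /= in_itv/= => /andP[x0 x1]; rewrite (ltW x0) (ltW x1).
Qed.

Let cubeE : cube_integral g = (\int[mu \x lam]_(z in D) (EFin \o G) z)%E.
Proof.
transitivity (\int[pushforward (mu \x lam)%E (@tcons _ n)]_(t in unit_cube)
   (g (row_of_tuple t))%:E)%E; first by [].
have E : (EFin \o (g \o @row_of_tuple R n.+1)) \o @tcons _ n = EFin \o G.
  by apply/funext => -[x t]; rewrite /= row_of_tcons.
rewrite (integral_pushforward (@measurable_tcons _ _ n)).
- by rewrite tcons_unit_cube E.
- by apply/measurable_EFinP; exact: measurable_continuous.
- by rewrite tcons_unit_cube E.
- exact: measurable_unit_cube.
Qed.

Let GD_int : (mu \x lam)%E.-integrable setT ((EFin \o G) \_ D).
Proof. by apply/integrable_restrict => //; rewrite setTI. Qed.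

Lemma cube_integral_cons : cube_integral g =
  (\int[mu]_(x in `]0%R, 1%R[) cube_integral (fun y => g (rcons0 x y)))%E.
Proof.
rewrite cubeE integral_mkcond -(integral12_prod_meas1 GD_int) [RHS]integral_mkcond.
apply: eq_integral => x _; rewrite /fubini_F patchE; case: ifPn => x01.
  rewrite /cube_integral [RHS]integral_mkcond; apply: eq_integral => t _.
  rewrite !patchE; congr (if _ then _ else _).
  by apply/idP/idP => [/set_mem[_ /mem_set]//|/set_mem tc]; apply/mem_set; split => //; exact: set_mem.
apply: integral0_eq => t _; rewrite patchE ifF//; apply/negbTE.
by apply: contra x01; rewrite !inE => -[].
Qed.

Lemma cube_integral_cons_swap : cube_integral g =
  (\int[lam]_(t in unit_cube)
     \int[mu]_(x in `]0%R, 1%R[) (g (rcons0 x (row_of_tuple t)))%:E)%E.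
Proof.
rewrite cubeE integral_mkcond -(integral21_prod_meas1 GD_int) [RHS]integral_mkcond.
apply: eq_integral => t _; rewrite /fubini_G patchE; case: ifPn => tc.
  rewrite [RHS]integral_mkcond; apply: eq_integral => x _.
  rewrite !patchE; congr (if _ then _ else _).
  by apply/idP/idP => [/set_mem[x01 _]|/set_mem ?]; apply/mem_set; [by []|split] => //; exact: set_mem.
apply: integral0_eq => x _; rewrite patchE ifF//; apply/negbTE.
by apply: contra tc; rewrite !inE => -[].
Qed.

End slices.

Lemma is_derive_rcons0l (n : nat) (g : 'rV[R]_n.+1 -> R) (y : 'rV[R]_n) (x : R) :
  derivable g (rcons0 x y) (evec ord0) ->
  is_derive x 1 (fun x => g (rcons0 x y)) ('D_(evec ord0) g (rcons0 x y)).
Proof.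
have E : (fun h : R => h^-1 *: (g (rcons0 (h *: 1 + x) y) - g (rcons0 x y))) =
    (fun h => h^-1 *: (g (h *: evec ord0 + rcons0 x y) - g (rcons0 x y))).
  by apply/funext => h; rewrite scaler1 rcons0_shift.
by move=> dg; split; rewrite /derivable /derive /= E.
Qed.

Lemma is_derive_rcons0r (n : nat) (g : 'rV[R]_n.+1 -> R) (x : R) (y : 'rV[R]_n) j :
  derivable g (rcons0 x y) (evec (lift ord0 j)) ->
  is_derive y (evec j) (fun y => g (rcons0 x y)) ('D_(evec (lift ord0 j)) g (rcons0 x y)).
Proof.
have E : (fun h : R => h^-1 *: (g (rcons0 x (h *: evec j + y)) - g (rcons0 x y))) =
    (fun h => h^-1 *: (g (h *: evec (lift ord0 j) + rcons0 x y) - g (rcons0 x y))).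
  by apply/funext => h; rewrite rcons0_lift_shift.
by move=> dg; split; rewrite /derivable /derive /= E.
Qed.

(** By Fubini the coordinate of differentiation can be integrated first, and
    the fundamental theorem of calculus turns that integral into a difference
    of values at points one period apart. *)
Lemma cube_integral_derive0 (n : nat) (g : 'rV[R]_n -> R) (i : 'I_n) :
  continuous g -> (forall x, derivable g x (evec i)) ->
  continuous ('D_(evec i) g) -> (forall x, g (x + evec i) = g x) ->
  cube_integral ('D_(evec i) g) = 0%E.
Proof.
elim: n g i => [|n IH] g i cg dg cdg pg; first by case: i {dg cdg pg}.
have [j ij|i0] := unliftP ord0 i; subst i.
- rewrite cube_integral_cons//; apply: integral0_eq => x _.
  have E : (fun y => 'D_(evec (lift ord0 j)) g (rcons0 x y)) =
           'D_(evec j) (fun y => g (rcons0 x y)).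
    by apply/funext => y; have [_ ->] := is_derive_rcons0r (dg (rcons0 x y)).
  rewrite E; apply: IH.
  + by move=> y; apply: (@continuous_comp _ _ _ (rcons0 x) g); [exact: continuous_rcons0r|exact: cg].
  + by move=> y; have [] := is_derive_rcons0r (dg (rcons0 x y)).
  + rewrite -E => y.
    by apply: (@continuous_comp _ _ _ (rcons0 x) ('D_(evec (lift ord0 j)) g)); [exact: continuous_rcons0r|exact: cdg].
  + move=> y; rewrite -(pg (rcons0 x y)) -[evec j]scale1r addrC rcons0_lift_shift.
    by rewrite scale1r addrC.
- rewrite cube_integral_cons_swap//; apply: integral0_eq => t _.
  set y := row_of_tuple t; set G := fun x => g (rcons0 x y).
  have dG x := is_derive_rcons0l (dg (rcons0 x y)).
  have cG : continuous G.
    by move=> x; apply: (@continuous_comp _ _ _ (fun x => rcons0 x y) g); [exact: continuous_rcons0l|exact: cg].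
  have cdG : continuous (fun x => 'D_(evec ord0) g (rcons0 x y)).
    move=> x; apply: (@continuous_comp _ _ _ (fun x => rcons0 x y) ('D_(evec ord0) g)).
      exact: continuous_rcons0l.
    exact: cdg.
  transitivity (\int[@lebesgue_measure R]_(x in `[0%R, 1%R]) ('D_(evec ord0) g (rcons0 x y))%:E)%E.
    rewrite [RHS]integral_itv_bndoo//; apply/measurable_EFinP; apply: measurable_funTS.
    exact: continuous_measurable_fun.
  rewrite (continuous_FTC2 (F := G)) ?ltr01//.
  + rewrite /G (_ : rcons0 1 y = rcons0 0 y + evec ord0) ?pg ?subee//.
    by rewrite -[1]addr0 rcons0_shift scale1r addrC.
  + exact: continuous_subspaceT.
  + split=> [x _||]; first by have [] := dG x.
      by apply: cvg_at_right_filter; exact: cG.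
    by apply: cvg_at_left_filter; exact: cG.
  + by move=> x _; rewrite derive1E; have [_ ->] := dG x.
Qed.

End derivative_mean.

(** * Trigonometric polynomials *)
Section complex_values.
Context {R : realType}.
Implicit Types (z w : R[i]).

Lemma cReD z w : complex.Re (z + w) = complex.Re z + complex.Re w.
Proof. by case: z => a b; case: w. Qed.

Lemma cReN z : complex.Re (- z) = - complex.Re z.
Proof. by case: z. Qed.

Lemma cReM z w :
  complex.Re (z * w) = complex.Re z * complex.Re w - complex.Im z * complex.Im w.
Proof. by case: z => a b; case: w. Qed.

Lemma cImM z w :
  complex.Im (z * w) = complex.Re z * complex.Im w + complex.Im z * complex.Re w.
Proof. by case: z => a b; case: w. Qed.

Lemma cRe_sum I (s : seq I) (P : pred I) (h : I -> R[i]) :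
  complex.Re (\sum_(i <- s | P i) h i) = \sum_(i <- s | P i) complex.Re (h i).
Proof. by apply: (big_morph _ cReD). Qed.

Definition cis (t : R) : R[i] := (cos t +i* sin t)%C.

Lemma cisD s t : cis (s + t) = cis s * cis t.
Proof.
by rewrite /cis cosD sinD; apply/eqP; rewrite eq_complex /= eqxx/= addrC [sin s * _]mulrC
  [cos t * _]mulrC addrC.
Qed.

Lemma cis0 : cis 0 = 1.
Proof. by rewrite /cis cos0 sin0. Qed.

Lemma cisN t : cis (- t) = ((cis t)^*)%C.
Proof. by rewrite /cis cosN sinN. Qed.

Lemma cis_int (m : int) : cis (pi *+ 2 * m%:~R) = 1.
Proof.
have nat_case (k : nat) : cis (pi *+ 2 * k%:R) = 1.
  elim: k => [|k IH]; first by rewrite mulr0 cis0.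
  rewrite -natr1 mulrDr mulr1 cisD IH mul1r /cis cos2pi sin2pi.
  by [].
case: m => k; first exact: nat_case.
rewrite NegzE mulrNz mulrN cisN nat_case.
by apply/eqP; rewrite eq_complex /= oppr0 !eqxx.
Qed.

End complex_values.

(** A directional derivative is the derivative at 0 of the restriction to a line. *)
Lemma is_derive_along {R : realType} (V : normedModType R) (f : V -> R) (y v : V)
    (F : R -> R) (df : R) :
  (forall h, f (h *: v + y) = F h) -> is_derive (0 : R) 1 F df -> is_derive y v f df.
Proof.
move=> fF [d1 d2].
have E : (fun h : R => h^-1 *: (f (h *: v + y) - f y)) =
   (fun h => h^-1 *: (F (h *: 1 + 0) - F 0)).
  by apply/funext => h; rewrite fF -[in X in _ - X](add0r y) -(scale0r v) fF scaler1 addr0.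
by split; rewrite /derivable /derive E.
Qed.

Section trig.
Context {R : realType} {n : nat}.
Local Notation freq := 'rV[int]_n.
Implicit Types (k l : 'rV[int]_n) (x y : 'rV[R]_n) (c : R[i]).

Definition phase k x : R := pi *+ 2 * \sum_i (k ord0 i)%:~R * x ord0 i.

Lemma phaseDr k x y : phase k (x + y) = phase k x + phase k y.
Proof.
rewrite /phase -mulrDr -big_split; congr (_ * _); apply: eq_bigr => i _.
by rewrite mxE mulrDr.
Qed.

Lemma phaseZr k (h : R) x : phase k (h *: x) = h * phase k x.
Proof.
rewrite /phase mulrCA; congr (_ * _); rewrite mulr_sumr; apply: eq_bigr => i _.
by rewrite mxE mulrCA.
Qed.

Lemma phaseDl k l x : phase (k + l) x = phase k x + phase l x.
Proof.
rewrite /phase -mulrDr -big_split; congr (_ * _); apply: eq_bigr => i _.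
by rewrite mxE intrD mulrDl.
Qed.

Lemma phaseNl k x : phase (- k) x = - phase k x.
Proof.
rewrite /phase -mulrN -sumrN; congr (_ * _); apply: eq_bigr => i _.
by rewrite mxE mulrNz mulNr.
Qed.

Lemma phase0l x : phase 0 x = 0.
Proof. by rewrite /phase big1 ?mulr0// => i _; rewrite mxE mul0r. Qed.

Lemma phase_evec k i : phase k (evec i) = pi *+ 2 * (k ord0 i)%:~R.
Proof.
rewrite /phase (bigD1 i)//= big1 ?addr0 => [|j ji].
  by rewrite mxE !eqxx mulr1.
by rewrite mxE (negbTE ji) andbF mulr0.
Qed.

Lemma continuous_phase k : continuous (phase k).
Proof.
apply: continuous_pZ; apply: continuous_psum => i _; apply: continuous_pZ.
exact: coord_continuous.
Qed.

Definition ek k x : R[i] := cis (phase k x).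

Lemma ekDl k l x : ek (k + l) x = ek k x * ek l x.
Proof. by rewrite /ek phaseDl cisD. Qed.

Lemma ekDr k x y : ek k (x + y) = ek k x * ek k y.
Proof. by rewrite /ek phaseDr cisD. Qed.

Lemma ek0 x : ek 0 x = 1.
Proof. by rewrite /ek phase0l cis0. Qed.

Lemma ekN k x : ek (- k) x = ((ek k x)^*)%C.
Proof. by rewrite /ek phaseNl cisN. Qed.

Lemma ek_evec k i : ek k (evec i) = 1.
Proof. by rewrite /ek phase_evec cis_int. Qed.

(** A real function is the real part of its one-sided expansion: the modes [k] and
    [- k] need not be paired, and each may carry any complex coefficient. *)
Definition mode k c x : R := complex.Re (c * ek k x).

Lemma modeE k c x : mode k c x =
  complex.Re c * cos (phase k x) - complex.Im c * sin (phase k x).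
Proof. by rewrite /mode cReM. Qed.

Lemma modeD k c c' x : mode k (c + c') x = mode k c x + mode k c' x.
Proof. by rewrite /mode mulrDl cReD. Qed.

Lemma mode0 k x : mode k 0 x = 0.
Proof. by rewrite /mode mul0r. Qed.

Lemma modeZ k (a : R) c x : mode k (a%:C%C * c) x = a * mode k c x.
Proof. by rewrite /mode -mulrA cReM /= mul0r subr0. Qed.

Lemma mode_sum I (s : seq I) (P : pred I) k (h : I -> R[i]) x :
  mode k (\sum_(i <- s | P i) h i) x = \sum_(i <- s | P i) mode k (h i) x.
Proof. by apply: (big_morph (fun c => mode k c x) (fun c d => modeD k c d x) (mode0 k x)). Qed.

Lemma mode_le k c x : `|mode k c x| <= `|complex.Re c| + `|complex.Im c|.
Proof.
rewrite modeE; apply: le_trans (ler_normB _ _) _; rewrite !normrM.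
by apply: lerD; rewrite ler_piMr// (cos_max, sin_max).
Qed.

Lemma continuous_mode k c : continuous (mode k c).
Proof.
rewrite (_ : mode k c = fun x => complex.Re c * cos (phase k x) +
  - (complex.Im c * sin (phase k x))); last by apply/funext => x; exact: modeE.
apply: continuous_pD; [|apply: continuous_pN]; apply: continuous_pZ;
  apply: continuous_pcomp; [exact: continuous_cos|exact: continuous_phase|
  exact: continuous_sin|exact: continuous_phase].
Qed.

Lemma mode_periodic k c i x : mode k c (x + evec i) = mode k c x.
Proof. by rewrite /mode ekDr ek_evec mulr1. Qed.

(** The symbol of the partial derivative in direction [j]. *)
Definition dsym j k : R[i] := (0 +i* (pi *+ 2 * (k ord0 j)%:~R))%C.

Lemma is_derive_mode k c j x :
  is_derive x (evec j) (mode k c) (mode k (dsym j k * c) x).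
Proof.
pose b : R := pi *+ 2 * (k ord0 j)%:~R.
pose G (h : R) : R := complex.Re c * cos (b * h + phase k x) -
  complex.Im c * sin (b * h + phase k x).
have E h : mode k c (h *: evec j + x) = G h.
  by rewrite modeE phaseDr phaseZr phase_evec /G /b [h * _]mulrC.
apply: (is_derive_along E).
have dl : is_derive (0 : R) 1 (fun h => b * h + phase k x) b.
  by apply: is_derive_eq; rewrite addr0 /GRing.scale /= mulr1.
have dc := @is_derive1_comp _ cos _ 0 _ _ (is_derive_cos _) dl.
have ds := @is_derive1_comp _ sin _ 0 _ _ (is_derive_sin _) dl.
have -> : G = (complex.Re c \*: (cos \o (fun h => b * h + phase k x))) -
   (complex.Im c \*: (sin \o (fun h => b * h + phase k x))) by [].
apply: is_derive_eq; rewrite modeE cReM cImM /= mulr0 add0r -/b /GRing.scale /=.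
ring.
Qed.

Lemma mean_mode k c : k != 0 -> mean (mode k c) = 0.
Proof.
move=> k0.
have [j kj] : exists j, k ord0 j != 0.
  apply/existsP; rewrite -negb_forall; apply: contra k0 => /forallP k0.
  by apply/eqP/rowP => i; rewrite mxE; apply/eqP; exact: k0.
have d0 : dsym j k != 0.
  by rewrite eq_complex /= eqxx /= mulf_neq0 ?intr_eq0// mulrn_eq0 /= gt_eqF ?pi_gt0.
have D : 'D_(evec j) (mode k ((dsym j k)^-1 * c)) = mode k c.
  apply/funext => x; have [_ ->] := is_derive_mode k ((dsym j k)^-1 * c) j x.
  by rewrite mulrA divff// mul1r.
rewrite /mean -D cube_integral_derive0//.
- exact: continuous_mode.
- by move=> x; have [] := is_derive_mode k ((dsym j k)^-1 * c) j x.
- by rewrite D; exact: continuous_mode.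
- by move=> x; exact: mode_periodic.
Qed.

(** Frequencies may be repeated in the list: sums are concatenations, and a
    multiplier acts on each mode of a presentation rather than on the function. *)
Definition trig (r : seq ('rV[int]_n * R[i])) x : R :=
  \sum_(p <- r) mode p.1 p.2 x.

Lemma trig_cat r s x : trig (r ++ s) x = trig r x + trig s x.
Proof. by rewrite /trig big_cat. Qed.

Lemma trig_nil x : trig [::] x = 0.
Proof. by rewrite /trig big_nil. Qed.

Lemma trig_flatten (I : eqType) (s : seq I) (h : I -> seq ('rV[int]_n * R[i])) x :
  trig (flatten [seq h i | i <- s]) x = \sum_(i <- s) trig (h i) x.
Proof. by rewrite /trig big_flatten big_map. Qed.

Lemma continuous_trig r : continuous (trig r).
Proof. by apply: continuous_psum => p _; exact: continuous_mode. Qed.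

Lemma trig_periodic r i x : trig r (x + evec i) = trig r x.
Proof. by apply: eq_bigr => p _; exact: mode_periodic. Qed.

(** The Fourier multiplier with symbol [mu]. *)
Definition act (mu : 'rV[int]_n -> R[i]) (r : seq ('rV[int]_n * R[i])) :=
  [seq (p.1, mu p.1 * p.2) | p <- r].

Lemma trig_act mu r x : trig (act mu r) x = \sum_(p <- r) mode p.1 (mu p.1 * p.2) x.
Proof. by rewrite /trig /act big_map. Qed.

Lemma is_derive_trig r j x :
  is_derive x (evec j) (trig r) (trig (act (dsym j) r) x).
Proof.
elim: r => [|p r IH].
  have -> : trig [::] = cst 0 by apply/funext => y; rewrite trig_nil.
  by exact: is_derive_cst.
have -> : trig (p :: r) = mode p.1 p.2 + trig r.
  by apply/funext => y; rewrite /trig big_cons.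
rewrite trig_act big_cons -trig_act; apply: is_deriveD.
exact: is_derive_mode.
Qed.

End trig.

(** * M. Riesz's theorem for Hilbert transforms along directions *)
Section pointwise_inequalities.
Context {R : realType}.
Implicit Types (x y a b t : R).

Lemma complex_pow_bound (x y : R) j :
  `|complex.Re ((x +i* y)%C ^+ j)| <= (`|x| + `|y|) ^+ j /\
  `|complex.Im ((x +i* y)%C ^+ j)| <= (`|x| + `|y|) ^+ j.
Proof.
elim: j => [|j [IH1 IH2]]; first by rewrite !expr0 /= normr0 normr1 ler01.
rewrite !exprS cReM cImM /= mulrDl; split.
  apply: le_trans (ler_normB _ _) _; rewrite !normrM.
  by apply: lerD; rewrite ler_wpM2l.
apply: le_trans (ler_normD _ _) _; rewrite !normrM.
by apply: lerD; rewrite ler_wpM2l.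
Qed.

Lemma complex_pow_near_imaginary (x y : R) j :
  let d := (x +i* y)%C ^+ j.+1 - (0 +i* y)%C ^+ j.+1 in
  `|complex.Re d| <= j.+1%:R * `|x| * (`|x| + `|y|) ^+ j /\
  `|complex.Im d| <= j.+1%:R * `|x| * (`|x| + `|y|) ^+ j.
Proof.
elim: j => [|j /=]; first by rewrite /= ?expr0 /= subr0 subrr normr0 !mulr1 mul1r.
set d := _ - _; move=> [IH1 IH2].
have -> : (x +i* y)%C ^+ j.+2 - (0 +i* y)%C ^+ j.+2 =
    (x +i* 0)%C * (x +i* y)%C ^+ j.+1 + (0 +i* y)%C * d.
  rewrite /d; have -> : (x +i* y)%C = (x +i* 0)%C + (0 +i* y)%C.
    by apply/eqP; rewrite eq_complex /= addr0 add0r !eqxx.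
  by rewrite !exprS; ring.
have [P1 P2] := complex_pow_bound x y j.+1.
have M0 : 0 <= `|x| + `|y| by rewrite addr_ge0.
have step u v : `|u| <= (`|x| + `|y|) ^+ j.+1 ->
    `|v| <= j.+1%:R * `|x| * (`|x| + `|y|) ^+ j ->
    `|x| * `|u| + `|y| * `|v| <= j.+2%:R * `|x| * (`|x| + `|y|) ^+ j.+1.
  move=> hu hv; apply: (@le_trans _ _ (`|x| * (`|x| + `|y|) ^+ j.+1 +
      (`|x| + `|y|) * (j.+1%:R * `|x| * (`|x| + `|y|) ^+ j))).
    apply: lerD; first by rewrite ler_wpM2l.
    by apply: ler_pM => //; rewrite lerDr.
  by rewrite -[j.+2%:R]natr1 exprS le_eqVlt; apply/orP; left; apply/eqP; ring.
split.
  rewrite cReD !cReM /= !mul0r subr0 sub0r; apply: le_trans (ler_normB _ _) _.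
  by rewrite !normrM; exact: step.
rewrite (_ : complex.Im _ = x * complex.Im ((x +i* y)%C ^+ j.+1) + y * complex.Re d).
  by apply: le_trans (ler_normD _ _) _; rewrite !normrM; exact: step.
have ImD (z w : R[i]) : complex.Im (z + w) = complex.Im z + complex.Im w.
  by case: z => ? ?; case: w.
by rewrite ImD !cImM /= !mul0r addr0 add0r.
Qed.

(** M. Riesz's inequality. For [m] odd the leading term in [y] of the real part
    of the power is [- y ^+ (2 * m)], and every other term contains [x]. *)
Lemma riesz_pointwise m : odd m -> exists2 C, 0 <= C & forall x y : R,
  complex.Re ((x +i* y)%C ^+ m.*2) <= - (y ^+ m.*2) / 2 + C * x ^+ m.*2.
Proof.
move=> om; case: m om => // m om; set s := m.+1.*2.
pose t := m.*2.+1; have st : s = t.+1 by [].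
pose L : R := 2 * s%:R * 2 ^+ t.
have L0 : 0 < L by rewrite !mulr_gt0 ?ltr0n// exprn_gt0.
exists (s%:R * (1 + L) ^+ t).
  by rewrite mulr_ge0// exprn_ge0// addr_ge0// ltW.
move=> x y.
have evenX (z : R) : z ^+ s = `|z| ^+ s by rewrite /s -muln2 mulnC !exprM real_normK ?num_real.
have imE : complex.Re ((0 +i* y)%C ^+ s) = - (y ^+ s).
  rewrite /s -muln2 mulnC [in LHS]exprM.
  have -> : ((0 +i* y)%C ^+ 2 : R[i]) = (- (y ^+ 2))%:C%C.
    by apply/eqP; rewrite expr2 eq_complex /= !mul0r mulr0 sub0r addr0 expr2 !eqxx.
  by rewrite -rmorphXn /= exprNn -signr_odd om expr1 mulN1r -exprM.
have key : complex.Re ((x +i* y)%C ^+ s) <= - (y ^+ s) + s%:R * `|x| * (`|x| + `|y|) ^+ t.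
  have [+ _] := complex_pow_near_imaginary x y t.
  rewrite -st cReD cReN imE => /(le_trans (ler_norm _)).
  by move=> h; lra.
apply: le_trans key _.
rewrite -subr_ge0.
suff : s%:R * `|x| * (`|x| + `|y|) ^+ t <= `|y| ^+ s / 2 + s%:R * (1 + L) ^+ t * `|x| ^+ s.
  rewrite (evenX x) (evenX y); move: (_ * (_ + _) ^+ t) (`|y| ^+ s) (_ * `|x| ^+ s) => u v w uvw.
  by rewrite subr_ge0; lra.
have [yx|xy] := lerP `|y| (L * `|x|).
  rewrite ler_wpDl//.
  have -> : s%:R * (1 + L) ^+ t * `|x| ^+ s = s%:R * `|x| * ((1 + L) * `|x|) ^+ t.
    by rewrite st exprMn [`|x| ^+ _]exprS; ring.
  rewrite ler_wpM2l ?mulr_ge0// lerXn2r ?nnegrE// ?addr_ge0//.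
    by rewrite mulr_ge0// addr_ge0// ltW.
  by rewrite mulrDl mul1r lerD2l.
apply: ler_wpDr.
  by rewrite mulr_ge0 ?exprn_ge0// mulr_ge0// exprn_ge0// addr_ge0// ltW.
have xL : `|x| <= `|y| / L by rewrite ler_pdivlMr// mulrC ltW.
have L1 : 1 <= L.
  rewrite /L -mulrA mulr_ege1 ?ler1n// mulr_ege1// ?ler1n//.
  by rewrite exprn_ege1// ler1n.
have M2 : `|x| + `|y| <= 2 * `|y|.
  rewrite mulr_natl mulr2n lerD2r (le_trans xL)// ler_pdivrMr// ler_peMr//.
apply: (@le_trans _ _ (s%:R * (`|y| / L) * (2 * `|y|) ^+ t)).
  apply: ler_pM; [by rewrite mulr_ge0|by rewrite exprn_ge0 ?addr_ge0|by rewrite ler_wpM2l|].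
  by rewrite lerXn2r ?nnegrE ?addr_ge0 ?mulr_ge0.
have -> : `|y| ^+ s = `|y| * `|y| ^+ t by rewrite st exprS.
have s0 : s%:R != 0 :> R by rewrite pnatr_eq0.
have t0 : 2 ^+ t != 0 :> R by rewrite expf_neq0.
rewrite exprMn /L le_eqVlt; apply/orP; left; apply/eqP.
by move: (2 ^+ t) (`|y| ^+ t) t0 (s%:R) s0 => u v u0 w w0; field; rewrite u0 w0.
Qed.

End pointwise_inequalities.

Section spectral_span.
Context {R : realType} {n : nat}.
Implicit Types (S : pred 'rV[int]_n) (f g : 'rV[R]_n -> R[i]) (k : 'rV[int]_n).

Definition ctrig (r : seq ('rV[int]_n * R[i])) (x : 'rV[R]_n) : R[i] :=
  \sum_(p <- r) p.2 * ek p.1 x.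

Lemma Re_ctrig r x : complex.Re (ctrig r x) = trig r x.
Proof. by rewrite /ctrig cRe_sum. Qed.

Definition spectrum_in S f := exists2 r, all (fun p => S p.1) r & f =1 ctrig r.

Lemma spectrum_char S k (c : R[i]) : S k -> spectrum_in S (fun x => c * ek k x).
Proof.
by move=> Sk; exists [:: (k, c)]; rewrite /= ?Sk// => x; rewrite /ctrig big_seq1.
Qed.

Lemma spectrum0 S : spectrum_in S (fun=> 0).
Proof. by exists [::] => // x; rewrite /ctrig big_nil. Qed.

Lemma spectrumD S f g : spectrum_in S f -> spectrum_in S g ->
  spectrum_in S (fun x => f x + g x).
Proof.
move=> [r Sr fr] [t St gt]; exists (r ++ t); first by rewrite all_cat Sr.
by move=> x; rewrite /ctrig big_cat fr gt.
Qed.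

Lemma spectrumM S S' S'' f g :
  (forall k l, S k -> S' l -> S'' (k + l)) ->
  spectrum_in S f -> spectrum_in S' g -> spectrum_in S'' (fun x => f x * g x).
Proof.
move=> SS [r Sr fr] [t St gt].
exists [seq (p.1 + q.1, p.2 * q.2) | p <- r, q <- t].
  by apply/all_allpairsP => p q /(allP Sr) Sp /(allP St) Sq; exact: SS.
move=> x; rewrite fr gt /ctrig big_allpairs_dep mulr_suml.
apply: eq_bigr => p _; rewrite mulr_sumr; apply: eq_bigr => q _.
by rewrite /= ekDl; ring.
Qed.

Lemma mean_spectrum S f : (forall k, S k -> k != 0) -> spectrum_in S f ->
  mean (fun x => complex.Re (f x)) = 0.
Proof.
move=> S0 [r Sr fr]; have -> : (fun x => complex.Re (f x)) = trig r.
  by apply/funext => x; rewrite /= fr Re_ctrig.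
rewrite /trig mean_sum => [|p _]; last exact: continuous_mode.
by rewrite big_seq big1// => p /(allP Sr) Sp; rewrite mean_mode// S0.
Qed.

Lemma spectrum_mode S k (c : R[i]) : S k -> S (- k) ->
  spectrum_in S (fun x => (mode k c x)%:C%C).
Proof.
move=> Sk SNk.
have [r Sr hr] := spectrumD (spectrum_char (c / 2) Sk) (spectrum_char ((c^*)%C / 2) SNk).
exists r => // x; rewrite -hr ekN /mode.
have h2 : (2 : R[i])^-1 = (2^-1 : R)%:C%C by rewrite rmorphV ?unitfE ?pnatr_eq0// rmorph_nat.
rewrite h2; case: c {hr} => a b; rewrite /ek /cis.
apply/eqP; rewrite eq_complex /=; apply/andP; split; apply/eqP; by field.
Qed.

End spectral_span.

Section hilbert.
Context {R : realType} {n : nat}.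
Variable (theta : 'rV[R]_n).
Implicit Types (k : 'rV[int]_n).

Definition lin k : R := \sum_i theta ord0 i * (k ord0 i)%:~R.

Lemma linD k l : lin (k + l) = lin k + lin l.
Proof. by rewrite /lin -big_split; apply: eq_bigr => i _; rewrite mxE intrD mulrDr. Qed.

Lemma linN k : lin (- k) = - lin k.
Proof. by rewrite /lin -sumrN; apply: eq_bigr => i _; rewrite mxE mulrNz mulrN. Qed.

Lemma lin0 : lin 0 = 0.
Proof. by rewrite /lin big1// => i _; rewrite mxE mulr0. Qed.

(** The Hilbert transform in direction [theta]. *)
Definition hilbert k : R[i] := (0 +i* - Num.sg (lin k))%C.

Let pos k := 0 < lin k.
Let nul k := lin k == 0.

(** Multiplying by the sign and adding [i] times the result turns a mode of positive
    frequency into the complex exponential itself and reflects a mode of negative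
    frequency; a mode of zero frequency stays real. *)
Let analytic_mode k c : exists2 b : 'rV[R]_n -> R[i], spectrum_in pos b &
  forall x, (mode k c x +i* mode k (hilbert k * c) x)%C =
    (if nul k then mode k c x else 0)%:C%C + b x.
Proof.
have E x : mode k (hilbert k * c) x = Num.sg (lin k) * complex.Im (c * ek k x).
  by rewrite /mode -mulrA cReM /= mul0r sub0r mulNr opprK.
have [kn|kp|k0] := ltgtP (lin k) 0.
- exists (fun x => (c^*)%C * ek (- k) x).
    by apply: spectrum_char; rewrite /pos linN oppr_gt0.
  move=> x; rewrite E /nul lt_eqF// ltr0_sg// ekN /mode.
  case: (c) (ek k x) => a b [u v]; apply/eqP; rewrite eq_complex /=.
  by apply/andP; split; apply/eqP; ring.
- exists (fun x => c * ek k x); first exact: spectrum_char.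
  move=> x; rewrite E /nul gt_eqF// gtr0_sg// /mode mul1r.
  by case: (c * _) => a b; apply/eqP; rewrite eq_complex /= !add0r !eqxx.
- exists (fun=> 0); first exact: spectrum0.
  by move=> x; rewrite E /nul k0 eqxx sgr0 mul0r addr0.
Qed.

Lemma analytic_signal r : exists a b, [/\
  spectrum_in nul (fun x : 'rV[R]_n => (a x)%:C%C), spectrum_in pos b, continuous a &
  forall x, (trig r x +i* trig (act hilbert r) x)%C = (a x)%:C%C + b x].
Proof.
elim: r => [|[k c] r [a [b [na pb ca E]]]].
  exists (fun=> 0), (fun=> 0); split => [||x|x].
  - by have [t St ht] := @spectrum0 R n nul; exists t => // x; rewrite -ht.
  - exact: spectrum0.
  - exact: cst_continuous.
  - by rewrite trig_act /trig !big_nil addr0.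
have [b' pb' E'] := analytic_mode k c.
exists (fun x => (if nul k then mode k c x else 0) + a x), (fun x => b' x + b x).
split.
- have : spectrum_in nul (fun x : 'rV[R]_n => (if nul k then mode k c x else 0)%:C%C).
    case k0 : (nul k); last exact: spectrum0.
    by apply: spectrum_mode => //; rewrite /nul linN oppr_eq0.
  move=> /spectrumD/(_ na) [t St ht]; exists t => // x.
  by rewrite -ht rmorphD.
- exact: spectrumD.
- case: (nul k); apply: continuous_pD => //; first exact: continuous_mode.
  exact: continuous_pcst.
- move=> x; rewrite trig_act /trig !big_cons -trig_act.
  transitivity ((mode k c x +i* mode k (hilbert k * c) x)%C +
      (trig r x +i* trig (act hilbert r) x)%C); first by [].
  by rewrite E E' rmorphD /= addrACA.
Qed.

(** Frequencies with [lin k = 0] and frequencies with [0 < lin k] add up to positive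
    ones, so the binomial expansion of a power has a single term without positive
    frequencies. *)
Lemma analytic_power a b j :
  spectrum_in nul (fun x : 'rV[R]_n => (a x)%:C%C) -> spectrum_in pos b ->
  spectrum_in nul (fun x : 'rV[R]_n => (a x ^+ j)%:C%C) /\
  exists2 bj, spectrum_in pos bj &
    forall x, ((a x)%:C%C + b x) ^+ j = (a x ^+ j)%:C%C + bj x.
Proof.
move=> na pb.
have nn k l : nul k -> nul l -> nul (k + l).
  by rewrite /nul linD => /eqP -> /eqP ->; rewrite addr0.
have np k l : nul k -> pos l -> pos (k + l) by rewrite /nul/pos linD => /eqP ->; rewrite add0r.
have pn k l : pos k -> nul l -> pos (k + l) by rewrite addrC => pk nl; exact: np.
have pp k l : pos k -> pos l -> pos (k + l) by rewrite /pos linD; exact: addr_gt0.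
elim: j => [|j [IH1 [bj pbj E]]].
  split.
    exists [:: (0, 1)]; first by rewrite /= /nul lin0 eqxx.
    by move=> x; rewrite /ctrig big_seq1 /= ek0 expr0 mulr1.
  exists (fun=> 0); first exact: spectrum0.
  by move=> x; rewrite !expr0 addr0.
split.
  have [t St ht] := spectrumM nn na IH1; exists t => // x.
  by rewrite -ht exprS rmorphM.
exists (fun x => (a x)%:C%C * bj x + (b x * (a x ^+ j)%:C%C + b x * bj x)).
  apply: spectrumD; first exact: (spectrumM np).
  by apply: spectrumD; [exact: (spectrumM pn)|exact: (spectrumM pp)].
by move=> x; rewrite exprS E exprS rmorphM /=; ring.
Qed.

End hilbert.

(** The even power of the analytic signal has mean [mean (a ^+ s) >= 0], because
    positive frequencies have mean zero; the pointwise inequality turns this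
    into a norm bound that does not depend on the direction. *)
Lemma hilbert_bound {R : realType} (n m : nat) : odd m ->
  exists2 C : R, 0 <= C & forall (theta : 'rV[R]_n) r,
    mean (fun x => trig (act (hilbert theta) r) x ^+ m.*2) <=
    C * mean (fun x => trig r x ^+ m.*2).
Proof.
move=> om; have [C C0 HC] := @riesz_pointwise R m om.
exists (2 * C); first by rewrite mulr_ge0.
move=> theta r; have [a [b [na pb ca E]]] := analytic_signal theta r.
have [_ [bj pbj Ej]] := analytic_power m.*2 na pb.
set u := trig r; set v := trig (act _ r).
have cs w : continuous (fun x => trig w x ^+ m.*2 : R).
  by apply: continuous_pX; exact: continuous_trig.
have mb : mean (fun x => complex.Re (bj x)) = 0.
  by apply: mean_spectrum pbj => k; apply: contraTneq => ->; rewrite lin0 ltxx.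
have [t _ bt] := pbj.
have cb : continuous (fun x => complex.Re (bj x)).
  have -> : (fun x => complex.Re (bj x)) = trig t.
    by apply/funext => x; rewrite /= bt Re_ctrig.
  exact: continuous_trig.
have : mean (fun x => a x ^+ m.*2 + complex.Re (bj x)) <=
    mean (fun x => - (2^-1) * v x ^+ m.*2 + C * u x ^+ m.*2).
  apply: le_mean.
  - by apply: continuous_pD => //; exact: continuous_pX.
  - by apply: continuous_pD; apply: continuous_pZ; exact: cs.
  - move=> x; have := HC (u x) (v x).
    by rewrite E Ej cReD /=; lra.
rewrite meanD//; last exact: continuous_pX.
rewrite meanD//; [|by apply: continuous_pZ; exact: cs..].
rewrite !meanZ//; [|exact: cs..].
rewrite mb addr0.
have : 0 <= mean (fun x => a x ^+ m.*2).
  by apply: mean_ge0 => x; rewrite -muln2 exprM sqr_ge0.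
by lra.
Qed.

(** * Fourier multipliers *)
Section power_inequalities.
Context {R : realType}.
Implicit Types (x y a t : R).

Lemma even_normX s x : ~~ odd s -> `|x| ^+ s = x ^+ s.
Proof.
by move=> es; rewrite -(odd_double_half s) (negbTE es) add0n -muln2 mulnC !exprM real_normK ?num_real.
Qed.

Lemma even_expr_ge0 s x : ~~ odd s -> 0 <= x ^+ s.
Proof. by move=> es; rewrite -even_normX// exprn_ge0. Qed.

(** A power lies above its tangent at [t]; this is the source of Jensen's inequality. *)
Lemma tangent_expr s a t : 0 <= a -> 0 <= t ->
  s.+1%:R * t ^+ s * a - s%:R * t ^+ s.+1 <= a ^+ s.+1.
Proof.
move=> a0 t0; elim: s => [|s IH].
  by rewrite expr0 !expr1 mul0r subr0 !mul1r.
rewrite [leRHS]exprS; apply: le_trans (ler_wpM2l a0 IH).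
rewrite -subr_ge0 [X in 0 <= X](_ : _ = s.+1%:R * t ^+ s * (a - t) ^+ 2).
  by rewrite mulr_ge0 ?sqr_ge0// mulr_ge0// exprn_ge0.
rewrite !exprS -[s.+2%:R]natr1 -[s.+1%:R]natr1; ring.
Qed.

(** Jensen's inequality for an even power and a uniform average. *)
Lemma average_expr_le s N (a : 'I_N -> R) : ~~ odd s -> (0 < N)%N ->
  (N%:R^-1 * \sum_i a i) ^+ s <= N%:R^-1 * \sum_i a i ^+ s.
Proof.
case: s => [|s] es N0.
  rewrite expr0; under eq_bigr do rewrite expr0.
  by rewrite sumr_const card_ord mulVf// pnatr_eq0 -lt0n.
have N0' : 0 < N%:R :> R by rewrite ltr0n.
pose t := N%:R^-1 * \sum_i `|a i|.
have t0 : 0 <= t by rewrite mulr_ge0 ?invr_ge0 ?ler0n// sumr_ge0.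
apply: (@le_trans _ _ (t ^+ s.+1)).
  rewrite -(even_normX _ es) lerXn2r ?nnegrE//.
  by rewrite normrM ger0_norm ?invr_ge0 ?ler0n// ler_wpM2l ?invr_ge0 ?ler0n// ler_norm_sum.
rewrite -ler_pdivrMl ?invr_gt0// invrK.
apply: (@le_trans _ _ (\sum_i (s.+1%:R * t ^+ s * `|a i| - s%:R * t ^+ s.+1))).
  rewrite sumrB -mulr_sumr sumr_const card_ord.
  have -> : \sum_i `|a i| = N%:R * t by rewrite /t mulrA mulfV ?mul1r// gt_eqF.
  rewrite -mulr_natl exprS -[s.+1%:R]natr1 le_eqVlt; apply/orP; left; apply/eqP; ring.
by apply: ler_sum => i _; rewrite -(even_normX _ es); exact: tangent_expr.
Qed.

Lemma exprD_le s x y : ~~ odd s -> (x + y) ^+ s <= 2 ^+ s * (x ^+ s + y ^+ s).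
Proof.
move=> es; rewrite -(even_normX (x + y) es) -(even_normX x es) -(even_normX y es).
apply: (@le_trans _ _ ((2 * Num.max `|x| `|y|) ^+ s)).
  rewrite lerXn2r ?nnegrE ?mulr_ge0 ?le_max ?normr_ge0//.
  rewrite (le_trans (ler_normD _ _))// mulr_natl mulr2n.
  by apply: lerD; rewrite le_max lexx ?orbT.
rewrite exprMn ler_wpM2l ?exprn_ge0//.
by case: (leP `|x| `|y|) => _; rewrite (lerDl, lerDr) exprn_ge0.
Qed.

End power_inequalities.

Section multipliers.
Context {R : realType} {n : nat} (s : nat) (es : ~~ odd s).
Implicit Types (mu nu : 'rV[int]_n -> R) (C D : R) (k : 'rV[int]_n).

Definition ract mu := act (fun k => (mu k)%:C%C).

Definition Lnorm_le C mu := forall r : seq ('rV[int]_n * R[i]),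
  mean (fun x => trig (ract mu r) x ^+ s) <= C * mean (fun x => trig r x ^+ s).

(** The [L^s] Fourier multipliers with real symbol, tested on trigonometric
    polynomials. *)
Definition multiplier mu := exists2 C, 0 <= C & Lnorm_le C mu.

Let cs r : continuous (fun x : 'rV[R]_n => trig r x ^+ s).
Proof. by apply: continuous_pX; exact: continuous_trig. Qed.

Lemma trig_ractD mu nu r x :
  trig (ract (fun k => mu k + nu k) r) x = trig (ract mu r) x + trig (ract nu r) x.
Proof.
rewrite !trig_act -big_split; apply: eq_bigr => p _.
by rewrite rmorphD mulrDl modeD.
Qed.

Lemma trig_ractZ (a : R) mu r x :
  trig (ract (fun k => a * mu k) r) x = a * trig (ract mu r) x.
Proof.
rewrite !trig_act mulr_sumr; apply: eq_bigr => p _.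
by rewrite rmorphM /= -mulrA modeZ.
Qed.

Lemma trig_ract_sum I (t : seq I) (P : pred I) (mu : I -> 'rV[int]_n -> R) r x :
  trig (ract (fun k => \sum_(i <- t | P i) mu i k) r) x =
  \sum_(i <- t | P i) trig (ract (mu i) r) x.
Proof.
rewrite !trig_act; under [RHS]eq_bigr do rewrite trig_act.
rewrite exchange_big; apply: eq_bigr => p _.
by rewrite -mode_sum -mulr_suml rmorph_sum.
Qed.

Lemma ract_ract mu nu r : ract mu (ract nu r) = ract (fun k => mu k * nu k) r.
Proof.
rewrite /ract /act -map_comp; apply: eq_map => p /=.
by rewrite mulrA -rmorphM.
Qed.

Lemma trig_cst (a : R) r x : trig (ract (fun=> a) r) x = a * trig r x.
Proof. by rewrite trig_act /trig mulr_sumr; apply: eq_bigr => p _; rewrite modeZ. Qed.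

Lemma multiplier_cst a : multiplier (fun=> a).
Proof.
exists (a ^+ s); first exact: even_expr_ge0.
move=> r; rewrite -meanZ// le_eqVlt; apply/orP; left; apply/eqP; congr mean.
by apply/funext => x; rewrite trig_cst exprMn.
Qed.

Lemma Lnorm_leM C D mu nu : 0 <= C -> Lnorm_le C mu -> Lnorm_le D nu ->
  Lnorm_le (C * D) (fun k => mu k * nu k).
Proof.
move=> C0 HC HD r; rewrite -ract_ract; apply: le_trans (HC _) _.
by rewrite -mulrA ler_wpM2l.
Qed.

Lemma multiplierM mu nu : multiplier mu -> multiplier nu ->
  multiplier (fun k => mu k * nu k).
Proof.
move=> [C C0 HC] [D D0 HD]; exists (C * D); first exact: mulr_ge0.
exact: Lnorm_leM.
Qed.

Lemma multiplierD mu nu : multiplier mu -> multiplier nu ->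
  multiplier (fun k => mu k + nu k).
Proof.
move=> [C C0 HC] [D D0 HD]; exists (2 ^+ s * (C + D)).
  by rewrite mulr_ge0 ?exprn_ge0// addr_ge0.
move=> r.
apply: (@le_trans _ _ (mean (fun x => 2 ^+ s *
   (trig (ract mu r) x ^+ s + trig (ract nu r) x ^+ s)))).
  apply: le_mean => //; first by apply: continuous_pZ; exact: continuous_pD.
  by move=> x; rewrite trig_ractD exprD_le.
rewrite meanZ; last exact: continuous_pD.
rewrite meanD// -mulrA ler_wpM2l ?exprn_ge0// mulrDl.
by apply: lerD.
Qed.

Lemma multiplier_ext mu nu : mu =1 nu -> multiplier mu -> multiplier nu.
Proof. by move=> /funext ->. Qed.

Lemma multiplierN mu : multiplier mu -> multiplier (fun k => - mu k).
Proof.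
move=> mm; apply: (multiplier_ext (mu := fun k => -1 * mu k)).
  by move=> k; rewrite mulN1r.
by apply: multiplierM => //; exact: multiplier_cst.
Qed.

Lemma multiplierB mu nu : multiplier mu -> multiplier nu ->
  multiplier (fun k => mu k - nu k).
Proof. by move=> mm mn; apply: multiplierD => //; exact: multiplierN. Qed.

Lemma multiplier_prod I (t : seq I) (P : pred I) (mu : I -> 'rV[int]_n -> R) :
  (forall i, P i -> multiplier (mu i)) ->
  multiplier (fun k => \prod_(i <- t | P i) mu i k).
Proof.
move=> mm; elim: t => [|i t IH].
  apply: (multiplier_ext (mu := fun=> 1)); last exact: multiplier_cst.
  by move=> k; rewrite big_nil.
case Pi : (P i); last by apply: multiplier_ext IH => k; rewrite big_cons Pi.
apply: (multiplier_ext (mu := fun k => mu i k * \prod_(i <- t | P i) mu i k)).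
  by move=> k; rewrite big_cons Pi.
by apply: multiplierM => //; exact: mm.
Qed.

(** Unlike for sums, the bound of an average does not grow with the number of terms. *)
Lemma Lnorm_le_average C N (mu : 'I_N -> 'rV[int]_n -> R) : (0 < N)%N ->
  (forall i, Lnorm_le C (mu i)) -> Lnorm_le C (fun k => N%:R^-1 * \sum_i mu i k).
Proof.
move=> N0 HC r.
apply: (@le_trans _ _ (mean (fun x => N%:R^-1 * \sum_i trig (ract (mu i) r) x ^+ s))).
  apply: le_mean => //; first by apply: continuous_pZ; apply: continuous_psum.
  by move=> x; rewrite trig_ractZ trig_ract_sum average_expr_le.
rewrite meanZ; last by apply: continuous_psum.
rewrite mean_sum// ler_pdivrMl ?ltr0n//.
apply: (@le_trans _ _ (\sum_(i < N) C * mean (fun x => trig r x ^+ s))).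
  by apply: ler_sum => i _; exact: HC.
by rewrite sumr_const card_ord mulr_natl.
Qed.

(** A trigonometric polynomial has finitely many frequencies, so pointwise
    convergence of the symbols gives uniform convergence of the images. *)
Lemma multiplier_lim C (mu_ : nat -> 'rV[int]_n -> R) mu : 0 <= C ->
  (forall N, Lnorm_le C (mu_ N)) ->
  (forall k (e : R), 0 < e -> \forall N \near \oo, `|mu_ N k - mu k| <= e) ->
  multiplier mu.
Proof.
move=> C0 HC cv; exists (2 ^+ s * C); first by rewrite mulr_ge0// exprn_ge0.
move=> r; have [s0|s0] := posnP s.
  have H := HC 0%N r; rewrite s0 in H *; rewrite expr0 mul1r; apply: le_trans H.
  by rewrite le_eqVlt; apply/orP; left; apply/eqP; congr mean; apply/funext => x.
pose A : R := \sum_(p <- r) (`|complex.Re p.2| + `|complex.Im p.2|).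
have A0 : 0 <= A by apply: sumr_ge0 => p _; rewrite addr_ge0.
apply/ler_addgt0Pr => e e0.
pose d : R := Num.min 1 (e / (2 ^+ s * (A + 1) ^+ s)).
have D0 : 0 < 2 ^+ s * (A + 1) ^+ s by rewrite mulr_gt0// exprn_gt0// ltr_wpDl.
have d0 : 0 < d by rewrite lt_min ltr01/= divr_gt0.
have [N HN] : exists N, forall p, p \in r -> `|mu_ N p.1 - mu p.1| <= d.
  have : \forall N \near \oo, forall p, p \in r -> `|mu_ N p.1 - mu p.1| <= d.
    elim: (r) => [|q t IH]; first by apply: nearW => N p.
    near=> N => p; rewrite inE => /orP[/eqP ->|].
      by near: N; exact: cv.
    by move: p; near: N.
  by move=> [N _ HN]; exists N; exact: (HN N (leqnn N)).
have diff x : `|trig (ract mu r) x - trig (ract (mu_ N) r) x| <= d * (A + 1).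
  rewrite !trig_act -sumrB (le_trans (ler_norm_sum _ _ _))//.
  apply: (@le_trans _ _ (\sum_(p <- r) d * (`|complex.Re p.2| + `|complex.Im p.2|))).
    rewrite big_seq [leRHS]big_seq; apply: ler_sum => p pr.
    rewrite !modeZ -mulrBl normrM distrC; apply: ler_pM => //; first exact: HN.
    exact: mode_le.
  by rewrite -mulr_sumr ler_wpM2l ?ltW// ltrDl.
apply: (@le_trans _ _ (mean (fun x : 'rV[R]_n => 2 ^+ s * (trig (ract (mu_ N) r) x ^+ s + (d * (A + 1)) ^+ s)))).
  apply: le_mean => //.
    by apply: continuous_pZ; apply: continuous_pD => //; exact: continuous_pcst.
  move=> x; rewrite -[trig (ract mu r) x](subrK (trig (ract (mu_ N) r) x)) addrC.
  apply: le_trans (exprD_le _ _ es) _.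
  rewrite ler_wpM2l ?exprn_ge0// lerD2l -even_normX// lerXn2r ?nnegrE//.
  by rewrite mulr_ge0// ltW// ltr_wpDl.
rewrite meanZ; last by apply: continuous_pD => //; exact: continuous_pcst.
rewrite meanD//; last exact: continuous_pcst.
rewrite mean_cst mulrDr -mulrA; apply: lerD.
  by apply: ler_wpM2l; [exact: exprn_ge0|exact: HC].
rewrite exprMn mulrCA.
apply: (@le_trans _ _ (d * (2 ^+ s * (A + 1) ^+ s))).
  rewrite ler_wpM2r ?(ltW D0)// -(prednK s0) exprS ler_piMr ?(ltW d0)//.
  by rewrite exprn_ile1 ?(ltW d0)// ge_min lexx.
by rewrite -ler_pdivlMr// ge_min lexx orbT.
Unshelve. all: by end_near. Qed.

End multipliers.

(** * Symbols of an oblique projection *)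

(** A Riemann sum for the integral over [[0, N]] of the sign of [y - t]. *)
Lemma sgr_sum_near {R : realFieldType} (N : nat) (y : R) : 0 <= y <= N%:R ->
  `|\sum_(l < N) Num.sg (y - l%:R) - (2 * y - N%:R)| <= 2.
Proof.
elim: N y => [|N IH] y /andP[y0 yN].
  have -> : y = 0 by apply/le_anti; rewrite y0 yN.
  by rewrite big_ord0 mulr0 !subrr normr0.
have above (z : R) M : M%:R <= z -> \sum_(l < M) Num.sg (z - l%:R) = M%:R.
  move=> Mz; rewrite (eq_bigr (fun=> 1)) ?sumr_const ?card_ord// => l _.
  by rewrite gtr0_sg// subr_gt0 (lt_le_trans _ Mz)// ltr_nat.
rewrite big_ord_recr /=; have [yltN|Nlty|yN'] := ltgtP y N%:R.
- rewrite ltr0_sg ?subr_lt0//.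
  have := IH y; rewrite y0 (ltW yltN) => /(_ isT).
  by rewrite -natr1; set S := \sum_(i < N) _; rewrite (_ : S + -1 - _ = S - (2 * y - N%:R)); last ring.
- rewrite above ?(ltW Nlty)// gtr0_sg ?subr_gt0//.
  move: yN; rewrite -natr1 => yN.
  by rewrite ler_norml; apply/andP; split; lra.
- rewrite above ?yN'// subrr sgr0 -natr1.
  by rewrite ler_norml; apply/andP; split; lra.
Qed.

Section projection_symbols.
Context {R : realType} {n : nat}.
Implicit Types (k : 'rV[int]_n) (i j : 'I_n).

Definition fr i k : R := (k ord0 i)%:~R.

Lemma fr0P k : k != 0 -> exists i, fr i k != 0.
Proof.
move=> k0; apply/existsP; rewrite -negb_forall; apply: contra k0 => /forallP k0.
by apply/eqP/rowP => i; rewrite mxE; apply/eqP; rewrite -(intr_eq0 R); exact: k0.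
Qed.

Lemma lin_evec i k : lin (evec i) k = fr i k.
Proof.
rewrite /lin (bigD1 i)//= big1 ?addr0 => [|j ji]; first by rewrite mxE !eqxx mul1r.
by rewrite mxE (negbTE ji) andbF mul0r.
Qed.

Lemma lin_comb (a : R) i j k : lin (evec j + a *: evec i) k = fr j k + a * fr i k.
Proof.
rewrite -!lin_evec /lin mulr_sumr -big_split; apply: eq_bigr => l _.
by rewrite !mxE mulrDl mulrA.
Qed.

Definition sgn2 (theta theta' : 'rV[R]_n) k : R :=
  Num.sg (lin theta k) * Num.sg (lin theta' k).

(** Up to the sign, [sgn2] is the symbol of a composition of two Hilbert transforms:
    a single sign is odd and would need an imaginary symbol. *)
Lemma sgn2_bound m : odd m ->
  exists2 C, 0 <= C & forall theta theta', Lnorm_le m.*2 C (sgn2 theta theta').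
Proof.
move=> om; have [C C0 HC] := @hilbert_bound R n m om.
exists (C * C); first exact: mulr_ge0.
move=> th th' r; rewrite -mulrA.
apply: le_trans (ler_wpM2l C0 (HC th' r)); apply: le_trans (HC th _).
rewrite le_eqVlt; apply/orP; left; apply/eqP; congr mean; apply/funext => x.
rewrite -[RHS]even_normX ?odd_double// -normrN even_normX ?odd_double//; congr (_ ^+ _).
rewrite !trig_act big_map -sumrN; apply: eq_bigr => p _ /=.
rewrite /mode -cReN; congr complex.Re; rewrite -mulNr; congr (_ * _).
rewrite /sgn2 /hilbert; case: p.2 => a b; apply/eqP; rewrite eq_complex /=.
by apply/andP; split; apply/eqP; ring.
Qed.

(** The comparison of [|k_i|] and [|k_j|] is read off the sign of
    [k_j ^+ 2 - k_i ^+ 2], which factors into two linear forms. *)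
Definition larger i j k : R :=
  let e := sgn2 (evec j + -1 *: evec i) (evec j + 1 *: evec i) k in (e + e ^+ 2) / 2.

Lemma largerE i j k : larger i j k = (`|fr i k| < `|fr j k|)%R%:R.
Proof.
rewrite /larger /sgn2 !lin_comb mul1r mulN1r -sgrM -subr_sqr.
rewrite -[fr j k ^+ 2]real_normK ?num_real// -[fr i k ^+ 2]real_normK ?num_real//.
have [h|h|h] := ltgtP (`|fr i k|%R) (`|fr j k|%R).
- by rewrite gtr0_sg ?subr_gt0 ?ltrXn2r// expr1n -mulr2n divff ?pnatr_eq0.
- by rewrite ltr0_sg ?subr_lt0 ?ltrXn2r// sqrrN expr1n addNr mul0r.
- by rewrite h subrr sgr0 expr0n /= addr0 mul0r.
Qed.

Definition maximal i k : R := \prod_j (1 - larger i j k).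

Lemma maximalE i k : maximal i k = [forall j, (`|fr j k| <= `|fr i k|)%R]%:R.
Proof.
rewrite /maximal; set b := [forall _, _]; have [/forallP m|] := boolP b.
  by rewrite big1// => j _; rewrite largerE le_gtF ?subr0//; exact: m.
rewrite negb_forall => /existsP[j]; rewrite -ltNge => ij.
by rewrite (bigD1 j)//= largerE ij subrr mul0r.
Qed.

(** Ties between maximal coordinates are broken in favour of the first one. *)
Definition cone i k : R := maximal i k * \prod_(j < n | (j < i)%N) (1 - maximal j k).

Lemma sum_cone k : (0 < n)%N -> \sum_i cone i k = 1.
Proof.
move=> n0.
have [i0 m0] : exists i, maximal i k = 1.
  case: (Order.TotalTheory.arg_maxP (fun j => `|fr j k|) (erefl : xpredT (Ordinal n0))).
  move=> i _ mi; exists i; rewrite maximalE; set b := [forall _, _].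
  by have -> : b by apply/forallP => l; exact: mi.
have m01 i : maximal i k = 0 \/ maximal i k = 1.
  by rewrite maximalE; set b := [forall _, _]; case: b; [right|left].
pose P i := maximal i k == 1.
have Pi0 : P i0 by rewrite /P m0.
case: (arg_minnP (fun i : 'I_n => val i) Pi0) => i /eqP mi imin.
rewrite (bigD1 i)//= big1 ?addr0 => [|j ji].
  rewrite /cone mi mul1r big1// => j ji.
  have [->|mj] := m01 j; first by rewrite subr0.
  by have := imin j; rewrite /P mj eqxx leqNgt ji => /(_ isT).
have [mj|mj] := m01 j; first by rewrite /cone mj mul0r.
have ij : (i < j)%N.
  rewrite ltn_neqAle imin ?/P ?mj// andbT.
  by apply: contra ji => /eqP/val_inj ->.
by rewrite /cone (bigD1 i)//= mi subrr mul0r mulr0.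
Qed.

Lemma cone_neq0 i k j : cone i k != 0 -> `|fr j k| <= `|fr i k|.
Proof.
rewrite /cone maximalE; set b := [forall _, _].
have [/forallP m _|_] := boolP b; first exact: m.
by rewrite mul0r eqxx.
Qed.

(** The vector field [nu]: it is homogeneous of degree -1 and has scalar product 1
    with [k], as [k / |k|^2] in the symbol of the orthogonal projection. *)
Definition conormal i k : R := cone i k / fr i k.

Lemma sum_conormal k : (0 < n)%N -> k != 0 -> \sum_i conormal i k * fr i k = 1.
Proof.
move=> n0 k0; rewrite -(sum_cone k n0); apply: eq_bigr => i _; rewrite /conormal.
have [->|ci] := eqVneq (cone i k) 0; first by rewrite !mul0r.
rewrite divfK//; have [j kj] := fr0P k0.
by rewrite -normr_gt0; apply: lt_le_trans (cone_neq0 j ci); rewrite normr_gt0.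
Qed.

(** The entries of [nu k^T], homogeneous of degree 0 in [k]. *)
Definition cone_ratio i j k : R := conormal i k * fr j k.

Variable (m : nat) (om : odd m).
Let s := m.*2.
Let es : ~~ odd s. Proof. by rewrite /s odd_double. Qed.

Lemma multiplier_larger i j : multiplier s (larger i j).
Proof.
have [C C0 HC] := sgn2_bound om.
have ms : multiplier s (sgn2 (evec j + -1 *: evec i) (evec j + 1 *: evec i)).
  by exists C => //; exact: HC.
rewrite /larger; apply: multiplierM => //; last exact: multiplier_cst.
apply: multiplierD => //; apply: multiplierM => //.
Qed.

Lemma multiplier_maximal i : multiplier s (maximal i).
Proof.
rewrite /maximal; apply: multiplier_prod => // j _.
by apply: multiplierB => //; [exact: multiplier_cst|exact: multiplier_larger].
Qed.

Lemma multiplier_cone i : multiplier s (cone i).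
Proof.
apply: multiplierM => //; first exact: multiplier_maximal.
apply: multiplier_prod => // j _.
by apply: multiplierB => //; [exact: multiplier_cst|exact: multiplier_maximal].
Qed.

(** On the cone where [|k_j| <= |k_i|], the quotient [k_j / k_i] is the average of
    [sg (k_j - a * k_i) * sg k_i] over the slopes [a] in [[-1, 1]]. *)
Lemma multiplier_cone_ratio i j : multiplier s (cone_ratio i j).
Proof.
have [C C0 HC] := sgn2_bound om; have [D D0 HD] := multiplier_cone i.
pose slope N (l : 'I_N.+1) : R := 1 - 2 * l%:R / N.+1%:R.
pose mu_ N k := cone i k * (N.+1%:R^-1 *
   \sum_(l < N.+1) sgn2 (evec j + slope N l *: evec i) (evec i) k).
apply: (@multiplier_lim _ _ _ es (D * C) mu_); first exact: mulr_ge0.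
  by move=> N; apply: Lnorm_leM => //; apply: Lnorm_le_average => // l; exact: HC.
move=> k e e0.
have [ci|ci] := eqVneq (cone i k) 0.
  by apply: nearW => N; rewrite /mu_ /cone_ratio /conormal ci !mul0r subrr normr0 ltW.
have kji := cone_neq0 j ci.
have [fi0|fi0] := eqVneq (fr i k) 0.
  have fj0 : fr j k = 0 by apply/eqP; rewrite -normr_le0 (le_trans kji)// fi0 normr0.
  apply: nearW => N; rewrite /mu_ /cone_ratio fj0 mulr0 subr0 big1 ?mulr0 ?normr0 ?ltW// => l _.
  by rewrite /sgn2 !lin_comb lin_evec fi0 sgr0 mulr0.
set tau := fr j k / fr i k.
have tau1 : `|tau| <= 1.
  by rewrite normrM normfV ler_pdivrMr ?normr_gt0// mul1r.
pose d := e / (2 * (`|cone i k| + 1)).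
have c0 : 0 < `|cone i k| + 1 by rewrite ltr_wpDl.
have d0 : 0 < d by rewrite divr_gt0// mulr_gt0.
near=> N.
have N0 : 0 < N.+1%:R :> R by rewrite ltr0n.
pose y := N.+1%:R * (tau + 1) / 2.
have sgE l : sgn2 (evec j + slope N l *: evec i) (evec i) k = Num.sg (y - l%:R).
  rewrite /sgn2 lin_comb lin_evec -sgrM.
  have -> : (fr j k + slope N l * fr i k) * fr i k =
      (fr i k ^+ 2 * (2 / N.+1%:R)) * (y - l%:R).
    by rewrite /slope /y /tau; field; rewrite fi0 gt_eqF.
  by rewrite sgrM gtr0_sg ?mul1r// mulr_gt0 ?divr_gt0// lt0r sqrf_eq0 fi0 sqr_ge0.
have yN : 0 <= y <= N.+1%:R.
  move: tau1; rewrite ler_norml => /andP[t1 t2]; apply/andP; split.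
    by apply: divr_ge0 => //; apply: mulr_ge0; [exact: ltW|lra].
  rewrite /y -mulrA ler_piMr ?(ltW N0)//; lra.
have -> : mu_ N k - cone_ratio i j k = cone i k *
    (N.+1%:R^-1 * (\sum_(l < N.+1) Num.sg (y - l%:R) - (2 * y - N.+1%:R))).
  rewrite /mu_ /cone_ratio /conormal; under eq_bigr do rewrite sgE.
  have -> : 2 * y - N.+1%:R = N.+1%:R * tau by rewrite /y; field.
  rewrite [in RHS]mulrBr mulKf ?(gt_eqF N0)// mulrBr /tau; congr (_ - _).
  by rewrite mulrAC mulrA.
rewrite normrM [X in _ * X]normrM normfV (gtr0_norm N0).
apply: (@le_trans _ _ ((`|cone i k| + 1) * (d * 2))); last first.
  by rewrite /d le_eqVlt; apply/orP; left; apply/eqP; field; rewrite gt_eqF.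
apply: ler_pM; [exact: normr_ge0|by rewrite mulr_ge0// invr_ge0 ltW|by rewrite lerDl|].
apply: ler_pM; [by rewrite invr_ge0 ltW|exact: normr_ge0| |exact: sgr_sum_near].
by apply/ltW; near: N; exact: (near_infty_natSinv_lt (PosNum d0)).
Unshelve. all: by end_near. Qed.

End projection_symbols.

(** * Uniform density of trigonometric polynomials *)
Section periodic_modulus.
Context {R : realType} {n : nat}.
Implicit Types (x y : 'rV[R]_n) (i : 'I_n).

Lemma periodic_int (V : Type) (g : 'rV[R]_n -> V) (z : 'rV[int]_n) x :
  (forall i x, g (x + evec i) = g x) -> g (x + map_mx intr z) = g x.
Proof.
move=> pg.
have nat_case i (k : nat) y : g (y + k%:R *: evec i) = g y.
  elim: k y => [|k IH] y; first by rewrite scale0r addr0.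
  by rewrite -natr1 scalerDl scale1r addrA pg IH.
have int_case i (k : int) y : g (y + k%:~R *: evec i) = g y.
  case: k => k; first exact: nat_case.
  rewrite NegzE -[in RHS](subrK (k.+1%:R *: evec i) y) nat_case.
  by rewrite mulrNz scaleNr.
have -> : map_mx intr z = \sum_i (z ord0 i)%:~R *: evec i :> 'rV[R]_n.
  rewrite {1}(row_sum_delta (map_mx intr z)); apply: eq_bigr => i _.
  by rewrite mxE.
by elim: (index_enum _) x => [|i s IH] x; rewrite ?big_nil ?addr0// big_cons addrA IH int_case.
Qed.

Definition chord i x y : R := (1 - cos (pi *+ 2 * (x ord0 i - y ord0 i))) / 2.

Lemma chord_ge0 i x y : 0 <= chord i x y.
Proof. by rewrite divr_ge0// subr_ge0 cos_le1. Qed.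

Lemma chord_le1 i x y : chord i x y <= 1.
Proof. by rewrite /chord; have := cos_geN1 (pi *+ 2 * (x ord0 i - y ord0 i)); lra. Qed.

Lemma cos_2pi_int (t : R) (z : int) : cos (pi *+ 2 * (t + z%:~R)) = cos (pi *+ 2 * t).
Proof.
have := cisD (pi *+ 2 * t) (pi *+ 2 * z%:~R).
by rewrite -mulrDr cis_int mulr1 => -[].
Qed.

Lemma chord_intl i x y (z : 'rV[int]_n) : chord i (x + map_mx intr z) y = chord i x y.
Proof. by rewrite /chord !mxE addrAC cos_2pi_int. Qed.

Lemma chord_intr i x y (z : 'rV[int]_n) : chord i x (y + map_mx intr z) = chord i x y.
Proof. by rewrite /chord !mxE opprD addrA -mulrNz cos_2pi_int. Qed.

Lemma chord_eq0 i x y : 0 <= x ord0 i <= 1 -> 0 <= y ord0 i <= 1 -> chord i x y = 0 ->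
  exists z : int, x ord0 i = y ord0 i + z%:~R.
Proof.
set a := x ord0 i; set b := y ord0 i => /andP[a0 a1] /andP[b0 b1] ab0.
have s0 : sin (pi * (a - b)) = 0.
  apply/eqP; rewrite -sqrf_eq0 sin2cos2; apply/eqP.
  have := cos_mulr2n (pi * (a - b)); rewrite -mulrnAl => c2.
  by move: ab0; rewrite /chord -/a -/b c2 -mulr_natl; lra.
have pos (t : R) : 0 < t -> t < 1 -> sin (pi * t) != 0.
  move=> t0 t1; rewrite gt_eqF// sin_gt0_pi// mulr_gt0 ?pi_gt0//=.
  by rewrite gtr_pMr ?pi_gt0.
have [ab|ab|->] := ltgtP a b; last by exists 0; rewrite addr0.
- have [ba1|ba1] := ltP (b - a) 1; last first.
    by exists (-1); rewrite mulrNz; lra.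
  have := pos (b - a); rewrite subr_gt0 => /(_ ab ba1).
  by rewrite -opprB mulrN sinN s0 oppr0 eqxx.
- have [ba1|ba1] := ltP (a - b) 1; last by exists 1; lra.
  by have := pos (a - b); rewrite subr_gt0 => /(_ ab ba1); rewrite s0 eqxx.
Qed.

Lemma to_unit_cube x : exists z : 'rV[int]_n, forall i,
  0 <= (x + map_mx intr z) ord0 i <= 1.
Proof.
exists (\row_i - Num.floor (x ord0 i)) => i; rewrite !mxE mulrNz.
have /andP[f1 f2] := floor_itv (x ord0 i); move: f2; rewrite intrD => f2.
by rewrite subr_ge0 f1 /= lerBlDl ltW.
Qed.

(** The modulus of continuity of a periodic function is controlled by the
    chords up to any given error; by periodicity this is a statement about a
    compact set of pairs, where it holds locally. *)
Lemma periodic_modulus (g : 'rV[R]_n -> R) (e : R) : continuous g ->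
  (forall i x, g (x + evec i) = g x) -> 0 < e ->
  exists2 C : R, 0 <= C & forall x y, `|g x - g y| <= e + C * \sum_i chord i x y.
Proof.
move=> cg pg e0.
set A := [set x : 'rV[R]_n | forall i, x ord0 i \in `[0%R, 1%R]].
have cA : compact A.
  by apply: (@rV_compact _ _ (fun=> `[(0 : R), 1]%classic)) => _; exact: segment_compact.
have /compact_near_coveringP cov := compact_setX cA cA.
pose q (z : 'rV[R]_n * 'rV[R]_n) : R := \sum_i chord i z.1 z.2.
pose d (z : 'rV[R]_n * 'rV[R]_n) : R := `|g z.1 - g z.2|.
have q0 z : 0 <= q z by apply: sumr_ge0 => i _; exact: chord_ge0.
have c1 i : continuous (fun z : 'rV[R]_n * 'rV[R]_n => z.1 ord0 i : R).
  move=> z; apply: (@continuous_comp _ _ _ fst (fun x : 'rV[R]_n => x ord0 i)).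
    exact: cvg_fst.
  exact: coord_continuous.
have c2 i : continuous (fun z : 'rV[R]_n * 'rV[R]_n => z.2 ord0 i : R).
  move=> z; apply: (@continuous_comp _ _ _ snd (fun x : 'rV[R]_n => x ord0 i)).
    exact: cvg_snd.
  exact: coord_continuous.
have cq : continuous q.
  apply: continuous_psum => i _; rewrite (_ : (fun z => _) =
    fun z : 'rV[R]_n * 'rV[R]_n => 2^-1 * (1 - cos (pi *+ 2 * (z.1 ord0 i - z.2 ord0 i)))); last first.
    by apply/funext => z; rewrite /chord mulrC.
  apply: continuous_pZ; apply: continuous_pD; first exact: continuous_pcst.
  apply: continuous_pN; apply: continuous_pcomp; first exact: continuous_cos.
  by apply: continuous_pZ; apply: continuous_pD => //; exact: continuous_pN.
have cd : continuous d.
  apply: continuous_pnorm; apply: continuous_pD; last apply: continuous_pN.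
    by move=> z; apply: (@continuous_comp _ _ _ fst g); [exact: cvg_fst|exact: cg].
  by move=> z; apply: (@continuous_comp _ _ _ snd g); [exact: cvg_snd|exact: cg].
have := cov nat \oo (fun N z => d z <= e + N%:R * q z) _.
case.
  move=> [x y] [/= Ax Ay].
  have [qz|qz] := eqVneq (q (x, y)) 0; last first.
    have {qz}qz : 0 < q (x, y) by rewrite lt_neqAle eq_sym qz q0.
    exists ([set z | q (x, y) / 2 < q z /\ d z < d (x, y) + 1],
            [set N | (d (x, y) + 1) / (q (x, y) / 2) <= N%:R]) => /=.
      split; last exact: nbhs_infty_ger.
      near=> z; split; near: z.
        by apply: (cvgr_gt _ (cq (x, y))); rewrite ltr_pdivrMr// ltr_pMr// ltr1n.
      by apply: (cvgr_lt _ (cd (x, y))); rewrite ltrDl.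
    move=> [z N] [/= [qz' dz'] NN].
    apply: (le_trans (ltW dz')); rewrite ler_wpDl ?(ltW e0)//.
    move: NN; rewrite ler_pdivrMr ?divr_gt0// => /le_trans; apply.
    by rewrite ler_wpM2l// ltW.
  have gxy : g x = g y.
    have ex i : exists z : int, x ord0 i = y ord0 i + z%:~R.
      apply: chord_eq0; [by have := Ax i; rewrite in_itv|by have := Ay i; rewrite in_itv|].
      apply/eqP; move: qz => /eqP; rewrite psumr_eq0 => [/allP/(_ i)|j _]; last exact: chord_ge0.
      by rewrite mem_index_enum => /(_ isT).
    have [z zE] := choice ex.
    rewrite -(periodic_int (\row_i z i) y pg); congr g; apply/rowP => i.
    by rewrite !mxE zE.
  exists ([set z | d z < e], setT) => /=.
    split; last exact: filterT.
    apply: (cvgr_lt _ (cd (x, y))); first by rewrite /d /= gxy subrr normr0.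
  move=> [z N] [/= dz _]; apply: (le_trans (ltW dz)).
  by rewrite lerDl mulr_ge0.
move=> N _ HN; exists N%:R => // x y.
have [zx zxP] := to_unit_cube x; have [zy zyP] := to_unit_cube y.
have := HN N (leqnn N) (x + map_mx intr zx, y + map_mx intr zy).
rewrite /d /q /= !(periodic_int _ _ pg).
under eq_bigr do rewrite chord_intl chord_intr.
by apply; split => i /=; rewrite in_itv/=; [exact: zxP|exact: zyP].
Unshelve. all: by end_near. Qed.

End periodic_modulus.

Section kernel.
Context {R : realType} {n : nat}.
Implicit Types (x y : 'rV[R]_n) (i j : 'I_n) (a : 'I_n -> nat).

Lemma continuous_chord i x : continuous (chord i x).
Proof.
rewrite (_ : chord i x = fun y => 2^-1 * (1 - cos (pi *+ 2 * (x ord0 i - y ord0 i)))); last first.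
  by apply/funext => z; rewrite /chord mulrC.
apply: continuous_pZ; apply: continuous_pD; first exact: continuous_pcst.
apply: continuous_pN; apply: continuous_pcomp; first exact: continuous_cos.
apply: continuous_pZ; apply: continuous_pD; first exact: continuous_pcst.
by apply: continuous_pN; exact: coord_continuous.
Qed.

(** De la Vallee-Poussin's kernel: since [1 - chord] is the square of a cosine, it is
    a product of even powers of cosines.  Different exponents are allowed because
    the integration by parts below changes them one at a time. *)
Definition kernel a x y : R := \prod_i (1 - chord i x y) ^+ a i.

Lemma kernel_ge0 a x y : 0 <= kernel a x y.
Proof. by apply: prodr_ge0 => i _; rewrite exprn_ge0// subr_ge0 chord_le1. Qed.

Lemma continuous_kernel a x : continuous (kernel a x).
Proof.
apply: continuous_pprod => i _; apply: continuous_pX; apply: continuous_pD.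
  exact: continuous_pcst.
by apply: continuous_pN; exact: continuous_chord.
Qed.

Definition incr a i : 'I_n -> nat := fun j => ((j == i) + a j)%N.

Lemma kernel_incr a i x y : kernel (incr a i) x y = (1 - chord i x y) * kernel a x y.
Proof.
rewrite /kernel (bigD1 i)//= [in RHS](bigD1 i)//= /incr eqxx exprS -mulrA; congr (_ * (_ * _)).
by apply: eq_bigr => j ji; rewrite (negbTE ji) add0n.
Qed.

Lemma sin_2pi_int (t : R) (z : int) : sin (pi *+ 2 * (t + z%:~R)) = sin (pi *+ 2 * t).
Proof.
have := cisD (pi *+ 2 * t) (pi *+ 2 * z%:~R).
by rewrite -mulrDr cis_int mulr1 => -[].
Qed.

(** With [u = 1 - chord i x y] and [v] the sine of the same angle, the derivative of
    [v * u ^+ a] in the [i]-th variable is a multiple of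
    [(2 * a + 2) * u ^+ a.+1 - (2 * a + 1) * u ^+ a], by [v ^+ 2 = 4 * u * (1 - u)]. *)
Lemma mean_kernel_incr a i x :
  (2 * (a i)%:R + 2) * mean (kernel (incr a i) x) = (2 * (a i)%:R + 1) * mean (kernel a x).
Proof.
pose rest y := \prod_(j | j != i) (1 - chord j x y) ^+ a j.
pose G y := sin (pi *+ 2 * (x ord0 i - y ord0 i)) * ((1 - chord i x y) ^+ a i * rest y).
have kE y : kernel a x y = (1 - chord i x y) ^+ a i * rest y.
  by rewrite /kernel (bigD1 i).
pose dG y := - (pi *+ 2) * ((2 * (a i)%:R + 2) * kernel (incr a i) x y -
                          (2 * (a i)%:R + 1) * kernel a x y).
have shift_other y h j : j != i -> chord j x (h *: evec i + y) = chord j x y.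
  by move=> ji; rewrite /chord !mxE (negbTE ji) andbF mulr0 add0r.
have rest_shift y h : rest (h *: evec i + y) = rest y.
  by apply: eq_bigr => j ji; rewrite shift_other.
have dGE y : is_derive y (evec i) G (dG y).
  set t := pi *+ 2 * (x ord0 i - y ord0 i); pose b : R := - (pi *+ 2).
  pose u (h : R) : R := 2^-1 * (1 + cos (b * h + t)).
  apply: (is_derive_along (F := fun h => sin (b * h + t) * (u h ^+ a i * rest y))) => [h|].
    rewrite /G rest_shift /chord /u !mxE !eqxx mulr1.
    have -> : pi *+ 2 * (x ord0 i - (h + y ord0 i)) = b * h + t by rewrite /t /b; ring.
    by congr (_ * (_ ^+ _ * _)); field.
  have dl : is_derive (0 : R) 1 (fun h => b * h + t) b.
    by apply: is_derive_eq; rewrite addr0 /GRing.scale /= mulr1.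
  have dc := @is_derive1_comp _ cos _ 0 _ _ (is_derive_cos _) dl.
  have ds := @is_derive1_comp _ sin _ 0 _ _ (is_derive_sin _) dl.
  have du : is_derive (0 : R) 1 u (2^-1 * (- sin t * b)).
    have -> : u = 2^-1 \*: (cst 1 + (cos \o (fun h => b * h + t))) by [].
    by apply: is_derive_eq; rewrite mulr0 !add0r.
  have -> : (fun h => sin (b * h + t) * (u h ^+ a i * rest y)) =
    (sin \o (fun h => b * h + t)) * (rest y \*: (u ^+ a i)).
    by apply/funext => h; rewrite /= [in RHS]/GRing.mul /= [_ *: _]mulrC exprfctE.
  apply: is_derive_eq; rewrite /dG kernel_incr kE exprfctE /GRing.scale /= !mulr0 !add0r.
  have -> : 1 - chord i x y = u 0 by rewrite /u mulr0 add0r /chord -/t; field.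
  have : sin t ^+ 2 = 4 * (1 - u 0) * u 0.
    by rewrite sin2cos2 /u mulr0 add0r; field.
  have : cos t = 2 * u 0 - 1 by rewrite /u mulr0 add0r; field.
  rewrite -/b; move: (u 0) (cos t) (sin t) (rest y) => U c v r -> v2.
  have sc w : r *: w = r * w by [].
  rewrite sc; case: (a i) => [|k]; first by rewrite !expr0; ring.
  have E : v * (r * (k.+1%:R * U ^+ k * (2^-1 * (- v * b)))) =
      - (v ^+ 2) * (2^-1 * r * k.+1%:R * U ^+ k * b) by ring.
  by rewrite [k.+1.-1]/= E v2 exprS; field.
have cG : continuous G.
  apply: continuous_pM; last apply: continuous_pM.
  - apply: continuous_pcomp; first exact: continuous_sin.
    apply: continuous_pZ; apply: continuous_pD; first exact: continuous_pcst.
    by apply: continuous_pN; exact: coord_continuous.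
  - apply: continuous_pX; apply: continuous_pD; first exact: continuous_pcst.
    by apply: continuous_pN; exact: continuous_chord.
  - apply: continuous_pprod => j _; apply: continuous_pX; apply: continuous_pD.
      exact: continuous_pcst.
    by apply: continuous_pN; exact: continuous_chord.
have DG : 'D_(evec i) G = dG by apply/funext => y; have [] := dGE y.
have ck b : continuous (kernel b x) := @continuous_kernel b x.
have cdG : continuous dG.
  apply: continuous_pZ; apply: continuous_pD; first exact: continuous_pZ.
  by apply: continuous_pN; exact: continuous_pZ.
have : cube_integral ('D_(evec i) G) = 0%E.
  apply: cube_integral_derive0;
    [exact: cG|by move=> y; have [] := dGE y|by rewrite DG|move=> y].
  have evecE : evec i = map_mx intr (delta_mx ord0 i) :> 'rV[R]_n.
    by apply/rowP => j; rewrite !mxE; case: (_ && _).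
  rewrite evecE /G /rest chord_intr; congr (_ * (_ * _)).
    by rewrite !mxE !eqxx opprD addrA -mulrNz sin_2pi_int.
  by apply: eq_bigr => j _; rewrite chord_intr.
rewrite DG cube_integralE// => -[].
rewrite meanZ; last first.
  apply: continuous_pD; first exact: continuous_pZ.
  by apply: continuous_pN; exact: continuous_pZ.
rewrite meanB; [|exact: continuous_pZ..].
rewrite !meanZ// => /eqP; rewrite mulf_eq0 oppr_eq0 mulrn_eq0 /= gt_eqF ?pi_gt0//=.
by rewrite subr_eq0 => /eqP.
Qed.

(** Lowering the exponents one by one reduces the kernel to 1, and the factors
    produced on the way do not involve the centre [x]. *)
Lemma mean_kernel_cst a : exists2 w : R, 0 < w & forall x, mean (kernel a x) = w.
Proof.
have [M] := ubnP (\sum_i a i)%N; elim: M a => // M IH a aM.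
have [a0|] := boolP [forall i, a i == 0%N].
  exists 1; first exact: ltr01.
  move=> x; rewrite -[RHS](@mean_cst _ n); congr mean; apply/funext => y.
  by rewrite /kernel big1// => i _; rewrite (eqP (forallP a0 i)) expr0.
rewrite negb_forall => /existsP[i ai].
pose a' : 'I_n -> nat := fun j => (a j - (j == i))%N.
have aE : a = incr a' i.
  apply/funext => j; rewrite /incr /a'; case: eqVneq => [->|_]; last by rewrite subn0.
  by rewrite add1n subn1 prednK// lt0n.
have [|w w0 wE] := IH a'.
  rewrite -ltnS (leq_trans _ aM)// ltnS aE /incr big_split /=.
  by rewrite [X in (_ < X + _)%N](bigD1 i)//= eqxx -addnA ltnS leq_addl.
exists ((2 * (a' i)%:R + 1) / (2 * (a' i)%:R + 2) * w).
  by rewrite mulr_gt0// divr_gt0// ltr_wpDl.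
move=> x; have := mean_kernel_incr a' i x; rewrite -aE wE => E.
have d0 : 2 * (a' i)%:R + 2 != 0 :> R by rewrite gt_eqF// ltr_wpDl.
by apply: (mulfI d0); rewrite E mulrA mulrCA divff// mulr1.
Qed.

Lemma mean_chord_kernel a i x :
  mean (fun y => chord i x y * kernel a x y) = mean (kernel a x) / (2 * (a i)%:R + 2).
Proof.
have ck b : continuous (kernel b x) := @continuous_kernel b x.
rewrite (_ : (fun y => _) = fun y => kernel a x y - kernel (incr a i) x y); last first.
  by apply/funext => y; rewrite kernel_incr; ring.
rewrite meanB//.
have d0 : 2 * (a i)%:R + 2 != 0 :> R by rewrite gt_eqF// ltr_wpDl.
apply: (mulfI d0); rewrite mulrBr mean_kernel_incr [RHS]mulrCA divff// mulr1.
by ring.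
Qed.

(** Integrating such a function of [x] and [y] against a continuous function of [y]
    leaves a trigonometric polynomial in [x]. *)
Definition separable (K : 'rV[R]_n -> 'rV[R]_n -> R) := exists (T : finType)
  (r : T -> seq ('rV[int]_n * R[i])) (v : T -> 'rV[R]_n -> R),
  (forall l, continuous (v l)) /\ forall x y, K x y = \sum_l trig (r l) x * v l y.

Lemma separable1 r (v : 'rV[R]_n -> R) : continuous v ->
  separable (fun x y => trig r x * v y).
Proof.
move=> cv; exists unit, (fun=> r), (fun=> v); split => // x y.
by rewrite (big_pred1 tt) => [|[]].
Qed.

Lemma separableD K K' : separable K -> separable K' ->
  separable (fun x y => K x y + K' x y).
Proof.
move=> [T [r [v [cv E]]]] [T' [r' [v' [cv' E']]]].
exists (T + T')%type, (fun z => match z with inl l => r l | inr l => r' l end),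
  (fun z => match z with inl l => v l | inr l => v' l end).
by split => [[]//|x y]; rewrite E E' big_sumType.
Qed.

(** Multiplying two real parts produces the sum and the difference of the
    frequencies. *)
Definition trig_mul (r t : seq ('rV[int]_n * R[i])) : seq ('rV[int]_n * R[i]) :=
  [seq (p.1 + q.1, p.2 * q.2 / 2) | p <- r, q <- t] ++
  [seq (p.1 - q.1, p.2 * (q.2^*)%C / 2) | p <- r, q <- t].

Lemma trig_mulE r t (x : 'rV[R]_n) : trig (trig_mul r t) x = trig r x * trig t x.
Proof.
rewrite trig_cat /trig !big_allpairs_dep -big_split mulr_suml; apply: eq_bigr => p _.
rewrite mulr_sumr -big_split; apply: eq_bigr => q _ /=.
have h2 : (2 : R[i])^-1 = (2^-1 : R)%:C%C by rewrite rmorphV ?unitfE ?pnatr_eq0// rmorph_nat.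
rewrite /mode !ekDl ekN h2; case: p.2 (ek p.1 x) q.2 (ek q.1 x) => a b [c d] [e f] [g h] /=.
by field.
Qed.

Lemma separableM K K' : separable K -> separable K' ->
  separable (fun x y => K x y * K' x y).
Proof.
move=> [T [r [v [cv E]]]] [T' [r' [v' [cv' E']]]].
exists (T * T')%type, (fun z => trig_mul (r z.1) (r' z.2)), (fun z y => v z.1 y * v' z.2 y).
split => [z|x y]; first exact: continuous_pM.
rewrite E E' mulr_suml -(pair_big xpredT xpredT (fun l l' =>
  trig (trig_mul (r l) (r' l')) x * (v l y * v' l' y))) /=.
apply: eq_bigr => l _; rewrite mulr_sumr; apply: eq_bigr => l' _.
by rewrite trig_mulE mulrACA.
Qed.

Lemma trig_const (c : R) (x : 'rV[R]_n) : trig [:: (0, c%:C%C)] x = c.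
Proof. by rewrite /trig big_seq1 /mode ek0 mulr1. Qed.

Lemma separable_cst (c : R) : separable (fun _ _ => c).
Proof.
have [T [r [v [cv E]]]] := separable1 [:: (0, c%:C%C)] (@continuous_pcst R 'rV[R]_n 1).
by exists T, r, v; split => // x y; rewrite -E trig_const mulr1.
Qed.

Lemma separable_chord i : separable (fun x y => 1 - chord i x y).
Proof.
have phE (z : 'rV[R]_n) : phase (delta_mx ord0 i) z = pi *+ 2 * z ord0 i.
  rewrite /phase (bigD1 i)//= big1 ?addr0 => [|j ji].
    by rewrite mxE !eqxx mul1r.
  by rewrite mxE (negbTE ji) andbF mul0r.
have tri (h : R -> R) : continuous h ->
    continuous (fun y : 'rV[R]_n => h (phase (delta_mx ord0 i) y)).
  by move=> ch; apply: continuous_pcomp => //; exact: continuous_phase.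
have [T [r [v [cv E]]]] := separableD (separable_cst 2^-1) (separableD
  (separable1 [:: (delta_mx ord0 i, (2^-1 : R)%:C%C)] (tri _ (@continuous_cos R)))
  (separable1 [:: (delta_mx ord0 i, (0 +i* - 2^-1)%C)] (tri _ (@continuous_sin R)))).
exists T, r, v; split => // x y; rewrite -E /trig !big_seq1 !modeE /= !phE /chord.
by rewrite mulrBr cosB; field.
Qed.

Lemma separable_kernel a : separable (kernel a).
Proof.
rewrite /kernel; elim: (index_enum _) => [|i s IH].
  have [T [r [v [cv E]]]] := separable_cst 1.
  by exists T, r, v; split => // x y; rewrite big_nil -E.
have sX k : separable (fun x y => (1 - chord i x y) ^+ k).
  elim: k => [|k [T [r [v [cv E]]]]].
    by have [T [r [v [cv E]]]] := separable_cst 1; exists T, r, v.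
  have [|T' [r' [v' [cv' E']]]] := separableM (separable_chord i) (K' := fun x y => (1 - chord i x y) ^+ k).
    by exists T, r, v.
  by exists T', r', v'; split => // x y; rewrite exprS -E'.
have [T [r [v [cv E]]]] := separableM (sX (a i)) IH.
by exists T, r, v; split => // x y; rewrite big_cons -E.
Qed.

(** Korovkin's argument: averaging [g] against the kernel centred at [x] moves its
    value by at most [e / 2] plus [C] times the average of the sum of the chords, and
    the average of one chord is [1 / (2 * N + 2)]. *)
Lemma trig_dense (g : 'rV[R]_n -> R) (e : R) : continuous g ->
  (forall i x, g (x + evec i) = g x) -> 0 < e ->
  exists r, forall x, `|trig r x - g x| <= e.
Proof.
move=> cg pg e0.
have [C C0 HC] := periodic_modulus cg pg (divr_gt0 e0 (ltr0n _ 2)).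
have [N HN] : exists N : nat, C * n%:R / (e / 2) <= N%:R.
  by have [N _ HN] := @nbhs_infty_ger R (C * n%:R / (e / 2)); exists N; exact: (HN N (leqnn N)).
pose a : 'I_n -> nat := fun=> N.
have [w w0 wE] := mean_kernel_cst a.
have [T [r [v [cv KE]]]] := separable_kernel a.
have ck x : continuous (kernel a x) := @continuous_kernel a x.
exists (flatten [seq ract (fun=> w^-1 * mean (fun y => g y * v l y)) (r l) | l <- index_enum T]).
move=> x; rewrite trig_flatten.
have -> : \sum_(l <- index_enum T) trig (ract (fun=> w^-1 * mean (fun y => g y * v l y)) (r l)) x =
    w^-1 * mean (fun y => g y * kernel a x y).
  rewrite (_ : (fun y => g y * kernel a x y) = fun y => \sum_l trig (r l) x * (g y * v l y)).
    rewrite mean_sum => [|l _]; last by apply: continuous_pZ; exact: continuous_pM.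
    rewrite mulr_sumr; apply: eq_bigr => l _.
    by rewrite trig_cst meanZ; [ring|exact: continuous_pM].
  by apply/funext => y; rewrite KE mulr_sumr; apply: eq_bigr => l _; ring.
have cgx : continuous (fun y => (g y - g x) * kernel a x y).
  by apply: continuous_pM => //; apply: continuous_pD => //; exact: continuous_pcst.
have -> : w^-1 * mean (fun y => g y * kernel a x y) - g x =
    w^-1 * mean (fun y => (g y - g x) * kernel a x y).
  rewrite (_ : (fun y => (g y - g x) * _) =
      fun y => g y * kernel a x y - g x * kernel a x y); last first.
    by apply/funext => y; rewrite mulrBl.
  rewrite meanB; [|exact: continuous_pM|exact: continuous_pZ].
  by rewrite meanZ// wE mulrBr [w^-1 * (_ * w)]mulrCA mulVf ?mulr1// gt_eqF.
rewrite normrM ger0_norm ?invr_ge0 ?(ltW w0)// mulrC ler_pdivrMr//.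
apply: (le_trans (mean_norm cgx)).
have cch i : continuous (fun y => chord i x y * kernel a x y).
  by apply: continuous_pM => //; exact: continuous_chord.
apply: (@le_trans _ _ (mean (fun y => (e / 2) * kernel a x y +
    C * \sum_i (chord i x y * kernel a x y)))).
  apply: le_mean; first exact: continuous_pnorm.
    by apply: continuous_pD; apply: continuous_pZ => //; exact: continuous_psum.
  move=> y; rewrite normrM [`|kernel _ _ _|]ger0_norm ?kernel_ge0// -mulr_suml mulrA -mulrDl.
  by rewrite ler_wpM2r ?kernel_ge0// distrC.
rewrite meanD; [|exact: continuous_pZ|by apply: continuous_pZ; exact: continuous_psum].
rewrite !meanZ//; last exact: continuous_psum.
rewrite mean_sum// (eq_bigr (fun=> w / (2 * N%:R + 2))) => [|i _]; last first.
  by rewrite mean_chord_kernel wE.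
rewrite sumr_const card_ord wE -[_ *+ n]mulr_natl.
have d0 : 0 < 2 * N%:R + 2 :> R by rewrite ltr_wpDl.
rewrite (_ : e / 2 * w + _ = (e / 2 + C * n%:R / (2 * N%:R + 2)) * w); last first.
  by field; rewrite gt_eqF.
rewrite ler_wpM2r ?(ltW w0)// [leRHS]splitr lerD2l ler_pdivrMr//.
move: HN; rewrite ler_pdivrMr ?divr_gt0// => /le_trans; apply.
by rewrite mulrC ler_wpM2l ?divr_ge0 ?(ltW e0)//; have := ler0n R N; lra.
Qed.

End kernel.

(** * Duality between symmetrized gradients and divergence-free fields *)
Section adjoint.
Context {R : realType} {n : nat}.
Implicit Types (r t : seq ('rV[int]_n * R[i])) (A : 'rV[int]_n -> R) (k l : 'rV[int]_n).

Lemma mean_modeM0 k l (c d : R[i]) : k != l -> k != - l ->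
  mean (fun x : 'rV[R]_n => mode k c x * mode l d x) = 0.
Proof.
move=> kl kNl.
rewrite (_ : (fun x => _) = fun x : 'rV[R]_n =>
    mode (k + l) (c * d / 2) x + mode (k - l) (c * (d^*)%C / 2) x).
  rewrite meanD; [|exact: continuous_mode..].
  by rewrite !mean_mode ?addr0// ?subr_eq0// addr_eq0.
apply/funext => x; have := trig_mulE [:: (k, c)] [:: (l, d)] x.
by rewrite /trig_mul /trig /= !big_cons !big_nil !addr0.
Qed.

Lemma mean_trigM r t : mean (fun x => trig r x * trig t x) =
  \sum_(p <- r) \sum_(q <- t) mean (fun x => mode p.1 p.2 x * mode q.1 q.2 x).
Proof.
have cM p q : continuous (fun x : 'rV[R]_n => mode p.1 p.2 x * mode q.1 q.2 x : R).
  by apply: continuous_pM; exact: continuous_mode.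
rewrite (_ : (fun x => _) = fun x => \sum_(p <- r) \sum_(q <- t) mode p.1 p.2 x * mode q.1 q.2 x).
  rewrite mean_sum => [|p _]; last by apply: continuous_psum => q _; exact: cM.
  by apply: eq_bigr => p _; rewrite mean_sum// => q _; exact: cM.
by apply/funext => x; rewrite /trig mulr_suml; apply: eq_bigr => p _; rewrite mulr_sumr.
Qed.

(** Two modes with frequencies [k] and [l] are orthogonal unless [k = l] or [k = - l],
    and an even symbol takes the same value at both frequencies. *)
Lemma ract_selfadjoint A r t : (forall k, A (- k) = A k) ->
  mean (fun x => trig r x * trig (ract A t) x) =
  mean (fun x => trig (ract A r) x * trig t x).
Proof.
move=> evA; rewrite !mean_trigM [in RHS]big_map; apply: eq_bigr => p _.
rewrite big_map; apply: eq_bigr => q _ /=.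
have [pq|pq] := boolP ((p.1 == q.1) || (p.1 == - q.1)).
  have Apq : A p.1 = A q.1 by case/orP: pq => /eqP ->; rewrite ?evA.
  by congr mean; apply/funext => x; rewrite !modeZ Apq; ring.
move: pq; rewrite negb_or => /andP[pq pNq].
by rewrite !mean_modeM0.
Qed.

Lemma mean_ract0 A r : A 0 = 0 -> mean (trig (ract A r)) = 0.
Proof.
move=> A0; rewrite [X in mean X](_ : _ = fun x => \sum_(p <- r) A p.1 * mode p.1 p.2 x).
  rewrite mean_sum => [|p _]; last by apply: continuous_pZ; exact: continuous_mode.
  rewrite big1// => p _; rewrite meanZ; last exact: continuous_mode.
  by have [->|p0] := eqVneq p.1 0; rewrite ?A0 ?mul0r// mean_mode// mulr0.
by apply/funext => x; rewrite trig_act; apply: eq_bigr => p _; rewrite modeZ.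
Qed.

Lemma mean_deriveM (f g : 'rV[R]_n -> R) (i : 'I_n) :
  continuous f -> continuous g ->
  (forall x, derivable f x (evec i)) -> (forall x, derivable g x (evec i)) ->
  continuous ('D_(evec i) f) -> continuous ('D_(evec i) g) ->
  (forall x, f (x + evec i) = f x) -> (forall x, g (x + evec i) = g x) ->
  mean (fun x => 'D_(evec i) f x * g x) = - mean (fun x => f x * 'D_(evec i) g x).
Proof.
move=> cf cg df dg cdf cdg pf pg.
have D : 'D_(evec i) (f * g) = fun x => 'D_(evec i) f x * g x + f x * 'D_(evec i) g x.
  by apply/funext => x; rewrite deriveM// addrC; congr (_ + _); exact: mulrC.
have c1 : continuous (fun x => 'D_(evec i) f x * g x) by exact: continuous_pM.
have c2 : continuous (fun x => f x * 'D_(evec i) g x) by exact: continuous_pM.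
have : cube_integral ('D_(evec i) (f * g)) = 0%E.
  apply: cube_integral_derive0.
  - exact: continuous_pM.
  - by move=> x; exact: derivableM.
  - by rewrite D; exact: continuous_pD.
  - by move=> x; rewrite /GRing.mul /= pf pg.
rewrite D cube_integralE; last exact: continuous_pD.
by move=> [] /eqP; rewrite meanD// addr_eq0 => /eqP.
Qed.

End adjoint.

Section test_fields.
Context {R : realType} {n : nat}.
Implicit Types (phi : 'rV[R]_n -> 'M[R]_n) (xi : 'M[R]_n) (i j : 'I_n).

Lemma continuous_entry phi i j : continuous phi -> continuous (fun x => phi x i j).
Proof.
by move=> cphi x; apply: (@continuous_comp _ _ _ phi (fun A : 'M[R]_n => A i j));
  [exact: cphi|exact: coord_continuous].
Qed.

Lemma test_continuous xi phi : sdqc_test xi phi -> continuous phi.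
Proof. by move=> [/(_ 0%N)[]]. Qed.

Lemma test_entry xi phi i j l : sdqc_test xi phi -> [/\
  continuous (fun x => phi x i j),
  forall x, derivable (fun x => phi x i j) x (evec l),
  continuous ('D_(evec l) (fun x => phi x i j)) &
  forall x, phi (x + evec l) i j = phi x i j].
Proof.
move=> [/(_ 1%N)[cphi /(_ l)[dphi [cdphi _]]] per _ _ _].
have E : 'D_(evec l) (fun x => phi x i j) = fun x => 'D_(evec l) phi x i j.
  by apply/funext => x; rewrite derive_mx// mxE.
split.
- exact: continuous_entry.
- by move=> x; move/derivable_mxP : (dphi x); exact.
- by rewrite E; exact: continuous_entry.
- by move=> x; rewrite per.
Qed.

(** Integration by parts: [fr l] is, up to a constant, the symbol of the [l]-th
    derivative, and it falls on [phi] as a divergence. *)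
Lemma gradient_orthogonal xi phi (A : 'rV[int]_n -> R) r j : sdqc_test xi phi ->
  \sum_l mean (fun x => trig (ract (fun k => fr l k * A k) r) x * phi x j l) = 0.
Proof.
move=> tphi.
(* The symbol [fr l k * A k] is that of the [l]-th derivative of [w]. *)
pose a k : R[i] := (0 +i* - (A k / (pi *+ 2)))%C.
pose w := trig (act a r).
have pi0 : pi *+ 2 != 0 :> R by rewrite mulrn_eq0/= gt_eqF ?pi_gt0.
have Dw l : 'D_(evec l) w = trig (ract (fun k => fr l k * A k) r).
  apply/funext => x; have [_ ->] := is_derive_trig (act a r) l x.
  rewrite !trig_act big_map; apply: eq_bigr => p _ /=; congr mode.
  rewrite mulrA; congr (_ * _); rewrite /a /dsym /fr; apply/eqP.
  rewrite eq_complex /=; apply/andP; split; apply/eqP; last by ring.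
  by rewrite mul0r sub0r mulrN opprK [pi *+ 2 * _]mulrC -mulrA [pi *+ 2 * _]mulrC divfK.
have cw : continuous w := @continuous_trig _ _ _.
have dw l x : derivable w x (evec l) by have [] := is_derive_trig (act a r) l x.
have step l : mean (fun x => trig (ract (fun k => fr l k * A k) r) x * phi x j l) =
    - mean (fun x => w x * 'D_(evec l) (fun x => phi x j l) x).
  have [c d cd per] := test_entry j l l tphi.
  rewrite (_ : (fun x => _) = fun x => 'D_(evec l) w x * phi x j l); last first.
    by apply/funext => x; rewrite -Dw.
  have cdw : continuous ('D_(evec l) w) by rewrite Dw; exact: continuous_trig.
  exact: (mean_deriveM cw c (dw l) d cdw cd (trig_periodic _ l) per).
under eq_bigr do rewrite step.
rewrite sumrN -mean_sum => [|l _]; last first.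
  have [c d cd per] := test_entry j l l tphi; exact: continuous_pM.
rewrite (_ : (fun x => _) = fun=> 0) ?mean_cst ?oppr0//.
apply/funext => x; rewrite -mulr_sumr.
have [_ _ _ /(_ x j) div0 _] := tphi.
by rewrite [X in _ * X]div0 mulr0.
Qed.

End test_fields.

(** * Real powers and the distance to a set of matrices *)
Section powers.
Context {R : realType}.
Implicit Types (a b t e : R).

Lemma continuous_powR_norm (r : R) : 0 < r -> continuous (fun t : R => `|t| `^ r).
Proof.
move=> r0 t; have [->|t0] := eqVneq t 0.
  apply/cvgrPdist_le => e e0; rewrite normr0 powR0 ?gt_eqF//.
  have d0 : 0 < e `^ r^-1 by rewrite powR_gt0.
  apply/nbhs_ballP; exists (e `^ r^-1) => //= y.
  rewrite /ball /= !sub0r !normrN => yd; rewrite ger0_norm ?powR_ge0//.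
  have -> : e = (e `^ r^-1) `^ r by rewrite -powRrM mulVf ?gt_eqF// powRr1 ?(ltW e0).
  by apply: ge0_ler_powR; rewrite ?nnegrE ?powR_ge0 ?(ltW r0) ?(ltW yd).
apply: (@continuous_comp R R R Num.norm (fun u : R => u `^ r)).
  exact: norm_continuous.
apply/differentiable_continuous/derivable1_diffP/derivable_powR.
by rewrite in_itv/= andbT normr_gt0.
Qed.

(** Smallness of the mean of a higher power is passed on to a lower power: below the
    threshold [d] the power is small anyway. *)
Lemma powR_interpolate (a b d : R) : 0 < a -> a <= b -> 0 < d -> forall t, 0 <= t ->
  t `^ a <= d `^ a + d `^ (a - b) * t `^ b.
Proof.
move=> a0 ab d0 t t0; have [td|dt] := leP t d.
  rewrite ler_wpDr ?mulr_ge0 ?powR_ge0//.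
  by apply: ge0_ler_powR; rewrite ?nnegrE ?(ltW a0) ?(ltW d0).
rewrite ler_wpDl ?powR_ge0//.
have t1 : 0 < t := lt_trans d0 dt.
have -> : t `^ a = t `^ (a - b) * t `^ b.
  by rewrite -powRD ?subrK// (gt_eqF t1) implybT.
rewrite ler_wpM2r ?powR_ge0// -[a - b]opprB !powRN lef_pV2 ?posrE ?powR_gt0//.
by apply: ge0_ler_powR; rewrite ?nnegrE ?subr_ge0 ?(ltW d0) ?(ltW t1) ?(ltW dt).
Qed.

(** A power below [s] is small on average once the mean square is small and the
    [s]-th moment is bounded. *)
Lemma powR_between (q : R) (s : nat) e : 0 < q -> q < s%:R -> 0 < e ->
  exists2 C, 0 <= C & forall t, 0 <= t -> t `^ q <= e * (1 + t ^+ s) + C * t ^+ 2.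
Proof.
move=> q0 qs e0.
(* Below [l] the power [t `^ q] is at most [e]; above [L] it is at most
   [e * t ^+ s]; in between it is comparable to [t ^+ 2]. *)
pose l := e `^ q^-1; have l0 : 0 < l by rewrite powR_gt0.
have lq : l `^ q = e by rewrite /l -powRrM mulVf ?gt_eqF// powRr1 ?(ltW e0).
pose L := e `^ (q - s%:R)^-1; have L0 : 0 < L by rewrite powR_gt0.
have Lq : L `^ (q - s%:R) = e.
  by rewrite /L -powRrM mulVf ?powRr1 ?(ltW e0)// subr_eq0 lt_eqF.
exists (L `^ q / l ^+ 2); first by rewrite divr_ge0 ?powR_ge0// sqr_ge0.
move=> t t0.
have ts : 0 <= t ^+ s by exact: exprn_ge0.
have C0 : 0 <= L `^ q / l ^+ 2 * t ^+ 2.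
  by rewrite mulr_ge0 ?sqr_ge0// divr_ge0 ?powR_ge0// sqr_ge0.
have [tl|lt] := leP t l.
  apply: (@le_trans _ _ e); last first.
    by rewrite mulrDr mulr1 -addrA ler_wpDr// addr_ge0// mulr_ge0// ltW.
  by rewrite -lq; apply: ge0_ler_powR; rewrite ?nnegrE ?(ltW q0) ?(ltW l0).
have t1 : 0 < t := lt_trans l0 lt.
have [tL|Lt] := leP t L.
  rewrite ler_wpDl//; first by rewrite mulr_ge0 ?(ltW e0)// addr_ge0.
  apply: (@le_trans _ _ (L `^ q)).
    by apply: ge0_ler_powR; rewrite ?nnegrE ?(ltW q0) ?(ltW L0).
  rewrite -mulrA ler_peMr ?powR_ge0// mulrC ler_pdivlMr ?exprn_gt0// mul1r.
  by rewrite lerXn2r ?nnegrE ?(ltW l0) ?(ltW lt).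
have -> : t `^ q = t `^ (q - s%:R) * t ^+ s.
  by rewrite -powR_mulrn// -powRD ?subrK// (gt_eqF t1) implybT.
rewrite ler_wpDr// mulrDr ler_wpDl ?mulr1 ?(ltW e0)// ler_wpM2r// -Lq.
rewrite -opprB !powRN lef_pV2 ?posrE ?powR_gt0//.
by apply: ge0_ler_powR; rewrite ?nnegrE ?subr_ge0 ?(ltW qs) ?(ltW L0) ?(ltW t1) ?(ltW Lt).
Qed.

Definition conj_exp (s : nat) : R := s%:R / (s%:R - 1).

Lemma conj_exp_gt0 s : (1 < s)%N -> 0 < conj_exp s.
Proof. by move=> s1; rewrite divr_gt0 ?subr_gt0 ?ltr1n// ltr0n ltnW. Qed.

(** Young's inequality for [d * a] and [b / d]. *)
Lemma young_expr (s : nat) (d : R) : (1 < s)%N -> 0 < d -> forall a b, 0 <= a -> 0 <= b ->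
  a * b <= d ^+ s * a ^+ s + d `^ (- conj_exp s) * b `^ conj_exp s.
Proof.
move=> s1 d0 a b a0 b0.
have s0 : 0 < s%:R :> R by rewrite ltr0n ltnW.
have s1' : 0 < s%:R - 1 :> R by rewrite subr_gt0 ltr1n.
have conj1 : (s%:R)^-1 + (conj_exp s)^-1 = 1 by rewrite /conj_exp; field; rewrite !gt_eqF.
have c0 := conj_exp_gt0 s1.
have := @conjugate_powR R (d * a) (d^-1 * b) s%:R (conj_exp s).
rewrite mulr_ge0 ?(ltW d0)// mulr_ge0 ?invr_ge0 ?(ltW d0)// => /(_ isT isT s0 c0 conj1).
rewrite mulrACA divff ?gt_eqF// mul1r => /le_trans; apply.
rewrite powR_mulrn ?mulr_ge0 ?(ltW d0)// powRM ?invr_ge0 ?(ltW d0)//.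
rewrite -powR_inv1 ?(ltW d0)// -powRrM mulN1r exprMn.
have si : (s%:R : R)^-1 <= 1 by rewrite invf_le1// ler1n ltnW.
have ci : (conj_exp s)^-1 <= 1.
  by rewrite -conj1 lerDr invr_ge0 ltW.
apply: lerD.
  by rewrite ler_piMr// mulr_ge0 ?exprn_ge0// ltW.
by rewrite ler_piMr// mulr_ge0 ?powR_ge0.
Qed.

Lemma powRD_le (q : R) a b : 0 < q -> 0 <= a -> 0 <= b ->
  (a + b) `^ q <= 2 `^ q * (a `^ q + b `^ q).
Proof.
move=> q0 a0 b0; wlog ab : a b a0 b0 / a <= b => [H|].
  have [ab|/ltW ba] := leP a b; first exact: H.
  by rewrite addrC [X in _ * X]addrC; exact: H.
apply: (@le_trans _ _ ((2 * b) `^ q)).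
  apply: ge0_ler_powR; rewrite ?nnegrE ?addr_ge0 ?mulr_ge0 ?(ltW q0)//.
  by rewrite mulr_natl mulr2n lerD2r.
by rewrite powRM// ler_wpM2l ?powR_ge0// lerDr powR_ge0.
Qed.

Lemma sum_expr_le s N (a : 'I_N -> R) : ~~ odd s -> (0 < N)%N ->
  (\sum_i a i) ^+ s <= N%:R ^+ s * \sum_i a i ^+ s.
Proof.
move=> es N0; have N0' : 0 < N%:R :> R by rewrite ltr0n.
have -> : \sum_i a i = N%:R * (N%:R^-1 * \sum_i a i) by rewrite mulVKf// gt_eqF.
rewrite exprMn ler_wpM2l ?exprn_ge0 ?ler0n//; apply: (le_trans (average_expr_le _ es N0)).
rewrite ler_piMl ?invf_le1 ?ler1n//.
by apply: sumr_ge0 => i _; exact: even_expr_ge0.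
Qed.

End powers.

Section frobenius_distance.
Context {R : realType} {n : nat}.
Implicit Types (A B : 'M[R]_n) (K : set 'M[R]_n).

Lemma frobenius_ge0 A : 0 <= frobenius A.
Proof. exact: sqrtr_ge0. Qed.

Let sq A : R := \sum_i \sum_j A i j ^+ 2.

Let sq_ge0 A : 0 <= sq A.
Proof. by apply: sumr_ge0 => i _; apply: sumr_ge0 => j _; exact: sqr_ge0. Qed.

Let sqE A : frobenius A ^+ 2 = sq A.
Proof. exact: (sqr_sqrtr (sq_ge0 A)). Qed.

Lemma entry_le_frobenius A i j : `|A i j| <= frobenius A.
Proof.
rewrite -[leRHS]ger0_norm ?frobenius_ge0// -ler_sqr ?nnegrE// !real_normK ?num_real// sqE.
rewrite /sq (bigD1 i)//= (bigD1 j)//= -addrA lerDl addr_ge0//.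
  by apply: sumr_ge0 => l _; exact: sqr_ge0.
by apply: sumr_ge0 => k _; apply: sumr_ge0 => l _; exact: sqr_ge0.
Qed.

Let dot A B : R := \sum_i \sum_j A i j * B i j.

Let sqD A B (a b : R) : sq (a *: A + b *: B) = a ^+ 2 * sq A + 2 * (a * b) * dot A B + b ^+ 2 * sq B.
Proof.
rewrite /sq /dot !mulr_sumr -!big_split; apply: eq_bigr => i _ /=.
rewrite !mulr_sumr -!big_split; apply: eq_bigr => j _ /=.
by rewrite !mxE; ring.
Qed.

Let cauchy A B : dot A B <= frobenius A * frobenius B.
Proof.
have [a0|a0] := eqVneq (frobenius A) 0.
  have A0 i j : A i j = 0.
    by apply/eqP; rewrite -normr_le0 -a0 entry_le_frobenius.
  rewrite a0 mul0r /dot big1// => i _; rewrite big1// => j _; rewrite A0 mul0r//.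
have [b0|b0] := eqVneq (frobenius B) 0.
  have B0 i j : B i j = 0.
    by apply/eqP; rewrite -normr_le0 -b0 entry_le_frobenius.
  rewrite b0 mulr0 /dot big1// => i _; rewrite big1// => j _; rewrite B0 mulr0//.
have := sq_ge0 (frobenius B *: A + - frobenius A *: B).
rewrite sqD -!sqE.
set a := frobenius A in a0 *; set b := frobenius B in b0 *.
have ab : 0 < a * b by rewrite mulr_gt0// lt0r ?a0 ?b0 frobenius_ge0.
rewrite (_ : _ + _ = 2 * (a * b) * (a * b - dot A B)); last by ring.
have c0 : 0 < 2 * (a * b) by rewrite mulr_gt0.
by rewrite (pmulr_rge0 _ c0) => h; rewrite -subr_ge0.
Qed.

Lemma frobeniusD A B : frobenius (A + B) <= frobenius A + frobenius B.
Proof.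
rewrite -ler_sqr ?nnegrE ?addr_ge0 ?frobenius_ge0// sqE.
have := sqD A B 1 1; rewrite !scale1r => ->; rewrite !expr1n !mul1r mulr1 -!sqE sqrrD.
by have := cauchy A B; rewrite -mulr_natl; lra.
Qed.

Lemma frobenius_le_sum A : frobenius A <= \sum_i \sum_j `|A i j|.
Proof.
have s0 : 0 <= \sum_i \sum_j `|A i j| by apply: sumr_ge0 => i _; exact: sumr_ge0.
rewrite -ler_sqr ?nnegrE ?frobenius_ge0// sqE expr2 mulr_suml; apply: ler_sum => i _.
rewrite mulr_suml; apply: ler_sum => j _.
rewrite -real_normK ?num_real// expr2 ler_wpM2l// (bigD1 i)//= (bigD1 j)//= -addrA lerDl.
by rewrite addr_ge0//; apply: sumr_ge0 => // k _; exact: sumr_ge0.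
Qed.

Lemma frobenius_mono A B : (forall i j, `|A i j| <= `|B i j|) -> frobenius A <= frobenius B.
Proof.
move=> AB; rewrite ler_sqrt ?sq_ge0//; apply: ler_sum => i _; apply: ler_sum => j _.
by rewrite -real_normK ?num_real// -[leRHS]real_normK ?num_real// lerXn2r ?nnegrE.
Qed.

Section dist.
Variables (K : set 'M[R]_n) (K0 : K !=set0).

Let lb A : has_lbound [set frobenius (A - eta) | eta in K].
Proof. by exists 0 => _ [eta _ <-]; exact: frobenius_ge0. Qed.

Let ne A : [set frobenius (A - eta) | eta in K] !=set0.
Proof. by have [eta Ke] := K0; exists (frobenius (A - eta)), eta. Qed.

Lemma frobenius_dist_ge0 A : 0 <= frobenius_dist A K.
Proof. by apply: lb_le_inf => // _ [eta _ <-]; exact: frobenius_ge0. Qed.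

Lemma frobenius_dist_le A eta : K eta -> frobenius_dist A K <= frobenius (A - eta).
Proof. by move=> Ke; apply: ge_inf => //; exists eta. Qed.

Lemma le_frobenius_dist A (c : R) : (forall eta, K eta -> c <= frobenius (A - eta)) ->
  c <= frobenius_dist A K.
Proof. by move=> H; apply: lb_le_inf => // _ [eta Ke <-]; exact: H. Qed.

Lemma frobenius_dist_lip A B :
  frobenius_dist A K <= frobenius_dist B K + \sum_i \sum_j `|A i j - B i j|.
Proof.
rewrite -lerBlDr; apply: le_frobenius_dist => eta Ke; rewrite lerBlDr.
apply: (le_trans (frobenius_dist_le A Ke)).
rewrite -[A - eta](subrKA B) addrC; apply: (le_trans (frobeniusD _ _)).
rewrite lerD2l; apply: (le_trans (frobenius_le_sum _)).
by apply: ler_sum => i _; apply: ler_sum => j _; rewrite !mxE.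
Qed.

Lemma continuous_frobenius_dist (T : topologicalType) (phi : T -> 'M[R]_n) :
  (forall i j, continuous (fun x => phi x i j)) ->
  continuous (fun x => frobenius_dist (phi x) K).
Proof.
move=> cphi x; apply/cvgrPdist_le => e e0.
have cd : continuous (fun y => \sum_i \sum_j `|phi x i j - phi y i j|).
  apply: continuous_psum => i _; apply: continuous_psum => j _; apply: continuous_pnorm.
  apply: continuous_pD; first exact: continuous_pcst.
  exact: continuous_pN.
near=> y.
have : \sum_i \sum_j `|phi x i j - phi y i j| < e.
  near: y; apply: (cvgr_lt _ (cd x)); rewrite big1// => i _; rewrite big1// => j _.
  by rewrite subrr normr0.
have := frobenius_dist_lip (phi x) (phi y).
have := frobenius_dist_lip (phi y) (phi x).
under eq_bigr do under eq_bigr do rewrite distrC.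
set S := \sum_i _ => h1 h2 h3; rewrite ler_norml; apply/andP; split; lra.
Unshelve. all: by end_near. Qed.

End dist.

End frobenius_distance.

(** * Projecting a bounded symmetric field *)
Section clamp.
Context {R : realType}.
Implicit Types (M t u : R).

Definition clamp M t : R := Num.max (- M) (Num.min M t).

Lemma clamp_bound M t : 0 <= M -> `|clamp M t| <= M.
Proof.
by move=> M0; rewrite ler_norml /clamp le_max lexx ge_max ge_min lexx /= andbT; lra.
Qed.

Lemma clamp_id M t : `|t| <= M -> clamp M t = t.
Proof. by rewrite ler_norml /clamp => /andP[h1 h2]; rewrite min_r// max_r. Qed.

Lemma clamp_lip M t u : `|clamp M t - clamp M u| <= `|t - u|.
Proof.
wlog tu : t u / t <= u => [H|].
  have [tu|/ltW ut] := leP t u; first exact: H.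
  by rewrite distrC [leRHS]distrC; exact: H.
have cases : clamp M t <= clamp M u /\ clamp M u - clamp M t <= u - t.
  have lo v : - M <= clamp M v by rewrite le_max lexx.
  have hi v : Num.min M v <= clamp M v by rewrite le_max lexx orbT.
  have min_tu : Num.min M t <= Num.min M u.
    by rewrite le_min ge_min lexx /= ge_min tu orbT.
  have min_ut : Num.min M u <= Num.min M t + (u - t).
    by rewrite ge_min; case: (leP M t) => h; apply/orP; [left|right]; lra.
  have := lo t; have := lo u; have := hi t; have := hi u => h1 h2 h3 h4.
  by split; rewrite ?lerBlDr {1}/clamp ge_max; apply/andP; split; lra.
rewrite distrC ger0_norm ?subr_ge0; last exact: cases.1.
by rewrite [leRHS]distrC ger0_norm ?subr_ge0//; exact: cases.2.
Qed.

Lemma continuous_clamp M : continuous (clamp M).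
Proof.
move=> t; apply/cvgrPdist_le => e e0; apply/nbhs_ballP; exists e => //= u.
by rewrite /ball /= => /ltW; apply: le_trans; exact: clamp_lip.
Qed.

End clamp.

Section rep_sums.
Context {R : realType} {n : nat}.

Definition tsum (I : finType) (h : I -> seq ('rV[int]_n * R[i])) :=
  flatten [seq h i | i <- index_enum I].

Lemma trig_tsum (I : finType) (h : I -> seq ('rV[int]_n * R[i])) (x : 'rV[R]_n) :
  trig (tsum h) x = \sum_i trig (h i) x.
Proof. exact: trig_flatten. Qed.

Lemma trig_act_tsum (I : finType) mu (h : I -> seq ('rV[int]_n * R[i])) (x : 'rV[R]_n) :
  trig (act mu (tsum h)) x = \sum_i trig (act mu (h i)) x.
Proof. by rewrite /act map_flatten -map_comp trig_flatten. Qed.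

Lemma smooth_trig_matrix (H : 'I_n -> 'I_n -> seq ('rV[int]_n * R[i])) :
  smooth (fun x : 'rV[R]_n => \matrix_(i, j) trig (H i j) x).
Proof.
have cH (H' : 'I_n -> 'I_n -> seq ('rV[int]_n * R[i])) :
    continuous (fun x : 'rV[R]_n => \matrix_(i, j) trig (H' i j) x).
  apply: continuous_mx => i j.
  rewrite (_ : (fun y => _) = trig (H' i j)); first exact: continuous_trig.
  by apply/funext => y; rewrite mxE.
move=> k; elim: k H => [|k IH] H; first by split=> //; exact: cH.
have E i j : (fun y : 'rV[R]_n => (\matrix_(i, j) trig (H i j) y) i j) = trig (H i j).
  by apply/funext => y; rewrite mxE.
split; first exact: cH.
move=> l.
have dH x : derivable (fun x : 'rV[R]_n => \matrix_(i, j) trig (H i j) x) x (evec l).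
  by apply/derivable_mxP => i j; rewrite E; have [] := is_derive_trig (H i j) l x.
split=> //.
rewrite (_ : 'D_(evec l) _ = fun x => \matrix_(i, j) trig (act (dsym l) (H i j)) x).
  exact: IH.
apply/funext => x; rewrite derive_mx//; apply/matrixP => i j; rewrite !mxE E.
by have [] := is_derive_trig (H i j) l x.
Qed.

End rep_sums.

Section projection.
Context {R : realType} {n : nat}.
Implicit Types (i j l m : 'I_n) (k : 'rV[int]_n).

Lemma frN i k : fr i (- k) = - fr i k :> R.
Proof. by rewrite /fr mxE mulrNz. Qed.

Lemma fr0 i : fr i 0 = 0 :> R.
Proof. by rewrite /fr mxE. Qed.

Lemma coneN i k : cone i (- k) = cone i k :> R.
Proof.
have mN j : maximal j (- k) = maximal j k :> R.
  rewrite !maximalE; congr ((nat_of_bool _)%:R).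
  by apply: eq_forallb => l; rewrite !frN !normrN.
by rewrite /cone mN; congr (_ * _); apply: eq_bigr => j _; rewrite mN.
Qed.

Lemma cone_ratioN i j k : cone_ratio i j (- k) = cone_ratio i j k :> R.
Proof. by rewrite /cone_ratio /conormal coneN !frN invrN !mulrN mulNr opprK. Qed.

Lemma cone_ratio0 i j : cone_ratio i j 0 = 0 :> R.
Proof. by rewrite /cone_ratio fr0 mulr0. Qed.

Definition kron i j : R := (i == j)%:R.

Lemma sum_kron i (f : 'I_n -> R) : \sum_j kron i j * f j = f i.
Proof.
rewrite (bigD1 i)//= /kron eqxx mul1r big1 ?addr0// => j ji.
by rewrite eq_sym (negbTE ji) mul0r.
Qed.

(** The symbol of [A |-> (1 - nu k^T) A (1 - k nu^T)], where [nu] is [conormal]: an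
    oblique projection onto the symmetric matrices that annihilate [k]. *)
Definition proj_symbol i j l m k : R := (kron i l - cone_ratio i l k) * (kron j m - cone_ratio j m k).

(** The symbol of [P - 1], where [P] has the symbol above. *)
Definition defect_symbol i j l m k : R := proj_symbol i j l m k - kron i l * kron j m.

Lemma projC i j l m k : proj_symbol i j l m k = proj_symbol j i m l k.
Proof. by rewrite /proj_symbol mulrC. Qed.

Lemma proj_div i l m k : (0 < n)%N -> \sum_j fr j k * proj_symbol i j l m k = 0.
Proof.
move=> n0; rewrite /proj_symbol; under eq_bigr do rewrite mulrCA.
rewrite -mulr_sumr; have [->|k0] := eqVneq k 0.
  by rewrite big1 ?mulr0// => j _; rewrite fr0 mul0r.
under eq_bigr do rewrite mulrBr mulrA.
rewrite sumrB (_ : \sum_j fr j k * kron j m = fr m k); last first.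
  by rewrite -[RHS](sum_kron m (fun j => fr j k)); apply: eq_bigr => j _; rewrite /kron eq_sym mulrC.
rewrite (_ : \sum_j _ = fr m k) ?subrr ?mulr0//.
rewrite -[RHS]mul1r -(sum_conormal n0 k0) mulr_suml; apply: eq_bigr => j _.
by rewrite /cone_ratio; ring.
Qed.

Lemma defectN i j l m k : defect_symbol i j l m (- k) = defect_symbol i j l m k.
Proof. by rewrite /defect_symbol /proj_symbol !cone_ratioN. Qed.

Lemma defect0 i j l m : defect_symbol i j l m 0 = 0.
Proof. by rewrite /defect_symbol /proj_symbol !cone_ratio0 !subr0 subrr. Qed.

(** Every term contains the factor [k_l] or the factor [k_m], where [(l, m)] is the
    input index: the adjoint takes its values in symmetrized gradients. *)
Lemma defectE i j l m k : defect_symbol i j l m k =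
  fr l k * (conormal i k * conormal j k * fr m k - kron j m * conormal i k) +
  fr m k * (- kron i l * conormal j k).
Proof. by rewrite /defect_symbol /proj_symbol /cone_ratio; ring. Qed.

Lemma multiplier_defect o : odd o -> forall i j l m, multiplier o.*2 (defect_symbol i j l m).
Proof.
move=> oo i j l m; have es : ~~ odd o.*2 by rewrite odd_double.
have mk a b : multiplier o.*2 (fun k => kron a b - cone_ratio a b k : R).
  exact: (multiplierB es (multiplier_cst es _) (multiplier_cone_ratio oo a b)).
have := multiplierB es (multiplierM (mk i l) (mk j m))
  (@multiplier_cst R n _ es (kron i l * kron j m)); exact.
Qed.

Lemma multiplier_uniform (s : nat) (T : finType) (mu : T -> 'rV[int]_n -> R) : ~~ odd s ->
  (forall t, multiplier s (mu t)) -> exists2 C, 0 <= C & forall t, Lnorm_le s C (mu t).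
Proof.
move=> es mm; have ex t : exists C, 0 <= C /\ Lnorm_le s C (mu t).
  by have [C C0 HC] := mm t; exists C.
have [C HC] := choice ex; exists (\sum_t C t).
  by apply: sumr_ge0 => t _; have [] := HC t.
move=> t r; have [_ H] := HC t; apply: (le_trans (H r)).
rewrite ler_wpM2r//; first by apply: mean_ge0 => x; exact: even_expr_ge0.
rewrite (bigD1 t)//= lerDl; apply: sumr_ge0 => t' _; by have [] := HC t'.
Qed.

End projection.

Section projected_field.
Context {R : realType} {n : nat} (n0 : (0 < n)%N).
Variables (xi : 'M[R]_n) (r : 'I_n -> 'I_n -> seq ('rV[int]_n * R[i])).
Hypotheses (xiT : symmx xi) (rC : forall i j, r i j = r j i).
Implicit Types (i j l m : 'I_n) (x : 'rV[R]_n).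

Definition proj_rep i j := tsum (fun l => tsum (fun m => ract (proj_symbol i j l m) (r l m))).
Definition defect_rep i j := tsum (fun l => tsum (fun m => ract (defect_symbol i j l m) (r l m))).

Lemma proj_repE i j x : trig (proj_rep i j) x = trig (r i j) x + trig (defect_rep i j) x.
Proof.
have -> : trig (r i j) x = \sum_l \sum_m trig (ract (fun=> kron i l * kron j m) (r l m)) x.
  under eq_bigr do under eq_bigr do rewrite trig_cst -mulrA.
  under eq_bigr do rewrite -mulr_sumr sum_kron.
  by rewrite sum_kron.
rewrite !trig_tsum -big_split; apply: eq_bigr => l _ /=.
rewrite !trig_tsum -big_split; apply: eq_bigr => m _ /=.
rewrite -trig_ractD; congr (trig (ract _ _) x); apply/funext => k.
by rewrite /defect_symbol addrC subrK.
Qed.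

Lemma mean_defect_rep i j : mean (trig (defect_rep i j)) = 0.
Proof.
rewrite [X in mean X](_ : _ = fun x => \sum_l \sum_m trig (ract (defect_symbol i j l m) (r l m)) x).
  rewrite mean_sum => [|l _]; last by apply: continuous_psum => m _; exact: continuous_trig.
  rewrite big1// => l _; rewrite mean_sum => [|m _]; last exact: continuous_trig.
  by rewrite big1// => m _; rewrite mean_ract0// defect0.
by apply/funext => x; rewrite trig_tsum; apply: eq_bigr => l _; rewrite trig_tsum.
Qed.

(** The projection leaves the zero frequency alone; the constant mode moves the mean
    from that of [r i j] to [xi i j]. *)
Definition field_rep i j :=
  (0, (xi i j - mean (trig (r i j)))%:C%C) :: proj_rep i j.

Lemma field_repE i j x : trig (field_rep i j) x =
  xi i j - mean (trig (r i j)) + trig (r i j) x + trig (defect_rep i j) x.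
Proof.
transitivity (mode 0 (xi i j - mean (trig (r i j)))%:C%C x + trig (proj_rep i j) x).
  by rewrite /trig big_cons.
by rewrite proj_repE /mode ek0 mulr1 /= addrA.
Qed.

Definition proj_field x : 'M[R]_n := \matrix_(i, j) trig (field_rep i j) x.

Lemma fieldE i j : (fun x => proj_field x i j) = trig (field_rep i j).
Proof. by apply/funext => x; rewrite mxE. Qed.

(** The coefficient of every mode is annihilated by its own frequency, by
    [proj_div]. *)
Lemma field_div x i : row_div proj_field x i = 0.
Proof.
rewrite /row_div (eq_bigr (fun j => trig (act (dsym j) (proj_rep i j)) x)); last first.
  move=> j _; rewrite fieldE; have [_ ->] := is_derive_trig (field_rep i j) j x.
  rewrite {1}/trig /= big_cons /= (_ : dsym j 0 = 0) ?mul0r ?mode0 ?add0r//.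
  by apply/eqP; rewrite eq_complex /= mxE mulr0z mulr0 !eqxx.
under eq_bigr do rewrite trig_act_tsum.
rewrite exchange_big big1// => l _; under eq_bigr do rewrite trig_act_tsum.
rewrite exchange_big big1// => m _; under eq_bigr do rewrite trig_act big_map.
rewrite exchange_big big1// => p _ /=.
rewrite -mode_sum (_ : \sum_j _ = 0) ?mode0//.
under eq_bigr do rewrite mulrA.
rewrite -mulr_suml (_ : \sum_j _ = (0 +i* (pi *+ 2))%C * (\sum_j fr j p.1 * proj_symbol i j l m p.1)%:C%C).
  by rewrite proj_div// rmorph0 mulr0 mul0r.
rewrite rmorph_sum mulr_sumr; apply: eq_bigr => j _.
apply/eqP; rewrite eq_complex /= /fr.
by apply/andP; split; apply/eqP; ring.
Qed.

Lemma field_test : sdqc_test xi proj_field.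
Proof.
split.
- exact: smooth_trig_matrix.
- by move=> i x; apply/matrixP => a b; rewrite !mxE trig_periodic.
- move=> x; apply/matrixP => a b; rewrite !mxE !field_repE rC.
  have -> : xi b a = xi a b by rewrite -[in LHS]xiT mxE.
  congr (_ + _); rewrite !trig_tsum.
  under eq_bigr do rewrite trig_tsum.
  under [RHS]eq_bigr do rewrite trig_tsum.
  rewrite exchange_big; apply: eq_bigr => l _; apply: eq_bigr => m _ /=.
  rewrite rC; congr (trig (ract _ _) x); apply/funext => k.
  by rewrite /defect_symbol projC mulrC.
- by move=> x i; exact: field_div.
- move=> i j; rewrite fieldE cube_integralE; last exact: continuous_trig.
  congr EFin.
  rewrite [X in mean X](_ : _ = fun x => xi i j - mean (trig (r i j)) +
     (trig (r i j) x + trig (defect_rep i j) x)); last first.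
    by apply/funext => x; rewrite field_repE addrA.
  rewrite meanD; [|exact: continuous_pcst|by apply: continuous_pD; exact: continuous_trig].
  rewrite mean_cst meanD; [|exact: continuous_trig..].
  by rewrite mean_defect_rep addr0 subrK.
Qed.

(** [(P - 1)^*] applied to the defect [(P - 1) r]. *)
Definition adjoint_rep l m :=
  tsum (fun i => tsum (fun j => ract (defect_symbol i j l m) (defect_rep i j))).

Lemma adjoint_repE l m x :
  trig (adjoint_rep l m) x = \sum_i \sum_j trig (ract (defect_symbol i j l m) (defect_rep i j)) x.
Proof. by rewrite trig_tsum; apply: eq_bigr => i _; rewrite trig_tsum. Qed.

(** [<D r, D r> = <D^* D r, r>] for [D = P - 1], entry by entry. *)
Lemma defect_energy :
  \sum_i \sum_j mean (fun x => trig (defect_rep i j) x ^+ 2) =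
  \sum_l \sum_m mean (fun x => trig (adjoint_rep l m) x * trig (r l m) x).
Proof.
have ct s t : continuous (fun x : 'rV[R]_n => trig s x * trig t x : R).
  by apply: continuous_pM; exact: continuous_trig.
pose S i j l m := mean (fun x : 'rV[R]_n =>
  trig (ract (defect_symbol i j l m) (defect_rep i j)) x * trig (r l m) x).
transitivity (\sum_i \sum_j \sum_l \sum_m S i j l m).
  apply: eq_bigr => i _; apply: eq_bigr => j _.
  rewrite [X in mean X](_ : _ = fun x => \sum_l \sum_m
      trig (defect_rep i j) x * trig (ract (defect_symbol i j l m) (r l m)) x); last first.
    apply/funext => x; rewrite expr2 {2}/defect_rep trig_tsum mulr_sumr.
    by apply: eq_bigr => l _; rewrite trig_tsum mulr_sumr.
  rewrite mean_sum => [|l _]; last by apply: continuous_psum => m _; exact: ct.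
  apply: eq_bigr => l _; rewrite mean_sum => [|m _]; last exact: ct.
  apply: eq_bigr => m _; rewrite ract_selfadjoint// => k.
  exact: defectN.
transitivity (\sum_l \sum_m \sum_i \sum_j S i j l m).
  under eq_bigr do rewrite exchange_big /=.
  rewrite exchange_big /=; apply: eq_bigr => l _.
  under eq_bigr do rewrite exchange_big /=.
  by rewrite exchange_big.
apply: eq_bigr => l _; apply: eq_bigr => m _.
rewrite [X in mean X](_ : _ = fun x => \sum_i \sum_j
    trig (ract (defect_symbol i j l m) (defect_rep i j)) x * trig (r l m) x); last first.
  apply/funext => x; rewrite adjoint_repE mulr_suml.
  by apply: eq_bigr => i _; rewrite mulr_suml.
rewrite mean_sum => [|i _]; last by apply: continuous_psum => j _; exact: ct.
by apply: eq_bigr => i _; rewrite mean_sum.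
Qed.

Lemma adjoint_orthogonal xi' phi : sdqc_test xi' phi ->
  \sum_l \sum_m mean (fun x => trig (adjoint_rep l m) x * phi x l m) = 0.
Proof.
move=> tphi; have symphi x l m : phi x l m = phi x m l.
  by have [_ _ /(_ x) sp _ _] := tphi; rewrite -[in LHS]sp mxE.
have cp t l m : continuous (fun x : 'rV[R]_n => trig t x * phi x l m : R).
  apply: continuous_pM; first exact: continuous_trig.
  by apply: continuous_entry; exact: test_continuous tphi.
have single i j : \sum_l \sum_m
    mean (fun x => trig (ract (defect_symbol i j l m) (defect_rep i j)) x * phi x l m) = 0.
  set t := defect_rep i j.
  pose A m k : R := conormal i k * conormal j k * fr m k - kron j m * conormal i k.
  pose B l k : R := - kron i l * conormal j k.
  have split_defect l m : mean (fun x => trig (ract (defect_symbol i j l m) t) x * phi x l m) =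
      mean (fun x => trig (ract (fun k => fr l k * A m k) t) x * phi x m l) +
      mean (fun x => trig (ract (fun k => fr m k * B l k) t) x * phi x l m).
    rewrite -meanD//; congr mean; apply/funext => x.
    rewrite (symphi x m l) -mulrDl -trig_ractD; congr (trig (ract _ t) x * _).
    by apply/funext => k; exact: defectE.
  under eq_bigr do under eq_bigr do rewrite split_defect.
  under eq_bigr do rewrite big_split /=.
  rewrite big_split /= exchange_big /=.
  rewrite big1 => [|m _]; last exact: gradient_orthogonal tphi.
  by rewrite add0r big1// => l _; exact: gradient_orthogonal tphi.
transitivity (\sum_i \sum_j \sum_l \sum_m
    mean (fun x => trig (ract (defect_symbol i j l m) (defect_rep i j)) x * phi x l m)); last first.
  by rewrite big1// => i _; rewrite big1.
transitivity (\sum_l \sum_m \sum_i \sum_j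
    mean (fun x => trig (ract (defect_symbol i j l m) (defect_rep i j)) x * phi x l m)); last first.
  under [RHS]eq_bigr do rewrite exchange_big /=.
  rewrite [RHS]exchange_big /=; apply: eq_bigr => l _.
  under [RHS]eq_bigr do rewrite exchange_big /=.
  by rewrite [RHS]exchange_big.
apply: eq_bigr => l _; apply: eq_bigr => m _.
rewrite [X in mean X](_ : _ = fun x => \sum_i \sum_j
    trig (ract (defect_symbol i j l m) (defect_rep i j)) x * phi x l m); last first.
  apply/funext => x; rewrite adjoint_repE mulr_suml.
  by apply: eq_bigr => i _; rewrite mulr_suml.
rewrite mean_sum => [|i _]; last by apply: continuous_psum => j _; exact: cp.
by apply: eq_bigr => i _; rewrite mean_sum.
Qed.

Variables (s : nat) (es : ~~ odd s) (C : R) (C0 : 0 <= C).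
Hypothesis (HC : forall i j l m, Lnorm_le s C (@defect_symbol R n i j l m)).

(** Both [defect_rep] and [adjoint_rep] are double sums of multipliers applied to
    a matrix of trigonometric polynomials bounded in [L^s]. *)
Lemma double_sum_bound (t : 'I_n -> 'I_n -> seq ('rV[int]_n * R[i]))
    (mu : 'I_n -> 'I_n -> 'rV[int]_n -> R) (D : R) :
  (forall l m, Lnorm_le s C (mu l m)) -> (forall l m, mean (fun x => trig (t l m) x ^+ s) <= D) ->
  mean (fun x => trig (tsum (fun l => tsum (fun m => ract (mu l m) (t l m)))) x ^+ s) <=
  n%:R ^+ s * n%:R ^+ s * (n%:R * n%:R * (C * D)).
Proof.
move=> Hmu Ht.
have cX u : continuous (fun x : 'rV[R]_n => trig u x ^+ s : R).
  by apply: continuous_pX; exact: continuous_trig.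
have cXX : continuous (fun x : 'rV[R]_n =>
    \sum_l \sum_m trig (ract (mu l m) (t l m)) x ^+ s : R).
  by apply: continuous_psum => l _; apply: continuous_psum => m _; exact: cX.
apply: (@le_trans _ _ (mean (fun x : 'rV[R]_n => n%:R ^+ s * n%:R ^+ s *
   \sum_l \sum_m trig (ract (mu l m) (t l m)) x ^+ s))).
  apply: le_mean => //; first exact: continuous_pZ.
  move=> x; rewrite trig_tsum; apply: (le_trans (sum_expr_le _ es n0)).
  rewrite -mulrA ler_wpM2l ?exprn_ge0 ?ler0n// mulr_sumr; apply: ler_sum => l _.
  by rewrite trig_tsum; exact: sum_expr_le.
rewrite meanZ// ler_wpM2l ?mulr_ge0 ?exprn_ge0 ?ler0n//.
rewrite mean_sum => [|l _]; last by apply: continuous_psum => m _; exact: cX.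
apply: (@le_trans _ _ (\sum_(l < n) \sum_(m < n) C * D)).
  apply: ler_sum => l _; rewrite mean_sum//; apply: ler_sum => m _.
  by apply: (le_trans (Hmu l m (t l m))); rewrite ler_wpM2l.
by rewrite !sumr_const !card_ord -mulrnA -[X in _ <= X]mulrA !mulr_natl -mulrnA.
Qed.

End projected_field.

Section truncation.
Context {R : realType} {n : nat} (n0 : (0 < n)%N).

(** Let [g] be the clamped field, [h] the projection of an approximation [r] of [g],
    and [z] the defect of [r].  Then [h - g] is [z] up to an error of order [d], and
    [z] is bounded in [L^s] because [g] is bounded.  By duality the energy of [z] is
    the integral of [Z * (r - phi)], where [Z] is bounded in [L^s] as well and
    [r - phi] is of order [d] plus the part of [phi] that was cut off, which is
    small for the conjugate exponent; Young's inequality concludes. *)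
Lemma truncated_field (o : nat) (M : R) : odd o -> 0 <= M ->
  let s := o.*2 in
  exists2 C : R, 0 <= C & forall (d : R) (xi : 'M[R]_n) phi, 0 < d <= 1 -> symmx xi ->
    sdqc_test xi phi ->
    (forall i j, mean (fun x => `|phi x i j - clamp M (phi x i j)| `^ conj_exp s) <=
       d * d `^ conj_exp s) ->
    exists2 h, sdqc_test xi h & forall i j,
      mean (fun x => (h x i j - clamp M (phi x i j)) ^+ s) <= C /\
      mean (fun x => (h x i j - clamp M (phi x i j)) ^+ 2) <= C * d.
Proof.
move=> oo M0 s.
have es : ~~ odd s by rewrite /s odd_double.
have s1 : (1 < s)%N by case: (o) oo @s es => // o' _ _ _; rewrite doubleS.
have [CQ CQ0 HQ] := multiplier_uniform es
  (fun t : 'I_n * 'I_n * ('I_n * 'I_n) => multiplier_defect oo t.1.1 t.1.2 t.2.1 t.2.2 : multiplier s (_ : _ -> R)).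
have {}HQ i j l m : Lnorm_le s CQ (@defect_symbol R n i j l m) by exact: (HQ ((i, j), (l, m))).
pose N : R := n%:R ^+ s * n%:R ^+ s * (n%:R * n%:R).
have N0 : 0 <= N by rewrite !mulr_ge0 ?exprn_ge0 ?ler0n.
pose B : R := (M + 1) ^+ s.
have B0 : 0 <= B by rewrite exprn_ge0// addr_ge0.
pose Bz : R := N * (CQ * B).
have Bz0 : 0 <= Bz by rewrite !mulr_ge0.
pose BZ : R := N * (CQ * Bz).
have BZ0 : 0 <= BZ by rewrite !mulr_ge0.
pose C1 : R := 2 ^+ s * (4 ^+ s + Bz).
pose C2 : R := 4 * (16 + n%:R * n%:R * (2 + 2 * BZ)).
have C10 : 0 <= C1 by rewrite mulr_ge0 ?exprn_ge0// addr_ge0// exprn_ge0.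
have C20 : 0 <= C2.
  by rewrite mulr_ge0// addr_ge0// mulr_ge0 ?mulr_ge0 ?ler0n// addr_ge0// mulr_ge0.
exists (C1 + C2); first exact: addr_ge0.
move=> d xi phi /andP[d0 d1] xiT tphi small.
have dle1 : d ^+ s <= d by rewrite -(prednK (ltnW s1)) exprS ler_piMr ?(ltW d0)// exprn_ile1// ltW.
pose g i j (x : 'rV[R]_n) : R := clamp M (phi x i j).
have cphi i j : continuous (fun x => phi x i j).
  by apply: continuous_entry; exact: test_continuous tphi.
have cg i j : continuous (g i j).
  by apply: continuous_pcomp; [exact: continuous_clamp|exact: cphi].
have pg i j l x : g i j (x + evec l) = g i j x.
  by have [_ _ _ per] := test_entry i j l tphi; rewrite /g per.
have gC i j : g i j = g j i.
  apply/funext => x; rewrite /g; congr clamp.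
  by have [_ _ /(_ x) sp _ _] := tphi; rewrite -[in LHS]sp mxE.
(* The approximant is chosen as a function of [f], so that equal entries of the
   symmetric field [g] receive the same list of modes. *)
have ex (f : 'rV[R]_n -> R) : exists rf : seq ('rV[int]_n * R[i]),
    continuous f -> (forall i x, f (x + evec i) = f x) -> forall x, `|trig rf x - f x| <= d.
  have [cf|ncf] := pselect (continuous f); last by exists [::].
  have [pf|npf] := pselect (forall i x, f (x + evec i) = f x); last by exists [::].
  by have [r Hr] := trig_dense cf pf d0; exists r.
have [rr rrP] := choice ex.
pose r i j := rr (g i j).
have rC i j : r i j = r j i by rewrite /r gC.
have rg i j x : `|trig (r i j) x - g i j x| <= d.
  by apply: rrP; [exact: cg|move=> l y; exact: pg].
have gM i j x : `|g i j x| <= M by exact: clamp_bound.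
have ct t : continuous (@trig R n t) by exact: continuous_trig.
have ctX t k : continuous (fun x => @trig R n t x ^+ k) by exact: continuous_pX.
have mean_r i j : mean (fun x => trig (r i j) x ^+ s) <= B.
  rewrite -[B](@mean_cst _ n); apply: le_mean => //; first exact: continuous_pcst.
  move=> x; rewrite -(even_normX _ es) /B lerXn2r ?nnegrE ?addr_ge0//.
  rewrite -[trig _ x](subrK (g i j x)) addrC (le_trans (ler_normD _ _))// lerD//.
  exact: le_trans d1.
pose z i j := defect_rep r i j.
pose Z l m := adjoint_rep r l m.
have mean_z i j : mean (fun x => trig (z i j) x ^+ s) <= Bz.
  apply: le_trans (double_sum_bound n0 es CQ0 (HQ i j) mean_r) _.
  by rewrite /Bz /N -!mulrA.
have mean_Z l m : mean (fun x => trig (Z l m) x ^+ s) <= BZ.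
  apply: le_trans (double_sum_bound n0 es CQ0 (fun i j => HQ i j l m) mean_z) _.
  by rewrite /BZ /N -!mulrA.
pose b i j x : R := `|phi x i j - g i j x|.
have cb i j : continuous (b i j).
  apply: continuous_pnorm; apply: continuous_pD; first exact: cphi.
  by apply: continuous_pN; exact: cg.
have c0 := @conj_exp_gt0 R s s1.
have cbp i j : continuous (fun x => b i j x `^ conj_exp s : R).
  rewrite (_ : (fun x => _) = fun x => `|b i j x| `^ conj_exp s).
    exact: (continuous_pcomp (continuous_powR_norm c0) (cb i j)).
  by apply/funext => x; rewrite /b normr_id.
(* Young's inequality with weight [d]: the smallness of the cut-off part
   compensates the large constant in front of its power. *)
have young (a : 'rV[R]_n -> R) (D : R) i j : continuous a -> (forall x, 0 <= a x) ->
    mean (fun x => a x ^+ s) <= D -> mean (fun x => a x * b i j x) <= d * D + d.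
  move=> ca a0 aD.
  have caX : continuous (fun x => a x ^+ s) by exact: continuous_pX.
  apply: (@le_trans _ _ (mean (fun x => d ^+ s * a x ^+ s +
      d `^ (- conj_exp s) * b i j x `^ conj_exp s))).
    apply: le_mean; first exact: continuous_pM.
      by apply: continuous_pD; exact: continuous_pZ.
    by move=> x; apply: young_expr => //; exact: normr_ge0.
  rewrite meanD; [|exact: continuous_pZ..].
  rewrite !meanZ//; apply: lerD.
    apply: (@le_trans _ _ (d * mean (fun x => a x ^+ s))).
      by rewrite ler_wpM2r// mean_ge0// => x; exact: exprn_ge0.
    by rewrite ler_wpM2l// ltW.
  rewrite powRN -ler_pdivlMl ?invr_gt0 ?powR_gt0// invrK mulrC.
  exact: small.
pose w i j x : R := trig (r i j) x - phi x i j.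
have cw i j : continuous (w i j) by apply: continuous_pD => //; exact: continuous_pN.
have wb i j x : `|w i j x| <= d + b i j x.
  rewrite /w -(subrKA (g i j x)) (le_trans (ler_normD _ _))// lerD//.
  by rewrite /b distrC.
(* The orthogonality of [Z] to [phi] turns [r] into [r - phi]. *)
have energy : \sum_i \sum_j mean (fun x => trig (z i j) x ^+ 2) <=
    n%:R * n%:R * (d * (2 + 2 * BZ)).
  rewrite defect_energy.
  apply: (@le_trans _ _ (\sum_l \sum_m mean (fun x => trig (Z l m) x * trig (r l m) x) -
      \sum_l \sum_m mean (fun x => trig (Z l m) x * phi x l m))).
    by rewrite (adjoint_orthogonal r tphi) subr0.
  rewrite -sumrB.
  apply: (@le_trans _ _ (\sum_(l < n) \sum_(m < n) d * (2 + 2 * BZ))); last first.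
    by rewrite !sumr_const !card_ord -[X in _ <= X]mulrA !mulr_natl -mulrnA.
  apply: ler_sum => l _; rewrite -sumrB; apply: ler_sum => m _.
  rewrite -meanB; [|exact: continuous_pM..].
  have cnZ : continuous (fun x => `|trig (Z l m) x| : R) by exact: continuous_pnorm.
  have cnZb : continuous (fun x => `|trig (Z l m) x| * b l m x) by exact: continuous_pM.
  have cd1 : continuous (fun x => d * (1 + trig (Z l m) x ^+ s)).
    by apply: continuous_pZ; apply: continuous_pD => //; exact: continuous_pcst.
  apply: (@le_trans _ _ (mean (fun x => d * (1 + trig (Z l m) x ^+ s) +
       `|trig (Z l m) x| * b l m x))).
    apply: le_mean.
    - by apply: continuous_pD; [|apply: continuous_pN]; exact: continuous_pM.
    - exact: continuous_pD.
    - move=> x; rewrite -mulrBr (le_trans (ler_norm _))// normrM.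
      apply: (@le_trans _ _ (`|trig (Z l m) x| * (d + b l m x))).
        by rewrite ler_wpM2l//; exact: wb.
      rewrite mulrDr lerD2r mulrC ler_wpM2l ?(ltW d0)//.
      rewrite -(even_normX _ es); have [le1|gt1] := leP `|trig (Z l m) x| 1.
        by rewrite (le_trans le1)// lerDl exprn_ge0.
      rewrite ler_wpDl// -[leLHS]expr1 ler_weXn2l ?(ltW gt1)//.
      exact: ltnW.
  rewrite meanD// meanZ; last by apply: continuous_pD => //; exact: continuous_pcst.
  rewrite meanD//; last exact: continuous_pcst.
  rewrite mean_cst.
  have y1 : mean (fun x => `|trig (Z l m) x| * b l m x) <= d * BZ + d.
    apply: young => //; rewrite (_ : (fun x => _) = fun x => trig (Z l m) x ^+ s) ?mean_Z//.
    by apply/funext => x; rewrite even_normX.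
  have y2 : d * (1 + mean (fun x => trig (Z l m) x ^+ s)) <= d * (1 + BZ).
    by rewrite ler_wpM2l ?(ltW d0)// lerD2l mean_Z.
  by move: y1 y2; lra.
have mean_z2 i j : mean (fun x => trig (z i j) x ^+ 2) <= n%:R * n%:R * (d * (2 + 2 * BZ)).
  apply: le_trans energy; have m2 i' j' : 0 <= mean (fun x => trig (z i' j') x ^+ 2).
    by apply: mean_ge0 => x; exact: sqr_ge0.
  rewrite (bigD1 i)//= (bigD1 j)//= -addrA lerDl addr_ge0//; first exact: sumr_ge0.
  by apply: sumr_ge0 => i' _; exact: sumr_ge0.
pose rho i j : R := xi i j - mean (trig (r i j)).
have rho_le i j : `|rho i j| <= 3 * d.
  have mphi : xi i j = mean (fun x => phi x i j).
    have [_ _ _ _ /(_ i j)] := tphi; rewrite cube_integralE; last exact: cphi.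
    by case.
  rewrite /rho distrC mphi -meanB//.
  apply: (le_trans (mean_norm (cw i j))).
  apply: (@le_trans _ _ (mean (fun x => d + 1 * b i j x))).
    apply: le_mean; first exact: continuous_pnorm.
      by apply: continuous_pD; [exact: continuous_pcst|exact: continuous_pZ].
    by move=> x; rewrite mul1r; exact: wb.
  rewrite meanD; [|exact: continuous_pcst|exact: continuous_pZ].
  rewrite mean_cst; have : mean (fun x => 1 * b i j x) <= d * 1 + d.
    apply: (young (fun=> 1)) => //; first exact: continuous_pcst.
    by under [X in mean X]eq_fun do rewrite expr1n; rewrite mean_cst.
  by lra.
pose h := proj_field xi r.
have eE i j x : h x i j - clamp M (phi x i j) =
    (rho i j + (trig (r i j) x - g i j x)) + trig (z i j) x.
  by rewrite /h mxE field_repE// -/(g i j x) /rho -/(z i j); ring.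
have rho_g i j x : `|rho i j + (trig (r i j) x - g i j x)| <= 4 * d.
  by apply: (le_trans (ler_normD _ _)); have := rho_le i j; have := rg i j x; lra.
have ce i j k : continuous (fun x => (h x i j - clamp M (phi x i j)) ^+ k).
  apply: continuous_pX; apply: continuous_pD; last by apply: continuous_pN; exact: cg.
  by rewrite /h fieldE; exact: continuous_trig.
have power_bound k i j (D : R) : ~~ odd k -> mean (fun x => trig (z i j) x ^+ k) <= D ->
    mean (fun x => (h x i j - clamp M (phi x i j)) ^+ k) <= 2 ^+ k * ((4 * d) ^+ k + D).
  move=> ek HD; apply: (@le_trans _ _ (mean (fun x => 2 ^+ k * ((4 * d) ^+ k + trig (z i j) x ^+ k)))).
    apply: le_mean => //.
      by apply: continuous_pZ; apply: continuous_pD => //; exact: continuous_pcst.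
    move=> x; rewrite eE; apply: (le_trans (exprD_le _ _ ek)).
    rewrite ler_wpM2l ?exprn_ge0// lerD2r -(even_normX _ ek) lerXn2r ?nnegrE//.
    by rewrite mulr_ge0// ltW.
  rewrite meanZ; last by apply: continuous_pD => //; exact: continuous_pcst.
  rewrite meanD//; last exact: continuous_pcst.
  by rewrite mean_cst ler_wpM2l ?exprn_ge0// lerD2l.
exists h; first exact: field_test.
move=> i j; split.
- apply: le_trans (power_bound s i j Bz es (mean_z i j)) _.
  apply: (@le_trans _ _ C1); last by rewrite lerDl.
  rewrite /C1 ler_wpM2l ?exprn_ge0// lerD2r lerXn2r ?nnegrE ?mulr_ge0 ?(ltW d0)//.
  by rewrite ler_piMr.
- apply: le_trans (power_bound 2%N i j _ isT (mean_z2 i j)) _.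
  apply: (@le_trans _ _ (C2 * d)); last by rewrite ler_wpM2r ?(ltW d0)// lerDr.
  have dd : d ^+ 2 <= d by rewrite expr2 ler_piMr ?(ltW d0).
  rewrite /C2 exprMn; move: (n%:R * n%:R) (2 + 2 * BZ) => u v.
  have -> : 4 * (16 + u * v) * d = 2 ^+ 2 * (4 ^+ 2 * d + u * (d * v)) by ring.
  by rewrite ler_wpM2l// lerD2r ler_wpM2l.
Qed.

End truncation.

(** * The hulls *)
Lemma clamp_nearest {R : realType} (M t u : R) : `|u| <= M -> `|t - clamp M t| <= `|t - u|.
Proof.
move=> uM; have M0 : 0 <= M by apply: le_trans uM.
move: uM; rewrite ler_norml => /andP[u1 u2].
have [tM|Mt] := leP t M; last first.
  have -> : clamp M t = M by rewrite /clamp min_l ?(ltW Mt)// max_r//; lra.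
  by rewrite !ger0_norm; lra.
have [tM'|Mt'] := leP (- M) t.
  have -> : clamp M t = t by apply: clamp_id; rewrite ler_norml tM' tM.
  by rewrite subrr normr0.
have -> : clamp M t = - M by rewrite /clamp min_r// max_l ?(ltW Mt').
by rewrite !ler0_norm; lra.
Qed.

Lemma small_factor {R : realType} (A e : R) : 0 <= A -> 0 < e ->
  exists2 d, 0 < d <= 1 & A * d <= e.
Proof.
move=> A0 e0; have A1 : 0 < A + 1 by rewrite ltr_wpDl.
exists (Num.min 1 (e / (A + 1))).
  by rewrite lt_min ltr01 divr_gt0//= ge_min lexx.
apply: (@le_trans _ _ ((A + 1) * (e / (A + 1)))); last by rewrite mulrCA divff ?mulr1// gt_eqF.
by apply: ler_pM; rewrite ?le_min ?ler01 ?divr_ge0 ?(ltW e0) ?(ltW A1)// ?lerDl// ge_min lexx orbT.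
Qed.

Lemma conj_exp_le {R : realType} (p q : R) : 1 < p ->
  exists o : nat, [/\ odd o, q < o.*2%:R & conj_exp o.*2 <= p].
Proof.
move=> p1; have p10 : 0 < p - 1 by rewrite subr_gt0.
have [N HN] : exists N : nat, `|q| + p / (p - 1) <= N%:R.
  by have [N _ HN] := @nbhs_infty_ger R (`|q| + p / (p - 1)); exists N; exact: (HN N (leqnn N)).
have Ns : N%:R < N.*2.+1.*2%:R :> R.
  by rewrite ltr_nat -!muln2; lia.
have r0 : 0 <= p / (p - 1) by rewrite divr_ge0 ?(ltW p10)//; lra.
exists N.*2.+1; rewrite /= odd_double; split => //.
  by apply: le_lt_trans Ns; have := ler_norm q; lra.
set s : R := N.*2.+1.*2%:R in Ns *.
have s1 : 1 < s by rewrite ltr1n.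
rewrite /conj_exp -/s ler_pdivrMr ?subr_gt0//.
have : p / (p - 1) <= s by have := normr_ge0 q; lra.
by rewrite ler_pdivrMr//; lra.
Qed.

Section hulls.
Context {R : realType} {n : nat} (n0 : (0 < n)%N).
Variables (K : set 'M[R]_n) (K0 : K !=set0).
Implicit Types (xi : 'M[R]_n).

Lemma continuous_dist_pow (r : R) (phi : 'rV[R]_n -> 'M[R]_n) : 0 < r ->
  (forall i j, continuous (fun x => phi x i j)) ->
  continuous (fun x => frobenius_dist (phi x) K `^ r).
Proof.
move=> r0 cphi; rewrite (_ : (fun x => _) = fun x => `|frobenius_dist (phi x) K| `^ r).
  exact: (continuous_pcomp (continuous_powR_norm r0) (continuous_frobenius_dist K0 cphi)).
by apply/funext => x; rewrite ger0_norm ?frobenius_dist_ge0.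
Qed.

Definition approximable (r : R) xi := forall e, 0 < e ->
  exists2 phi, sdqc_test xi phi & mean (fun x => frobenius_dist (phi x) K `^ r) <= e.

(** The envelope is an infimum of nonnegative finite integrals. *)
Lemma hullE (r : R) xi : 0 < r -> sdqc_hull K r xi <-> symmx xi /\ approximable r xi.
Proof.
move=> r0.
have intE phi : sdqc_test xi phi -> cube_integral (dist_pow K r \o phi) =
    (mean (fun x => frobenius_dist (phi x) K `^ r))%:E.
  move=> tphi; rewrite cube_integralE//; apply: continuous_dist_pow => // i j.
  by apply: continuous_entry; exact: test_continuous tphi.
have m0 phi : 0 <= mean (fun x : 'rV[R]_n => frobenius_dist (phi x) K `^ r).
  by apply: mean_ge0 => x; exact: powR_ge0.
split=> -[xiT H]; split => //.
  move=> e e0.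
  have fin : sdqc_envelope (dist_pow K r) xi \is a fin_num by rewrite H.
  have [_ [phi tphi <-]] := lb_ereal_inf_adherent e0 fin.
  rewrite -/(sdqc_envelope _ _) H add0e intE// lte_fin => /ltW le.
  by exists phi.
apply/eqP; rewrite eq_le; apply/andP; split.
  apply/lee_addgt0Pr => e e0; rewrite add0e.
  have [phi tphi le] := H e e0.
  apply: (@le_trans _ _ (cube_integral (dist_pow K r \o phi))).
    by apply: ereal_inf_lbound; exists phi.
  by rewrite intE// lee_fin.
apply: le_ereal_inf_tmp => _ [phi tphi <-]; rewrite intE// lee_fin; exact: m0.
Qed.

Lemma approximable_lower (a b : R) xi : 0 < a -> a <= b ->
  approximable b xi -> approximable a xi.
Proof.
move=> a0 ab H e e0; have e2 : 0 < e / 2 by rewrite divr_gt0.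
pose d := (e / 2) `^ a^-1; have d0 : 0 < d by rewrite powR_gt0.
have da : d `^ a = e / 2 by rewrite /d -powRrM mulVf ?gt_eqF// powRr1 ?(ltW e2).
have c0 : 0 < d `^ (a - b) by rewrite powR_gt0.
have [phi tphi le] := H (e / 2 / d `^ (a - b)) (divr_gt0 e2 c0).
exists phi => //.
have cphi i j : continuous (fun x => phi x i j).
  by apply: continuous_entry; exact: test_continuous tphi.
have cb : continuous (fun x => frobenius_dist (phi x) K `^ b).
  by apply: continuous_dist_pow => //; exact: lt_le_trans ab.
apply: (@le_trans _ _ (mean (fun x => d `^ a + d `^ (a - b) * frobenius_dist (phi x) K `^ b))).
  apply: le_mean; first exact: continuous_dist_pow.
    by apply: continuous_pD; [exact: continuous_pcst|exact: continuous_pZ].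
  by move=> x; apply: powR_interpolate => //; exact: frobenius_dist_ge0.
rewrite meanD; [|exact: continuous_pcst|exact: continuous_pZ].
rewrite mean_cst meanZ// da [leRHS]splitr lerD2l.
by rewrite mulrC -ler_pdivlMr.
Qed.

Hypothesis Kc : compact K.

Lemma compact_entries : exists2 M : R, 0 <= M &
  forall eta i j, K eta -> `|eta i j| <= M.
Proof.
have [M [_ HM]] := compact_bounded Kc.
exists (`|M| + 1) => [|eta i j Ke]; first by rewrite addr_ge0.
apply: le_trans (HM (`|M| + 1) _ eta Ke); last by rewrite ltr_pwDr// ler_norm.
rewrite [leRHS]/Num.Def.normr/= mx_normrE.
exact: (le_bigmax _ (fun ij : 'I_n * 'I_n => `|eta ij.1 ij.2|) (i, j)).
Qed.

(** The distance of [h] to [K] is at most that of the clamped field [g] plus the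
    error [h - g].  The former is bounded and at most [dist (phi, K)], which is small
    for a lower exponent; the latter is small in [L^2] and bounded in [L^s] with
    [s > q]. *)
Lemma approximable_upper (o : nat) (q : R) xi : odd o -> symmx xi ->
  conj_exp o.*2 < q -> q < o.*2%:R -> approximable (conj_exp o.*2) xi -> approximable q xi.
Proof.
move=> oo xiT pq qs H e e0; set s := o.*2 in qs H pq *; set p0 := conj_exp s in pq H.
have es : ~~ odd s by rewrite /s odd_double.
have s1 : (1 < s)%N by rewrite /s; case: (o) oo => // o' _; rewrite doubleS.
have p00 : 0 < p0 := conj_exp_gt0 s1.
have q0 : 0 < q := lt_trans p00 pq.
have [M M0 KM] := compact_entries.
have [C C0 HC] := truncated_field n0 oo M0.
pose N k : R := n%:R ^+ k * n%:R ^+ k * (n%:R * n%:R).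
have N0 k : 0 <= N k by rewrite !mulr_ge0 ?exprn_ge0 ?ler0n.
pose W : R := 2 `^ q; have W0 : 0 <= W by exact: powR_ge0.
(* The three terms of the final estimate get [e / 3] each: [u] absorbs the bounded
   moment of order [s], then [d] the mean square, then [v] the distance of [phi]. *)
have e3 : 0 < e / 3 by rewrite divr_gt0.
have [u /andP[u0 u1] Hu] : exists2 u, 0 < u <= 1 & W * (1 + N s * C) * u <= e / 3.
  by apply: small_factor => //; rewrite mulr_ge0// addr_ge0// mulr_ge0.
have [Cu Cu0 HCu] := powR_between q0 qs u0.
have [d /andP[d0 d1] Hd] : exists2 d, 0 < d <= 1 & W * Cu * (N 2%N * C) * d <= e / 3.
  by apply: small_factor => //; rewrite mulr_ge0// mulr_ge0.
pose L : R := n%:R * n%:R * (2 * M) + 1.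
have L0 : 0 <= L by rewrite addr_ge0// !mulr_ge0 ?ler0n.
have [v /andP[v0 v1] Hv] : exists2 v, 0 < v <= 1 & W * L `^ (q - p0) * v <= e / 3.
  by apply: small_factor => //; rewrite mulr_ge0 ?powR_ge0.
have dd0 : 0 < d * d `^ p0 by rewrite mulr_gt0 ?powR_gt0.
have t0 : 0 < Num.min v (d * d `^ p0) by rewrite lt_min v0.
have [phi tphi Hphi] := H _ t0.
have phiv : mean (fun x => frobenius_dist (phi x) K `^ p0) <= v.
  by apply: (le_trans Hphi); rewrite ge_min lexx.
have phid : mean (fun x => frobenius_dist (phi x) K `^ p0) <= d * d `^ p0.
  by apply: (le_trans Hphi); rewrite ge_min lexx orbT.
have cphi i j : continuous (fun x => phi x i j).
  by apply: continuous_entry; exact: test_continuous tphi.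
have cdphi : continuous (fun x => frobenius_dist (phi x) K `^ p0).
  exact: continuous_dist_pow.
pose g x : 'M[R]_n := \matrix_(i, j) clamp M (phi x i j).
have gE x i j : g x i j = clamp M (phi x i j) by rewrite mxE.
have cg i j : continuous (fun x => g x i j).
  rewrite (_ : (fun x => _) = fun x => clamp M (phi x i j)).
    exact: (continuous_pcomp (@continuous_clamp _ M) (cphi i j)).
  by apply/funext => x; rewrite gE.
have dgphi x : frobenius_dist (g x) K <= frobenius_dist (phi x) K.
  apply: le_frobenius_dist => // eta Ke.
  apply: (le_trans (frobenius_dist_le _ Ke)); apply: frobenius_mono => i j.
  by rewrite !mxE -{1}(clamp_id (KM eta i j Ke)) clamp_lip.
have dgL x : frobenius_dist (g x) K <= L.
  have [eta Ke] := K0; apply: (le_trans (frobenius_dist_le _ Ke)).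
  apply: (le_trans (frobenius_le_sum _)).
  apply: (@le_trans _ _ (\sum_(i < n) \sum_(j < n) (2 * M))).
    apply: ler_sum => i _; apply: ler_sum => j _; rewrite !mxE.
    rewrite (le_trans (ler_normB _ _))// mulr_natl mulr2n lerD ?KM//.
    exact: clamp_bound.
  by rewrite !sumr_const !card_ord /L -[X in _ <= X + _]mulrA !mulr_natl -mulrnA lerDl.
have small i j : mean (fun x => `|phi x i j - clamp M (phi x i j)| `^ p0) <= d * d `^ p0.
  apply: le_trans phid; apply: le_mean => //.
    apply: (continuous_pcomp (continuous_powR_norm p00)
      (f := fun x => phi x i j - clamp M (phi x i j))).
    apply: continuous_pD => //; apply: continuous_pN.
    exact: (continuous_pcomp (@continuous_clamp _ M) (cphi i j)).
  move=> x; apply: ge0_ler_powR; rewrite ?nnegrE ?frobenius_dist_ge0 ?(ltW p00)//.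
  apply: le_frobenius_dist => // eta Ke.
  apply: (le_trans (clamp_nearest _ (KM eta i j Ke))).
  by apply: le_trans (entry_le_frobenius _ i j); rewrite !mxE.
have [h th Hh] : exists2 h, sdqc_test xi h & forall i j,
      mean (fun x => (h x i j - clamp M (phi x i j)) ^+ s) <= C /\
      mean (fun x => (h x i j - clamp M (phi x i j)) ^+ 2) <= C * d.
  by apply: (HC d xi phi) => //; rewrite d0.
exists h => //.
have ch i j : continuous (fun x => h x i j).
  by apply: continuous_entry; exact: test_continuous th.
pose E x : R := \sum_i \sum_j `|h x i j - g x i j|.
have E0 x : 0 <= E x by apply: sumr_ge0 => i _; exact: sumr_ge0.
have ce i j : continuous (fun x => `|h x i j - g x i j|).
  by apply: continuous_pnorm; apply: continuous_pD => //; exact: continuous_pN.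
have cE : continuous E.
  by apply: continuous_psum => i _; apply: continuous_psum => j _; exact: ce.
have meanE k (D : R) : ~~ odd k -> (forall i j,
    mean (fun x => (h x i j - clamp M (phi x i j)) ^+ k) <= D) ->
    mean (fun x => E x ^+ k) <= N k * D.
  move=> ek HD.
  have cek i j : continuous (fun x => `|h x i j - g x i j| ^+ k) by exact: continuous_pX.
  have cek2 : continuous (fun x => \sum_i \sum_j `|h x i j - g x i j| ^+ k).
    by apply: continuous_psum => i _; apply: continuous_psum.
  apply: (@le_trans _ _ (mean (fun x => n%:R ^+ k * n%:R ^+ k *
      \sum_i \sum_j `|h x i j - g x i j| ^+ k))).
    apply: le_mean; [exact: continuous_pX|exact: continuous_pZ|move=> x].
    apply: (le_trans (sum_expr_le _ ek n0)).
    rewrite -mulrA ler_wpM2l ?exprn_ge0 ?ler0n// mulr_sumr; apply: ler_sum => i _.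
    exact: sum_expr_le.
  rewrite meanZ// /N -mulrA ler_wpM2l ?mulr_ge0 ?exprn_ge0 ?ler0n//.
  rewrite mean_sum => [|i _]; last by apply: continuous_psum.
  apply: (@le_trans _ _ (\sum_(i < n) \sum_(j < n) D)).
    apply: ler_sum => i _; rewrite mean_sum//; apply: ler_sum => j _.
    rewrite [X in mean X](_ : _ = fun x => (h x i j - clamp M (phi x i j)) ^+ k)//.
    by apply/funext => x; rewrite even_normX// gE.
  by rewrite !sumr_const !card_ord -[X in _ <= X]mulrA !mulr_natl -mulrnA.
have meanEs : mean (fun x => E x ^+ s) <= N s * C by apply: meanE => // i j; have [] := Hh i j.
have meanE2 : mean (fun x => E x ^+ 2) <= N 2%N * (C * d).
  by apply: meanE => // i j; have [] := Hh i j.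
have cEX k : continuous (fun x => E x ^+ k) by exact: continuous_pX.
have pointwise x : frobenius_dist (h x) K `^ q <=
    W * L `^ (q - p0) * frobenius_dist (phi x) K `^ p0 +
    (W * u * (1 + E x ^+ s) + W * Cu * E x ^+ 2).
  have hg : frobenius_dist (h x) K <= frobenius_dist (g x) K + E x by exact: frobenius_dist_lip.
  have dg0 := frobenius_dist_ge0 K0 (g x).
  apply: (@le_trans _ _ ((frobenius_dist (g x) K + E x) `^ q)).
    by apply: ge0_ler_powR; rewrite ?nnegrE ?addr_ge0 ?frobenius_dist_ge0 ?(ltW q0).
  apply: (le_trans (powRD_le q0 dg0 (E0 x))); rewrite -/W -!mulrA -!mulrDr ler_wpM2l//.
  apply: lerD; last exact: HCu.
  have [->|dgn0] := eqVneq (frobenius_dist (g x) K) 0.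
    by rewrite powR0 ?gt_eqF// mulr_ge0 ?powR_ge0.
  have -> : frobenius_dist (g x) K `^ q =
      frobenius_dist (g x) K `^ (q - p0) * frobenius_dist (g x) K `^ p0.
    by rewrite -powRD ?subrK// dgn0 implybT.
  apply: ler_pM; [exact: powR_ge0|exact: powR_ge0| |].
    by apply: ge0_ler_powR; rewrite ?nnegrE ?subr_ge0 ?(ltW pq).
  by apply: ge0_ler_powR; rewrite ?nnegrE ?frobenius_dist_ge0 ?(ltW p00).
have c1E : continuous (fun x => 1 + E x ^+ s).
  by apply: continuous_pD; [exact: continuous_pcst|exact: cEX].
have cZ1 := @continuous_pZ R _ (W * L `^ (q - p0)) _ cdphi.
have cZ2 := @continuous_pZ R _ (W * u) _ c1E.
have cZ3 := @continuous_pZ R _ (W * Cu) _ (cEX 2%N).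
apply: (@le_trans _ _ (mean (fun x => W * L `^ (q - p0) * frobenius_dist (phi x) K `^ p0 +
    (W * u * (1 + E x ^+ s) + W * Cu * E x ^+ 2)))).
  apply: le_mean; [exact: continuous_dist_pow| |exact: pointwise].
  exact: (continuous_pD cZ1 (continuous_pD cZ2 cZ3)).
rewrite (meanD cZ1 (continuous_pD cZ2 cZ3)) (meanD cZ2 cZ3).
rewrite (meanZ _ cdphi) (meanZ _ c1E) (meanZ _ (cEX 2%N)).
rewrite (meanD (@continuous_pcst _ _ 1) (cEX s)) mean_cst.
have m1 : W * L `^ (q - p0) * mean (fun x => frobenius_dist (phi x) K `^ p0) <= e / 3.
  by apply: le_trans Hv; rewrite ler_wpM2l// mulr_ge0 ?powR_ge0.
have m2 : W * u * (1 + mean (fun x => E x ^+ s)) <= e / 3.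
  by apply: le_trans Hu; rewrite mulrAC ler_wpM2r ?(ltW u0)// ler_wpM2l// lerD2l.
have m3 : W * Cu * mean (fun x => E x ^+ 2) <= e / 3.
  by apply: le_trans Hd; rewrite -[leRHS]mulrA -[N 2%N * C * d]mulrA ler_wpM2l// mulr_ge0.
by move: m1 m2 m3; lra.
Qed.

End hulls.

Theorem theorem3p6 (R : realType) (n : nat) (hn : (0 < n)%N)
    (K : set 'M[R]_n) (K_sym : K `<=` symmx) (K_compact : compact K)
    (K_nonempty : K !=set0) (p q : R) (hp : 1 < p) (hpq : p < q) :
  sdqc_hull K p = sdqc_hull K q.
Proof.
have p0 : 0 < p := lt_trans ltr01 hp.
have q0 : 0 < q := lt_trans p0 hpq.
apply/seteqP; split => xi H.
  have [xiT {}H] := (hullE K_nonempty xi p0).1 H.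
  apply: (hullE K_nonempty xi q0).2; split=> //.
  have [m [om qm cm]] := conj_exp_le q hp.
  apply: (approximable_upper hn K_nonempty K_compact om xiT (le_lt_trans cm hpq) qm).
  apply: (approximable_lower K_nonempty _ cm H); apply: conj_exp_gt0.
  by case: (m) om => // m' _; rewrite doubleS.
have [xiT {}H] := (hullE K_nonempty xi q0).1 H.
apply: (hullE K_nonempty xi p0).2; split=> //.
exact: (approximable_lower K_nonempty p0 (ltW hpq) H).
Qed.
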